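(* For every $d\ge 3$ and $\varepsilon>0$ there exist a finite set $S$ and the transition matrix $Q$ of a reversible Markov chain on $S$ such that (i) the spectral radius of $Q$ is less than $\varepsilon$; (ii) the branching Markov process $\nu_Q$ on the $d$-regular tree $T_d$ according to $Q$ is not a typical process, and hence it is not the weak limit of factor of i.i.d. processes.
   Context: The spectral radius of a transition matrix $Q$ means the second largest eigenvalue in absolute value, after the eigenvalue $1$ (eigenvalues counted with multiplicity). $T_d$ is the infinite $d$-regular tree; for a finite set $F$, $I_d(F)$ is the set of Borel probability measures on $F^{V(T_d)}$ invariant under $\mathrm{Aut}(T_d)$, with the weak topology. Branching Markov process $\nu_Q$: let $\pi$ be the reversible stationary distribution of $Q$. Choose the state of a root vertex from $\pi$; then, going outward, given the state $s$ of a vertex, choose the states of its children (neighbors one step farther from the root) conditionally independently from $Q(s,\cdot)$. The law $\nu_Q$ of the resulting random element of $S^{V(T_d)}$ is in $I_d(S)$. Factor of i.i.d.: let $f:[0,1]^{V(T_d^* )}\to S$ be Borel measurable and invariant under root-preserving automorphisms of the rooted tree $T_d^*$. Take i.i.d. uniform $[0,1]$ labels on $V(T_d)$ and give each vertex $v$ the value of $f$ on the labelling with the root placed at $v$; the law of the result is a factor of i.i.d. process. Typical processes: a sequence $\{G_i\}$ of finite $d$-regular graphs is a large girth sequence if for every $\varepsilon'>0$ there is $n$ such that for all $i\ge n$ the probability that a uniformly random vertex of $G_i$ is contained in a cycle of length at most $\lceil 1/\varepsilon'\rceil$ is at most $\varepsilon'$. Colorings $f_i:V(G_i)\to F$ of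 a large girth sequence have Benjamini–Schramm limit $\mu\in I_d(F)$ if for every $r\in\mathbb N$ the law of the (isomorphism class of the) rooted $F$-colored ball of radius $r$ around a uniformly random vertex of $G_i$ converges weakly to the law of the rooted $F$-colored ball of radius $r$ around a fixed vertex in a $\mu$-random coloring of $T_d$. $[\{G_i\}]_F$ is the set of all $\mu\in I_d(F)$ arising as such limits of some $F$-colorings. A process $\mu\in I_d(F)$ is typical if there is a fixed sequence of positive integers $n_i\to\infty$ (with $dn_i$ even) such that, for independent uniformly random $d$-regular graphs $\mathbb G_{n_i}$ on $n_i$ labelled vertices, $\mu\in[\{\mathbb G_{n_i}\}_{i=1}^\infty]_F$ holds with probability $1$. *)

(* Defs.v *)
From HB Require Import structures.
From mathcomp Require Import all_boot all_order all_algebra.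
From mathcomp Require Import complex.
From mathcomp Require Import all_classical all_reals all_analysis.

Set Implicit Arguments.
Unset Strict Implicit.
Unset Printing Implicit Defensive.

Import Order.TTheory GRing.Theory Num.Theory.
Import numFieldNormedType.Exports.

Local Open Scope classical_set_scope.
Local Open Scope ring_scope.

(* The tree T_d is the Cayley graph of the free product of d copies of Z/2:
   vertices are the words over d letters without two equal consecutive letters
   (the last letter added comes first), and the neighbours of a vertex are
   obtained by adding or removing a first letter. *)
Definition reduced (d : nat) (w : seq 'I_d) : bool :=
  sorted [rel a b | a != b] w.

Definition vertex (d : nat) : Type := {w : seq 'I_d | reduced w}.
HB.instance Definition _ (d : nat) := Choice.on (vertex d).

Definition tree_root (d : nat) : vertex d := exist _ [::] isT.

Lemma reduced_behead (d : nat) (w : seq 'I_d) : reduced w -> reduced (behead w).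
Proof. by case: w => //= a w; exact: path_sorted. Qed.

(* By convention the parent of the root is the root itself. *)
Definition parent (d : nat) (v : vertex d) : vertex d :=
  exist _ (behead (val v)) (reduced_behead (valP v)).

Definition tadj (d : nat) : rel (vertex d) := fun u v =>
  ((v != tree_root d) && (parent v == u)) ||
  ((u != tree_root d) && (parent u == v)).

Definition tree_aut (d : nat) (phi : vertex d -> vertex d) : Prop :=
  bijective phi /\ forall u v, tadj (phi u) (phi v) = tadj u v.

(* Nonempty finite sets: the measurable types of the library are pointed. *)
#[short(type="pfinType")]
HB.structure Definition PointedFinite := {T of Finite T & Pointed T}.

Definition discrete (F : pfinType) : Type := discrete_topology F.
HB.instance Definition _ (F : pfinType) := DiscreteTopology.on (discrete F).
HB.instance Definition _ (F : pfinType) := Pointed.on (discrete F).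

(* X^{V(T_d)} with the product topology and its Borel sigma-algebra. *)
Definition config (d : nat) (X : ptopologicalType) : Type :=
  g_sigma_algebraType (@open {ptws vertex d -> X}).
HB.instance Definition _ (d : nat) (X : ptopologicalType) :=
  Measurable.on (config d X).

(* Borel probability measures on F^{V(T_d)}. *)
Definition process (R : realType) (d : nat) (F : pfinType) : Type :=
  probability (config d (discrete F)) R.

Definition aut_invariant (R : realType) (d : nat) (F : pfinType)
    (mu : process R d F) : Prop :=
  forall phi : vertex d -> vertex d, tree_aut phi ->
  forall A : set (config d (discrete F)), measurable A ->
    mu [set x | A (fun v => x (phi v))] = mu A.

(* F^{V(T_d)} is compact, so that all its continuous real functions
   are bounded. *)
Definition weak_cvg (R : realType) (d : nat) (F : pfinType)
    (mu_ : nat -> process R d F) (mu : process R d F) : Prop :=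
  forall g : {ptws vertex d -> discrete F} -> R, continuous g ->
    (fun k => \int[mu_ k]_x (g x)%:E)%E @ \oo --> (\int[mu]_x (g x)%:E)%E.

(* Mutual independence of a family of classes of events. *)
Definition mutually_independent (R : realType) (dO : measure_display)
    (Omega : measurableType dO) (P : probability Omega R) (I : choiceType)
    (E : I -> set (set Omega)) : Prop :=
  forall (J : seq I) (A : I -> set Omega), uniq J ->
    (forall i, i \in J -> E i (A i)) ->
    P (\bigcap_(i in [set` J]) A i) = (\prod_(i <- J) P (A i))%E.

Definition iid_uniform (R : realType) (d : nat) (dO : measure_display)
    (Omega : measurableType dO) (P : probability Omega R)
    (X : vertex d -> Omega -> R) : Prop :=
  [/\ (forall v w, 0 <= X v w <= 1),
      (forall v, measurable_fun setT (X v)),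
      (forall v (B : set R), measurable B ->
         P (X v @^-1` B) = uniform_prob (@ltr01 R) B)
    & mutually_independent P (fun v => [set X v @^-1` B | B in measurable])].

Definition unit_cube (R : realType) (d : nat) : set (config d R) :=
  [set x | forall v, 0 <= x v <= 1].

(* f is Borel measurable [0,1]^{V(T_d)} -> F and invariant under the
   automorphisms of T_d that fix the root; its values outside [0,1]^{V(T_d)} are
   irrelevant. *)
Definition factor_rule (R : realType) (d : nat) (F : pfinType)
    (f : config d R -> F) : Prop :=
  (forall B : set F, measurable (@unit_cube R d `&` f @^-1` B)) /\
  (forall (phi : vertex d -> vertex d) (x : config d R),
     tree_aut phi -> phi (tree_root d) = tree_root d -> unit_cube x ->
     f (fun v => x (phi v)) = f x).

(* The labelling x with the root placed at v is u |-> x (phi u), for any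
   automorphism phi mapping the root to v; f does not depend on the choice of phi. *)
Definition factor_of_iid (R : realType) (d : nat) (F : pfinType)
    (mu : process R d F) : Prop :=
  exists f : config d R -> F, factor_rule f /\
  exists (dO : measure_display) (Omega : measurableType dO)
    (P : probability Omega R) (X : vertex d -> Omega -> R)
    (Y : Omega -> config d (discrete F)),
  [/\ iid_uniform P X,
      (forall (w : Omega) (phi : vertex d -> vertex d), tree_aut phi ->
         Y w (phi (tree_root d)) = f (fun u => X (phi u) w))
    & (forall A, measurable A -> mu A = P (Y @^-1` A))].

Definition weak_limit_of_fiid (R : realType) (d : nat) (F : pfinType)
    (mu : process R d F) : Prop :=
  exists mu_ : nat -> process R d F,
    (forall k, factor_of_iid (mu_ k)) /\ weak_cvg mu_ mu.

(* A graph on V is given by the set E of its ordered pairs of adjacent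
   vertices. *)
Definition edge (V : finType) (E : {set V * V}) : rel V :=
  fun u v => (u, v) \in E.

Definition regular_graph (d : nat) (V : finType) (E : {set V * V}) : bool :=
  [&& [forall u, ~~ edge E u u],
      [forall u, forall v, edge E u v == edge E v u]
    & [forall u, #|[pred v | edge E u v]| == d]].

Definition in_short_cycle (R : realType) (V : finType) (E : {set V * V})
    (eps : R) (v : V) : Prop :=
  exists c : seq V, [/\ ucycle (edge E) c, (2 < size c)%N, v \in c
                      & (size c)%:Z <= Num.ceil eps^-1].

Definition vertex_frequency (R : realType) (V : finType) (A : V -> Prop) : R :=
  #|[pred v : V | `[< A v >]]|%:R / #|V|%:R.

Definition large_girth (R : realType) (V : nat -> finType)
    (E : forall i, {set V i * V i}) : Prop :=
  forall eps : R, 0 < eps -> exists n : nat, forall i, (n <= i)%N ->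
    vertex_frequency R (in_short_cycle (E i) eps) <= eps.

Record rooted_colored_graph (F : Type) := RootedColoredGraph {
  rcg_size : nat;
  rcg_adj : rel 'I_rcg_size;
  rcg_root : 'I_rcg_size;
  rcg_color : 'I_rcg_size -> F }.
Arguments rcg_adj {F} _ _ _.
Arguments rcg_color {F} _ _.

Definition in_ball (V : eqType) (e : rel V) (v : V) (r : nat) (u : V) : Prop :=
  exists p : seq V, [/\ path e v p, last v p = u & (size p <= r)%N].

(* The colored r-ball around v in the graph e with coloring c, rooted at v, is
   isomorphic to H. *)
Definition ball_iso (F : Type) (V : eqType) (e : rel V) (c : V -> F) (r : nat)
    (H : rooted_colored_graph F) (v : V) : Prop :=
  exists phi : 'I_(rcg_size H) -> V,
  [/\ injective phi,
      (forall u, in_ball e v r u <-> exists i, phi i = u),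
      phi (rcg_root H) = v,
      (forall i j, e (phi i) (phi j) = rcg_adj H i j)
    & (forall i, c (phi i) = rcg_color H i)].

(* Isomorphism classes of finite rooted colored graphs form a countable discrete
   space, on which the weak convergence of probability measures is the
   convergence of the mass of every point. *)
Definition benjamini_schramm_limit (R : realType) (d : nat) (F : pfinType)
    (V : nat -> finType) (E : forall i, {set V i * V i})
    (f : forall i, V i -> F) (mu : process R d F) : Prop :=
  forall (r : nat) (H : rooted_colored_graph F),
    (fun i => (vertex_frequency R (ball_iso (edge (E i)) (f i) r H))%:E)
      @ \oo -->
    mu [set x | ball_iso (@tadj d) x r H (tree_root d)].

(* mu belongs to [{G_i}]_F, the set of limits of colorings of the large girth
   sequence G_i = (V i, E i). *)
Definition limit_of_colorings (R : realType) (d : nat) (F : pfinType)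
    (V : nat -> finType) (E : forall i, {set V i * V i}) (mu : process R d F)
    : Prop :=
  [/\ large_girth R E, aut_invariant mu
    & exists f : forall i, V i -> F, benjamini_schramm_limit E f mu].

(* When no simple d-regular graph on n i labelled vertices exists, no G
   satisfies this. *)
Definition independent_uniform_regular_graphs (R : realType) (d : nat)
    (n : nat -> nat) (dO : measure_display) (Omega : measurableType dO)
    (P : probability Omega R)
    (G : forall i, Omega -> {set 'I_(n i) * 'I_(n i)}) : Prop :=
  [/\ (forall i E, measurable (G i @^-1` [set E])),
      (forall i E, P (G i @^-1` [set E]) =
         ((regular_graph d E)%:R /
          #|[pred E' : {set 'I_(n i) * 'I_(n i)} | regular_graph d E']|%:R)%:E)
    & mutually_independent P (fun i => [set G i @^-1` B | B in setT])].

Definition typical (R : realType) (d : nat) (F : pfinType)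
    (mu : process R d F) : Prop :=
  aut_invariant mu /\
  exists n : nat -> nat,
  [/\ (forall i, (0 < n i)%N), (forall i, ~~ odd (d * n i)), n @ \oo --> \oo
    & exists (dO : measure_display) (Omega : measurableType dO)
        (P : probability Omega R)
        (G : forall i, Omega -> {set 'I_(n i) * 'I_(n i)}),
      independent_uniform_regular_graphs d P G /\
      {ae P, forall w, limit_of_colorings (fun i => G i w) mu}].

Definition transition_matrix (R : realType) (S : finType) (Q : S -> S -> R)
    : Prop :=
  (forall s t, 0 <= Q s t) /\ (forall s, \sum_t Q s t = 1).

Definition reversible_distribution (R : realType) (S : finType)
    (Q : S -> S -> R) (pi : S -> R) : Prop :=
  [/\ (forall s, 0 <= pi s), \sum_s pi s = 1
    & (forall s t, pi s * Q s t = pi t * Q t s)].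

(* The complex eigenvalues, with algebraic multiplicity. *)
Definition eigenvalues (R : realType) (S : finType) (Q : S -> S -> R)
    : seq R[i] :=
  sval (closed_field_poly_normal
    (char_poly (\matrix_(i < #|S|, j < #|S|)
                  (Q (enum_val i) (enum_val j))%:C%C))).

(* [rem] removes a single occurrence of the eigenvalue 1. *)
Definition spectral_radius (R : realType) (S : finType) (Q : S -> S -> R) : R :=
  \big[Num.max/0]_(z <- rem 1 (eigenvalues Q)) ComplexField.Normc.normc z.

(* The joint law of the states on a finite set A of vertices that contains the
   root and is closed under taking parents, when the state of the root is chosen
   from pi and that of every other vertex v from Q (s, .), where s is the state
   of the parent of v. *)
Definition branching_markov (R : realType) (d : nat) (S : pfinType)
    (Q : S -> S -> R) (pi : S -> R) (nu : process R d S) : Prop :=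
  forall A : seq (vertex d), uniq A -> tree_root d \in A ->
    (forall v, v \in A -> parent v \in A) ->
  forall x : vertex d -> S,
    nu [set y | forall v, v \in A -> y v = x v] =
    (pi (x (tree_root d)) *
     \prod_(v <- A | v != tree_root d) Q (x (parent v)) (x v))%:E.

(* Main.v *)
(* The states are the vectors of F_q^10 for a large prime q, and one step adds
   y (1, x, ..., x^9) for uniform x, y in F_q.  Every additive character is an
   eigenfunction; its eigenvalue is (number of roots of a polynomial)/q, where
   the polynomial has degree at most 9 and vanishes only for the trivial
   character.  So the spectral radius is at most 9/q, although a state has only
   q^2 of the q^10 states as successors.

   If the branching process were typical, then almost all d-regular graphs on n
   vertices would have a colouring by N = q^10 states in which every state is
   used about n/N times and almost all edges join admissible pairs.  A fixed
   colouring of this kind leaves only a fraction of about 2 q^(-8) of all pairs,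
   hence of about q^(-4nd) of all d-regular graphs, against N^n = q^(10n)
   colourings; for d >= 3 and large q such graphs are exponentially rare.  The
   lower bound on the number of d-regular graphs comes from switchings.

   For factors of i.i.d. the same count is run over random m-lifts of (the
   bipartite double cover of) the Cayley graph of a finite quotient of the free
   product of d copies of Z/2.  Up to a small error the factor is a rule of
   finite radius; the quotient is chosen so large that balls in every lift look
   like balls in the tree, so that the rule applied to i.i.d. labels of the lift
   colours every lift well, which the count forbids. *)

Require Import Defs.
From HB Require Import structures.
From mathcomp Require Import all_boot all_order all_algebra all_fingroup.
From mathcomp Require Import zify ring lra.
From mathcomp Require Import complex.
From mathcomp Require Import all_classical all_reals all_analysis.
From mathcomp Require Import measurable_realfun.

Set Implicit Arguments.
Unset Strict Implicit.
Unset Printing Implicit Defensive.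

(** * Switchings and the number of regular graphs *)

(** The dimension 10 is a balance of exponents. With q^D states and q^2 successors, a colouring is
    compatible with a fraction of about q^(-(D-2)nd/2) of the graphs, and there are q^(Dn)
    colourings; so (D-2)d/2 > D is required, which for d = 3 means D > 6. D = 10 gives 12n against
    10n, and the margin pays for the few edges that may be inadmissible. A lift has 2|K|m vertices
    and d|K|m edges, so the balance is the same there: 8d >= 24 against 20, in units of |K|m. All
    other losses, such as e^(3n) in the count of compatible graphs and C^n in the lower bound for
    the number of regular graphs, have the form c^n with c independent of q and are absorbed by a
    large q. Hence a count of regular graphs up to such a factor suffices. The double cover turns
    the d|K| fibre permutations into free parameters: in a plain lift an edge read backwards would
    have to carry the inverse permutation. *)

Lemma card_dep_pairs (T1 T2 : finType) (P : pred T1) (Q : T1 -> pred T2) :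
  #|[pred q : T1 * T2 | P q.1 && Q q.1 q.2]| = \sum_(x | P x) #|Q x|.
Proof.
rewrite -sum1_card -(pair_big_dep P Q (fun _ _ => 1)) /=.
by apply: eq_bigr => x _; rewrite sum1_card.
Qed.

Definition nbrs (V : finType) (E : {set V * V}) (u : V) : {set V} :=
  [set v | (u, v) \in E].

Lemma card_edges_from (V : finType) (E : {set V * V}) (T : {set V}) :
  #|[set p in E | p.1 \in T]| = \sum_(u in T) #|nbrs E u|.
Proof.
rewrite -(card_dep_pairs (mem T) (fun u => mem (nbrs E u))).
by apply: eq_card => -[u v]; rewrite !inE /= andbC.
Qed.

Definition simple_graph (V : finType) (E : {set V * V}) : bool :=
  [forall u, (u, u) \notin E] &&
  [forall u, forall v, ((u, v) \in E) == ((v, u) \in E)].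

Lemma simple_graphP (V : finType) (E : {set V * V}) :
  reflect ((forall u, (u, u) \in E = false) /\
           (forall u v, ((u, v) \in E) = ((v, u) \in E))) (simple_graph E).
Proof.
apply: (iffP andP) => -[h1 h2]; split.
- by move=> u; apply/negbTE/(forallP h1).
- by move=> u v; apply/eqP/(forallP (forallP h2 u)).
- by apply/forallP => u; rewrite h1.
- by apply/forallP => u; apply/forallP => v; rewrite h2.
Qed.

Lemma regular_graphE (d : nat) (V : finType) (E : {set V * V}) :
  regular_graph d E =
  simple_graph E && [forall u, #|nbrs E u| == d].
Proof.
rewrite /regular_graph /simple_graph -andbA; congr [&& _, _ & _].
apply: eq_forallb => u; congr (_ == _).
by apply: eq_card => v; rewrite !inE.
Qed.

Lemma card_edges_to (V : finType) (E : {set V * V}) (T : {set V}) :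
  simple_graph E -> #|[set p in E | p.2 \in T]| = \sum_(u in T) #|nbrs E u|.
Proof.
move=> /simple_graphP[_ sE]; rewrite -card_edges_from.
have swap_inj : injective (fun p : V * V => (p.2, p.1)) by move=> [? ?] [? ?] [-> ->].
rewrite -(card_imset _ swap_inj); apply: eq_card => -[u v].
apply/imsetP/idP => [[[x y]]|].
  by rewrite !inE /= sE => h [-> ->].
rewrite !inE /= => h; exists (v, u) => //.
by rewrite !inE /= sE.
Qed.

Section Switch.
Variables (d : nat) (V : finType) (a b : V).
Hypothesis ab : a != b.

(* Deleting an edge uv away from a and b and adding ua and vb raises the degrees
   of a and b by one.  After d such steps, two isolated vertices added to a
   d-regular graph on n vertices are absorbed into a d-regular graph on n + 2. *)
Definition pendant_graph (j : nat) (E : {set V * V}) : bool :=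
  [&& simple_graph E, (a, b) \notin E, #|nbrs E a| == j, #|nbrs E b| == j
    & [forall u, (u \notin [set a; b]) ==> (#|nbrs E u| == d)]].

(** The exclusions keep the two new edges from being loops or already present, so that the result is
    simple and the degrees of [a] and [b] do grow. The pair is ordered: its first entry will be
    joined to [a], its second to [b]. *)
Definition switchable (E : {set V * V}) (p : V * V) : bool :=
  [&& p \in E, p.1 \notin [set a; b] :|: nbrs E a
    & p.2 \notin [set a; b] :|: nbrs E b].

Definition switch (E : {set V * V}) (p : V * V) : {set V * V} :=
  (E :\: [set (p.1, p.2); (p.2, p.1)]) :|:
  [set (p.1, a); (a, p.1); (p.2, b); (b, p.2)].

Definition unswitch (E : {set V * V}) (p : V * V) : {set V * V} :=
  (E :\: [set (p.1, a); (a, p.1); (p.2, b); (b, p.2)]) :|: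
  [set (p.1, p.2); (p.2, p.1)].

Lemma switchK (E : {set V * V}) (p : V * V) :
  simple_graph E -> switchable E p -> unswitch (switch E p) p = E.
Proof.
move=> /simple_graphP[iE sE]; case: p => u v /and3P[/= uvE].
rewrite !inE !negb_or => /andP[/andP[ua ub] uNa] /andP[/andP[va vb] vNb].
have vuE : (v, u) \in E by rewrite sE.
have auE : (a, u) \in E = false by apply/negbTE.
have uaE : (u, a) \in E = false by rewrite sE.
have bvE : (b, v) \in E = false by apply/negbTE.
have vbE : (v, b) \in E = false by rewrite sE.
apply/setP => -[x y]; rewrite /unswitch /switch !inE /=.
have [->|n1] := eqVneq (x, y) (u, v); first by rewrite uvE /= orbT.
have [->|n2] := eqVneq (x, y) (v, u); first by rewrite vuE /= orbT.
rewrite /= orbF; set c := (X in ~~ X).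
rewrite orbC; have [/= cT|/negbTE] := boolP c; last by rewrite /c => -> /=.
apply/esym/negbTE; move: cT; rewrite /c => /orP[/orP[/orP[]|]|] /eqP ->;
  by rewrite ?auE ?uaE ?bvE ?vbE.
Qed.

Lemma nbrs_switch_a E u v : simple_graph E -> switchable E (u, v) ->
  nbrs (switch E (u, v)) a = u |: nbrs E a.
Proof.
move=> /simple_graphP[iE sE] /and3P[/= uvE].
rewrite !inE !negb_or => /andP[/andP[ua ub] uNa] /andP[/andP[va vb] vNb].
apply/setP => y; rewrite !inE /= !xpair_eqE eqxx /=.
rewrite ![a == _]eq_sym (negbTE ua) (negbTE va) [b == a]eq_sym (negbTE ab) /=.
by rewrite ?orbF orbC.
Qed.

Lemma nbrs_switch_b E u v : simple_graph E -> switchable E (u, v) ->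
  nbrs (switch E (u, v)) b = v |: nbrs E b.
Proof.
move=> /simple_graphP[iE sE] /and3P[/= uvE].
rewrite !inE !negb_or => /andP[/andP[ua ub] uNa] /andP[/andP[va vb] vNb].
apply/setP => y; rewrite !inE /= !xpair_eqE eqxx /=.
rewrite ![b == _]eq_sym (negbTE ub) (negbTE vb) (negbTE ab) /=.
by rewrite ?orbF orbC.
Qed.

Lemma nbrs_switch_u E u v : simple_graph E -> switchable E (u, v) ->
  nbrs (switch E (u, v)) u = a |: (nbrs E u :\ v).
Proof.
move=> /simple_graphP[iE sE] /and3P[/= uvE].
rewrite !inE !negb_or => /andP[/andP[ua ub] uNa] /andP[/andP[va vb] vNb].
have uv : (u == v) = false by apply/eqP => uv; rewrite uv iE in uvE.
apply/setP => y; rewrite !inE /= !xpair_eqE eqxx /=.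
rewrite uv (negbTE ua) (negbTE ub) /= !orbF.
by rewrite orbC.
Qed.

Lemma nbrs_switch_v E u v : simple_graph E -> switchable E (u, v) ->
  nbrs (switch E (u, v)) v = b |: (nbrs E v :\ u).
Proof.
move=> /simple_graphP[iE sE] /and3P[/= uvE].
rewrite !inE !negb_or => /andP[/andP[ua ub] uNa] /andP[/andP[va vb] vNb].
have uv : (v == u) = false by apply/eqP => uv; rewrite uv iE in uvE.
apply/setP => y; rewrite !inE /= !xpair_eqE eqxx /=.
rewrite uv (negbTE va) (negbTE vb) /= !orbF.
by rewrite orbC.
Qed.

Lemma nbrs_switch_x E u v x : x \notin [set a; b; u; v] ->
  nbrs (switch E (u, v)) x = nbrs E x.
Proof.
rewrite !inE !negb_or => /andP[/andP[/andP[/negbTE xa /negbTE xb] /negbTE xu] /negbTE xv].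
by apply/setP => y; rewrite !inE /= !xpair_eqE xa xb xu xv /= !orbF.
Qed.

Lemma switch_simple E u v : simple_graph E -> switchable E (u, v) ->
  simple_graph (switch E (u, v)).
Proof.
move=> /simple_graphP[iE sE] /and3P[/= uvE].
rewrite !inE !negb_or => /andP[/andP[ua ub] uNa] /andP[/andP[va vb] vNb].
apply/simple_graphP; split => [x|x y].
  rewrite !inE iE andbF /= !xpair_eqE.
  apply/negbTE; rewrite !negb_or !negb_and.
  have [->|] := eqVneq x u; first by rewrite ua ub /= ?orbT.
  have [->|] := eqVneq x v; first by rewrite va vb /= ?orbT.
  by rewrite ?orbT.
rewrite !inE sE !xpair_eqE /=.
rewrite [(y == u) && (x == v)]andbC [(y == v) && (x == u)]andbC.
rewrite [(y == u) && (x == a)]andbC [(y == a) && (x == u)]andbC.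
rewrite [(y == v) && (x == b)]andbC [(y == b) && (x == v)]andbC.
rewrite [X in ~~ X && _]orbC; congr orb.
rewrite -!orbA; do !case: (_ && _) => //=.
Qed.

Lemma switch_pendant j E u v :
  pendant_graph j E -> switchable E (u, v) ->
  [/\ pendant_graph j.+1 (switch E (u, v)),
      u \in nbrs (switch E (u, v)) a & v \in nbrs (switch E (u, v)) b].
Proof.
move=> /and5P[gE abE /eqP da /eqP db /forallP dE] sw.
rewrite nbrs_switch_a // nbrs_switch_b // !setU11; split => //.
have [iE sE] := simple_graphP _ gE.
have /and3P[/= uvE] := sw.
rewrite !inE !negb_or => /andP[/andP[ua ub] uNa] /andP[/andP[va vb] vNb].
rewrite /pendant_graph switch_simple // nbrs_switch_a // nbrs_switch_b //.
rewrite !cardsU1 !inE uNa vNb da db !add1n !eqxx /=; apply/andP; split.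
  rewrite !xpair_eqE (negbTE abE) andbF /=.
  by rewrite [a == u]eq_sym [a == v]eq_sym [b == u]eq_sym (negbTE ua) (negbTE ub) (negbTE va) (negbTE ab) /= ?andbF.
apply/forallP => x; apply/implyP => xab.
have := implyP (dE x) xab => /eqP dx.
have [xu|nxu] := eqVneq x u.
  rewrite xu nbrs_switch_u // cardsU1 !inE [(u, a) \in E]sE (negbTE uNa) andbF /=.
  by have := cardsD1 v (nbrs E u); rewrite inE uvE -xu dx => ->.
have [xv|nxv] := eqVneq x v.
  rewrite xv nbrs_switch_v // cardsU1 !inE [(v, b) \in E]sE (negbTE vNb) andbF /=.
  by have := cardsD1 u (nbrs E v); rewrite inE sE uvE -xv dx => ->.
rewrite nbrs_switch_x ?dx // !inE !negb_or nxu nxv !andbT.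
by move: xab; rewrite !inE negb_or.
Qed.

(** At most d + 2 vertices are forbidden as first end and as many as second end, and each carries at
    most d edges. Edges leaving [a] and [b] are left out of the main term because the degree j of
    these two may be small. *)
Lemma card_switchable j E : (j <= d)%N -> pendant_graph j E ->
  ((#|V| - 2) * d - 2 * d * (d + 2) <= #|switchable E|)%N.
Proof.
move=> jd /and5P[gE abE /eqP da /eqP db /forallP dE].
have ledeg u : #|nbrs E u| <= d.
  case: (boolP (u \in [set a; b])) => [|/(implyP (dE u))/eqP-> //].
  by rewrite !inE => /orP[] /eqP ->; rewrite ?da ?db.
set Ta := [set a; b] :|: nbrs E a; set Tb := [set a; b] :|: nbrs E b.
have cardT (T : {set V}) : #|T| <= d + 2 -> \sum_(u in T) #|nbrs E u| <= d * (d + 2).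
  move=> hT; apply: (@leq_trans (\sum_(u in T) d)); first exact: leq_sum.
  by rewrite sum_nat_const mulnC leq_mul2l hT orbT.
have hTa : #|Ta| <= d + 2.
  by apply: leq_trans (leq_card_setU _ _) _; rewrite cards2 ab da addnC leq_add2r.
have hTb : #|Tb| <= d + 2.
  by apply: leq_trans (leq_card_setU _ _) _; rewrite cards2 ab db addnC leq_add2r.
have hE : (#|V| - 2) * d <= #|E|.
  have -> : #|E| = #|[set p in E | p.1 \in [set: V]]|.
    by apply: eq_card => p; rewrite !inE andbT.
  rewrite card_edges_from (bigID (mem [set a; b])) /=.
  apply: leq_trans (leq_addl _ _).
  rewrite (eq_bigr (fun=> d)); last first.
    by move=> u /andP[_ /(implyP (dE u))/eqP].
  rewrite sum_nat_const leq_mul2r; apply/orP; right.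
  rewrite [X in (_ <= X)%N](@eq_card _ _ (mem (~: [set a; b]))); last by move=> u; rewrite unfold_in /= !inE.
  by rewrite cardsCs finset.setCK cards2 ab.
have sub : E \subset [set p | switchable E p] :|:
    ([set p in E | p.1 \in Ta] :|: [set p in E | p.2 \in Tb]).
  apply/fintype.subsetP => p pE; apply/setUP.
  have [sp|] := boolP (switchable E p); first by left; rewrite finset.in_set.
  rewrite /switchable pE /= negb_and !negbK => /orP[] h; right.
    by apply/setUP; left; rewrite finset.in_set pE.
  by apply/setUP; right; rewrite finset.in_set pE.
rewrite leq_subLR; apply: leq_trans hE (leq_trans (subset_leq_card sub) _).
apply: leq_trans (leq_card_setU _ _) _; rewrite addnC; apply: leq_add; last by rewrite cardsE.
apply: leq_trans (leq_card_setU _ _) _.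
rewrite card_edges_from card_edges_to //.
by have := cardT _ hTa; have := cardT _ hTb; lia.
Qed.

(** Double counting of pairs (graph, switch). By [switchK] a switch can be undone once its pair is
    known, and that pair is a neighbour of [a] together with a neighbour of [b] in the new graph: at
    most d^2 choices. *)
Lemma card_pendant_step j : (j < d)%N ->
  (#|pendant_graph j| * ((#|V| - 2) * d - 2 * d * (d + 2))
    <= #|pendant_graph j.+1| * d ^ 2)%N.
Proof.
move=> jd.
pose P := [pred q : {set V * V} * (V * V) | pendant_graph j q.1 && switchable q.1 q.2].
pose P' := [pred q : {set V * V} * (V * V) | pendant_graph j.+1 q.1 &&
  [pred p : V * V | (p.1 \in nbrs q.1 a) && (p.2 \in nbrs q.1 b)] q.2].
apply: (@leq_trans #|P|).
  rewrite card_dep_pairs -sum_nat_const; apply: leq_sum => E pE.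
  by apply: card_switchable pE; exact: ltnW.
apply: (@leq_trans #|P'|); last first.
  rewrite (card_dep_pairs _ (fun E => [pred p : V * V | (p.1 \in nbrs E a) && (p.2 \in nbrs E b)])).
  rewrite -sum_nat_const; apply: leq_sum => E /and5P[_ _ /eqP da /eqP db _].
  rewrite (card_dep_pairs (mem (nbrs E a)) (fun=> mem (nbrs E b))).
  by rewrite sum_nat_const da db -mulnn leq_mul.
pose f (q : {set V * V} * (V * V)) := (switch q.1 q.2, q.2).
have f_inj : {in P &, injective f}.
  move=> [E p] [E' p'] /andP[/= /and5P[gE _ _ _ _] sE] /andP[/= /and5P[gE' _ _ _ _] sE'].
  move=> [h pp']; rewrite -{p'}pp' in h sE' *.
  by rewrite -(switchK gE sE) h switchK.
rewrite -(card_in_imset f_inj); apply: subset_leq_card; apply/fintype.subsetP => q.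
move=> /imsetP[[E [u v]] /andP[/= pE sE] ->].
by have [h1 h2 h3] := switch_pendant pE sE; apply/and3P; split.
Qed.

Lemma card_pendant (n : nat) :
  (n <= (#|V| - 2) * d - 2 * d * (d + 2))%N ->
  (#|pendant_graph 0| * n ^ d <= #|pendant_graph d| * (d ^ 2) ^ d)%N.
Proof.
move=> hn; suff h j : (j <= d)%N ->
    (#|pendant_graph 0| * n ^ j <= #|pendant_graph j| * (d ^ 2) ^ j)%N by exact: h.
elim: j => [|j IH] jd; first by rewrite !expn0.
have := IH (ltnW jd); have := card_pendant_step jd.
rewrite (expnS n) (expnS (d ^ 2)) => h1 h2.
have h3 : #|pendant_graph j| * n <= #|pendant_graph j.+1| * d ^ 2.
  by apply: leq_trans h1; rewrite leq_mul2l hn orbT.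
rewrite mulnCA; apply: (@leq_trans (n * (#|pendant_graph j| * (d ^ 2) ^ j))).
  by rewrite leq_mul2l h2 orbT.
rewrite mulnA [n * _]mulnC; rewrite [in leqRHS]mulnA.
by rewrite leq_mul2r h3 orbT.
Qed.

End Switch.

Section RegularCount.
Variable d : nat.

Definition num_regular (n : nat) : nat :=
  #|[pred E : {set 'I_n * 'I_n} | regular_graph d E]|.

Let wid (n : nat) : 'I_n -> 'I_n.+2 := widen_ord (leqW (leqnSn n)).
Let wid2 (n : nat) (p : 'I_n * 'I_n) := (wid p.1, wid p.2).

(** [ord_max] and [lift ord_max ord_max] are the vertices n + 1 and n, which stay isolated when a
    graph on n vertices is carried over. *)
Lemma num_regular_le_pendant (n : nat) :
  num_regular n <= #|pendant_graph d (ord_max : 'I_n.+2) (lift ord_max ord_max) 0|.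
Proof.
set a := ord_max : 'I_n.+2; set b := lift _ _ : 'I_n.+2.
have wid_inj : injective (@wid n) by move=> x y [] /val_inj.
have wid2_inj : injective (@wid2 n) by move=> [x y] [x' y'] [] /val_inj -> /val_inj ->.
have wa x : (wid x == a) = false.
  by apply/negbTE/eqP => /(congr1 val) /= h; have := ltn_ord x; rewrite h; lia.
have vb : val b = n by rewrite /b /= /bump; lia.
have wb x : (wid x == b) = false.
  by apply/negbTE/eqP => /(congr1 val); rewrite vb /= => h; have := ltn_ord x; rewrite h; lia.
have wsurj u : u \notin [set a; b] -> exists x, u = wid x.
  rewrite !inE negb_or => /andP[/eqP ua /eqP ub].
  have hu : u < n.
    have := ltn_ord u; rewrite !ltnS leq_eqVlt => /orP[/eqP h|].
      by case: ua; apply: val_inj.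
    rewrite ltnS leq_eqVlt => /orP[/eqP h|//].
    by case: ub; apply: val_inj; rewrite vb.
  by exists (Ordinal hu); apply: val_inj.
have nbw (E : {set 'I_n * 'I_n}) x : nbrs (@wid2 n @: E) (wid x) = @wid n @: nbrs E x.
  apply/setP => y; rewrite inE; apply/imsetP/imsetP => [[[x' y'] h] [e1 e2]|[y']].
    by exists y' => //; rewrite inE (val_inj e1).
  by rewrite inE => h ->; exists (x, y').
have nb0 (E : {set 'I_n * 'I_n}) c : (forall x, (wid x == c) = false) -> nbrs (@wid2 n @: E) c = finset.set0.
  move=> hc; apply/setP => y; rewrite !inE; apply/negbTE/imsetP => -[[x' y'] _ [e _]].
  by have := hc x'; rewrite e eqxx.
rewrite /num_regular -(card_imset _ (imset_inj wid2_inj)).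
apply: subset_leq_card; apply/fintype.subsetP => E' /imsetP[E].
rewrite inE regular_graphE => /andP[/simple_graphP[iE sE] /forallP dE] ->.
apply/and5P; split.
- apply/simple_graphP; split => [u|u v].
    by apply/negbTE/imsetP => -[[x y] h [-> /wid_inj xy]]; rewrite xy iE in h.
  by apply/imsetP/imsetP => -[[x y] h [-> ->]]; exists (y, x) => //; rewrite sE.
- by apply/imsetP => -[[x y] h /(congr1 fst) /= e]; have := wa x; rewrite -e eqxx.
- by rewrite nb0 ?cards0.
- by rewrite nb0 ?cards0.
apply/forallP => u; apply/implyP => /wsurj[x ->].
by rewrite nbw card_imset.
Qed.

Lemma pendant_le_num_regular (n : nat) :
  #|pendant_graph d (ord_max : 'I_n.+2) (lift ord_max ord_max) d| <= num_regular n.+2.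
Proof.
apply: subset_leq_card; apply/fintype.subsetP => E /and5P[gE _ ha hb /forallP dE].
rewrite inE regular_graphE gE; apply/forallP => u.
have [|h] := boolP (u \in [set (ord_max : 'I_n.+2); lift ord_max ord_max]).
  by rewrite !inE => /orP[] /eqP ->.
exact: implyP (dE u) h.
Qed.

Lemma num_regular_step (n : nat) : 1 < d -> 4 * d + 8 <= n ->
  num_regular n * n ^ d <= num_regular n.+2 * (d ^ 2) ^ d.
Proof.
move=> d1 hn; have ab : (ord_max : 'I_n.+2) != lift ord_max ord_max.
  by apply/eqP => /(congr1 val); rewrite /= /bump; lia.
apply: leq_trans (leq_trans (@card_pendant d _ _ _ ab n _) _).
- by rewrite leq_mul2r num_regular_le_pendant orbT.
(* The number of switches, at least nd - 2d(d + 2), must be at least n; for d >= 2 this follows from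
   n >= 4(d + 2). *)
- by rewrite card_ord; nia.
by rewrite leq_mul2r pendant_le_num_regular orbT.
Qed.

Let C := (2 ^ d * (d ^ 2) ^ d).

(** Two new vertices multiply the number of graphs by n^d up to a constant, but n!^d by about
    n^(2d); hence the square on the right. In [C] the factor 2^d comes from (n+2)(n+1) <= (2n)^2 and
    the factor d^(2d) from the switchings; each step of two vertices uses up [C ^ 2]. *)
Lemma num_regular_growth (n0 k : nat) : 1 < d -> 4 * d + 8 <= n0 ->
  0 < num_regular n0 ->
  (n0 + k.*2)`! ^ d <= n0`! ^ d * C ^ (n0 + k.*2) * num_regular (n0 + k.*2) ^ 2.
Proof.
move=> d1 hn0 N0; have C0 : 0 < C by rewrite /C !(muln_gt0, expn_gt0); lia.
elim: k => [|k IH].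
  rewrite addn0 -{1}[_ ^ d]muln1 -mulnA leq_mul2l; apply/orP; right.
  by rewrite muln_gt0 !expn_gt0 C0 N0.
have -> : n0 + k.+1.*2 = (n0 + k.*2).+2 by rewrite doubleS !addnS.
have : 4 * d + 8 <= n0 + k.*2 by apply: leq_trans hn0 (leq_addr _ _).
move: (n0 + k.*2) IH => n IH hn.
have st := num_regular_step d1 hn.
have e : n.+2`! <= (2 * n) ^ 2 * n`!.
  by rewrite !factS mulnA leq_mul2r; apply/orP; right; rewrite -mulnn; nia.
apply: (@leq_trans (((2 * n) ^ 2 * n`!) ^ d)); first by rewrite leq_exp2r // ltnW.
have -> : ((2 * n) ^ 2 * n`!) ^ d = (2 ^ d) ^ 2 * (n ^ d) ^ 2 * n`! ^ d.
  by rewrite -(expnAC 2 2 d) -(expnAC n 2 d) -!expnMn.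
apply: (@leq_trans ((2 ^ d) ^ 2 * (n ^ d) ^ 2 * (n0`! ^ d * C ^ n * num_regular n ^ 2))).
  by rewrite leq_mul2l IH orbT.
have -> : (2 ^ d) ^ 2 * (n ^ d) ^ 2 * (n0`! ^ d * C ^ n * num_regular n ^ 2) =
  n0`! ^ d * C ^ n * (2 ^ d) ^ 2 * (num_regular n * n ^ d) ^ 2.
  by rewrite [(num_regular n * _) ^ 2]expnMn; ring.
have -> : n0`! ^ d * C ^ n.+2 * num_regular n.+2 ^ 2 =
   n0`! ^ d * C ^ n * (2 ^ d) ^ 2 * (num_regular n.+2 * (d ^ 2) ^ d) ^ 2.
  have -> : C ^ n.+2 = C ^ n * C ^ 2 by rewrite -expnD addn2.
  by rewrite {2}/C !(expnMn _ _ 2); ring.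
by rewrite leq_mul2l leq_exp2r // st orbT.
Qed.

(* Since the number of vertices grows by two at each step, each parity class
   needs its own starting point, and only exists if d-regular graphs do. *)
Lemma num_regular_lb : 1 < d -> exists C D : nat,
  forall n, 4 * d + 8 <= n -> 0 < num_regular n ->
    n`! ^ d <= D * C ^ n * num_regular n ^ 2.
Proof.
move=> d1; exists C.
have H (p : bool) : exists D : nat,
  forall n, odd n = p -> 4 * d + 8 <= n -> 0 < num_regular n ->
    n`! ^ d <= D * C ^ n * num_regular n ^ 2.
  have [[n0 hn0]|no] := pselect (exists n, [&& odd n == p, 4 * d + 8 <= n & 0 < num_regular n]).
    have ex : exists n, [&& odd n == p, 4 * d + 8 <= n & 0 < num_regular n] by exists n0.
    case: (ex_minnP ex) => {hn0}n0' /and3P[/eqP o h1 h2] hmin.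
    exists (n0'`! ^ d) => n on hn Nn.
    have le : n0' <= n by apply: hmin; rewrite on eqxx hn Nn.
    have -> : n = n0' + (n - n0')./2.*2.
      by have := odd_double_half (n - n0'); rewrite oddB // on o addbb; lia.
    exact: num_regular_growth.
  exists 0 => n on hn Nn; case: no; exists n; by rewrite on eqxx hn Nn.
have [D1 h1] := H true; have [D2 h2] := H false.
exists (D1 + D2) => n hn Nn; case E : (odd n).
  apply: leq_trans (h1 _ E hn Nn) _; rewrite -!mulnA leq_mul2r.
  by rewrite leq_addr orbT.
apply: leq_trans (h2 _ E hn Nn) _; rewrite -!mulnA leq_mul2r.
by rewrite leq_addl orbT.
Qed.

End RegularCount.

(** * The tree as a Cayley graph and its finite quotients *)

Section Words.
Variable d : nat.
Implicit Types (w : seq 'I_d) (a i : 'I_d).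

(* T_d is the Cayley graph of the free product of d copies of Z/2: multiplying
   by a letter on the left crosses an edge, and multiplying on the right is an
   automorphism. *)
Definition lmul a w : seq 'I_d :=
  if w is b :: w' then if b == a then w' else a :: w else [:: a].

(** The letters are involutions, so reversal is inversion in the free product and exchanges left and
    right multiplication. *)
Definition rmul i w : seq 'I_d := rev (lmul i (rev w)).

Lemma reduced_rev w : reduced (rev w) = reduced w.
Proof.
rewrite /reduced rev_sorted; apply: eq_sorted => x y /=.
by rewrite eq_sym.
Qed.

Lemma lmul_reduced a w : reduced w -> reduced (lmul a w).
Proof.
case: w => [//|b w] /= rw; case: eqP => [_|ba]; first exact: path_sorted rw.
by rewrite /reduced /= rw andbT; apply/eqP => ab; apply: ba.
Qed.

Lemma rmul_reduced i w : reduced w -> reduced (rmul i w).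
Proof. by rewrite /rmul reduced_rev => rw; apply: lmul_reduced; rewrite reduced_rev. Qed.

Lemma lmulK a w : reduced w -> lmul a (lmul a w) = w.
Proof.
case: w => [_|b w] /=; first by rewrite eqxx.
case: (b =P a) => [->|ba]; last by rewrite /= eqxx.
by case: w => [//|c w] /= /andP[ac _]; rewrite eq_sym (negbTE ac).
Qed.

Lemma rmulK i w : reduced w -> rmul i (rmul i w) = w.
Proof. by move=> rw; rewrite /rmul revK lmulK ?revK // reduced_rev. Qed.

Lemma rmul_rcons i w c :
  rmul i (rcons w c) = if c == i then w else rcons (rcons w c) i.
Proof.
rewrite /rmul rev_rcons /=; case: eqP => _; first by rewrite revK.
by rewrite !rev_cons revK.
Qed.

(** Associativity in the free product. Since edges are left multiplications, it makes right
    multiplication preserve adjacency. *)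
Lemma lmul_rmul a i w : lmul a (rmul i w) = rmul i (lmul a w).
Proof.
case: w => [|b w].
  rewrite /= -[[:: a]]/(rcons [::] a) rmul_rcons /= eq_sym.
  by case: (_ == _).
case: (lastP w) => [|t c].
  rewrite -[[:: b]]/(rcons [::] b) rmul_rcons /=.
  have [->|bi] := eqVneq b i.
    have [->//|ia] := eqVneq i a.
    by rewrite -[[:: a; i]]/(rcons [:: a] i) rmul_rcons eqxx.
  rewrite /=; have [//|ba] := eqVneq b a.
  by rewrite -[[:: a; b]]/(rcons [:: a] b) rmul_rcons (negbTE bi).
rewrite -rcons_cons rmul_rcons /=.
have [ci|ci] := eqVneq c i; have [ba|ba] := eqVneq b a => /=.
- by rewrite ba eqxx rmul_rcons ci eqxx.
- by rewrite (negbTE ba) -!rcons_cons rmul_rcons ci eqxx.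
- by rewrite ba eqxx rmul_rcons (negbTE ci).
- by rewrite (negbTE ba) -!rcons_cons rmul_rcons (negbTE ci).
Qed.

Lemma size_rmul i w : size (rmul i w) <= (size w).+1.
Proof.
case: (lastP w) => [//|t c]; rewrite rmul_rcons size_rcons.
by case: ifP => _; rewrite ?size_rcons //; lia.
Qed.

Lemma tadjP (u v : vertex d) : reflect (exists a, val v = lmul a (val u)) (tadj u v).
Proof.
apply: (iffP orP) => [[/andP[]|/andP[]]|[a]].
- case: u v => [u ru] [[|a v] rv] /eqP nr /eqP pv; first by case: nr; exact: val_inj.
  exists a; have := congr1 val pv => /= <-.
  have rav : reduced (a :: v) by [].
  move: rav {nr pv rv}; rewrite /reduced; case: v => [//|b v] /= /andP[ab _].
  by rewrite eq_sym (negbTE ab).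
- case: u v => [[|a u] ru] [v rv] /eqP nr /eqP pv; first by case: nr; exact: val_inj.
  by exists a; have := congr1 val pv => /= <-; rewrite eqxx.
case: u v => [[|b u] ru] [v rv] va; simpl in va.
  left; apply/andP; split; first by apply/eqP => /(congr1 val); rewrite /= va.
  by apply/eqP/val_inj; rewrite /= va.
move: va; case: (b =P a) => ba vu.
  right; apply/andP; split; first by apply/eqP => /(congr1 val).
  by apply/eqP/val_inj; rewrite /= vu.
left; apply/andP; split; first by apply/eqP => /(congr1 val); rewrite /= vu.
by apply/eqP/val_inj; rewrite /= vu.
Qed.

Definition vrmul i (v : vertex d) : vertex d :=
  exist _ (rmul i (val v)) (rmul_reduced i (valP v)).

Lemma vrmulK i : involutive (vrmul i).
Proof. by move=> v; apply: val_inj; rewrite /= rmulK //; exact: valP. Qed.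

Lemma tree_aut_vrmul i : tree_aut (vrmul i).
Proof.
split; first exact: inv_bij (vrmulK i).
move=> u v; apply/tadjP/tadjP => -[a] h; exists a; last by rewrite /= lmul_rmul h.
have {}h : rmul i (val v) = rmul i (lmul a (val u)) by rewrite -lmul_rmul.
by rewrite -[LHS](rmulK i (valP v)) h rmulK // lmul_reduced //; exact: valP.
Qed.

Lemma exists_word (n : nat) : 1 < d -> exists v : vertex d, size (val v) = n.
Proof.
move=> d1; pose a : 'I_d := Ordinal (ltnW d1); pose b : 'I_d := Ordinal d1.
pose w := mkseq (fun k => if odd k then a else b) n.
have rw : reduced w.
  apply/(sortedP a) => k; rewrite size_mkseq => kn.
  by rewrite /= !nth_mkseq //=; [case: odd|exact: ltnW].
by exists (exist _ w rw); rewrite /= size_mkseq.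
Qed.

(** The i.i.d. labels come indexed by the tree. An injection of a countable set into its vertices
    yields i.i.d. labels indexed by that set, in particular by the vertices of a lift. *)
Lemma countable_injection (T : countType) : 1 < d -> exists f : T -> vertex d, injective f.
Proof.
move=> d1; pose e n := sval (cid (exists_word n d1)).
have eP n : size (val (e n)) = n := svalP (cid (exists_word n d1)).
exists (fun x => e (pickle x)) => x y /(congr1 (fun v : vertex d => size (val v))).
by rewrite !eP => /(pcan_inj pickleK).
Qed.

End Words.

Section FiniteQuotient.
Variables (d r : nat).

Definition short_word : finType := {w : r.-bseq 'I_d | reduced w}.

(* The free product acts on the ball of radius [r], a letter fixing the words
   that it would take out of the ball.  This makes the symmetric group of the
   ball a finite quotient in which the words of length at most [r] stay distinct. *)
Definition short_lmul_seq (a : 'I_d) (w : seq 'I_d) : seq 'I_d :=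
  if size (lmul a w) <= r then lmul a w else w.

Lemma short_lmul_size a (w : short_word) : size (short_lmul_seq a (val (val w))) <= r.
Proof. by rewrite /short_lmul_seq; case: ifP => // _; exact: size_bseq. Qed.

Lemma short_lmul_reduced a (w : short_word) : reduced (short_lmul_seq a (val (val w))).
Proof.
rewrite /short_lmul_seq; case: ifP => _; last exact: valP w.
by apply: lmul_reduced; exact: valP w.
Qed.

Definition short_lmul (a : 'I_d) (w : short_word) : short_word :=
  exist _ (Bseq (short_lmul_size a w)) (short_lmul_reduced a w).

Lemma short_lmulK a : involutive (short_lmul a).
Proof.
move=> w; apply: val_inj; apply: val_inj; rewrite /= /short_lmul_seq.
have rw : reduced (val (val w)) := valP w.
case: (leqP (size (lmul a (val (val w)))) r) => h.
  by rewrite lmulK // size_bseq.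
by rewrite leqNgt h.
Qed.

Definition gen_perm (a : 'I_d) : {perm short_word} := perm (inv_inj (short_lmulK a)).

Definition shift (a : 'I_d) (k : {perm short_word}) : {perm short_word} := (k * gen_perm a)%g.

Lemma shiftK a : involutive (shift a).
Proof.
move=> k; rewrite /shift -mulgA (_ : (gen_perm a * gen_perm a = 1)%g) ?mulg1 //.
by apply/permP => w; rewrite permM !permE short_lmulK.
Qed.

Lemma foldr_shift (k : {perm short_word}) (u : seq 'I_d) :
  foldr shift k u = (k * foldr shift 1%g u)%g.
Proof. by elim: u => [|a u IH] /=; rewrite ?mulg1 // IH /shift mulgA. Qed.

Definition short_root : short_word := exist _ (Bseq (leq0n r : size [::] <= r)) isT.

(** All suffixes of a short reduced word lie in the ball, so no letter is blocked on the way and the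
    permutation of the word carries the empty word to the word itself. The permutation thus
    determines the word. *)
Lemma foldr_shift_root (u : seq 'I_d) : reduced u -> size u <= r ->
  val (val (foldr shift 1%g u short_root)) = u.
Proof.
elim: u => [|a u IH] /= ru su; first by rewrite perm1.
have ru' : reduced u by exact: path_sorted ru.
rewrite /shift permM permE /= /short_lmul_seq IH ?(ltnW su) //.
have -> : lmul a u = a :: u.
  by case: u ru {IH su ru'} => [//|b u] /= /andP[ab _]; rewrite eq_sym (negbTE ab).
by rewrite /= su.
Qed.

Lemma foldr_shift_inj (k : {perm short_word}) (u u' : seq 'I_d) :
  reduced u -> reduced u' -> size u <= r -> size u' <= r ->
  foldr shift k u = foldr shift k u' -> u = u'.
Proof.
move=> ru ru' su su'; rewrite foldr_shift [RHS]foldr_shift => /mulgI h.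
by rewrite -(foldr_shift_root ru su) h foldr_shift_root.
Qed.

Variables (m : nat) (tau : {ffun 'I_d * {perm short_word} -> {perm 'I_m}}).
Local Notation fibred := ({perm short_word} * 'I_m * bool)%type.

(* The lifted graph: its vertices are (k, j, b) with [k] in the quotient, [j] the
   index in the fibre and [b] the side of the bipartite double cover. *)
Definition move (a : 'I_d) (v : fibred) : fibred :=
  let: (k, j, b) := v in
  if b then (shift a k, tau (a, k) j, false)
  else (shift a k, (tau (a, shift a k))^-1%g j, true).

Lemma moveK a : involutive (move a).
Proof. by move=> [[k j] [|]]; rewrite /move shiftK ?permK ?permKV. Qed.

Definition walk (u : seq 'I_d) (v : fibred) : fibred := foldr move v u.

Lemma walk_fst u v : (walk u v).1.1 = foldr shift v.1.1 u.
Proof.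
elim: u => [//|a u IH] /=; rewrite -IH /move.
by case: (walk u v) => [[k j] [|]].
Qed.

(** The quotient coordinate alone separates short words, whatever the permutations [tau] are; so the
    balls in every lift are embedded tree balls. *)
Lemma walk_inj v (u u' : seq 'I_d) :
  reduced u -> reduced u' -> size u <= r -> size u' <= r ->
  walk u v = walk u' v -> u = u'.
Proof.
move=> ru ru' su su' /(congr1 (fun x : fibred => x.1.1)).
by rewrite !walk_fst; exact: foldr_shift_inj.
Qed.

Lemma walk_start_inj u : injective (walk u).
Proof. by elim: u => [//|a u IH] v v' /= /(inv_inj (moveK a))/IH. Qed.

(** A walk reads its word from the last letter on, so a right multiplication only changes the
    starting point. Hence rooting the rule at a neighbour amounts to relabelling the tree by
    [vrmul]. *)
Lemma walk_rmul i u v : walk (rmul i u) v = walk u (move i v).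
Proof.
case: (lastP u) => [//|t c]; rewrite rmul_rcons /walk; case: eqP => [->|_].
  by rewrite foldr_rcons moveK.
by rewrite foldr_rcons.
Qed.

Definition overlap (v v' : fibred) : bool :=
  [exists u : short_word, [exists u' : short_word,
    walk (val (val u)) v == walk (val (val u')) v']].

(** A pair of words that witnesses the overlap determines the second centre, since a walk is
    injective in its start. The bound is independent of [m], so for large [m] overlapping pairs are
    a negligible share. *)
Lemma card_overlap v : #|[pred v' | overlap v v']| <= #|short_word| ^ 2.
Proof.
have sub : [set v' | overlap v v'] \subset
    [set v' | [exists p : short_word * short_word, walk (val (val p.1)) v == walk (val (val p.2)) v']].
  apply/fintype.subsetP => v'; rewrite !inE => /existsP[u /existsP[u' h]].
  by apply/existsP; exists (u, u').
pose f (v' : fibred) : option (short_word * short_word) :=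
  [pick p | walk (val (val p.1)) v == walk (val (val p.2)) v'].
have finj : {in [pred v' | overlap v v'] &, injective f}.
  move=> v1 v2; rewrite !inE => /existsP[u1 /existsP[u1' h1]] _.
  rewrite /f; case: pickP => [p /eqP hp|/(_ (u1, u1'))]; last by rewrite h1.
  case: pickP => // p' /eqP hp' [pp]; rewrite -pp in hp'.
  by apply: (@walk_start_inj (val (val p.2))); rewrite -hp -hp'.
have fsome v' : v' \in [pred v' | overlap v v'] -> f v' \in [set Some p | p : short_word * short_word].
  rewrite inE => /existsP[u /existsP[u' h]].
  rewrite /f; case: pickP => [p _|/(_ (u, u'))]; last by rewrite h.
  exact: imset_f.
rewrite -(card_in_imset finj); apply: (@leq_trans #|[set Some p | p : short_word * short_word]|).
  by apply: subset_leq_card; apply/fintype.subsetP => _ /imsetP[v' hv' ->]; exact: fsome.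
by apply: leq_trans (leq_imset_card _ _) _; rewrite card_prod mulnn.
Qed.

End FiniteQuotient.

Import Order.TTheory GRing.Theory Num.Theory.
Local Open Scope ring_scope.

(** * First-moment bounds for good colourings *)

Lemma sum_set_weights (R : comPzRingType) (U : finType) (w : U -> R) :
  \sum_(D : {set U}) \prod_(u in D) w u = \prod_u (1 + w u).
Proof.
rewrite (eq_bigr (fun u => w u + 1)); last by move=> u _; rewrite addrC.
rewrite bigA_distr; apply: eq_bigr => D _.
rewrite [RHS](bigID [in D]) /= [X in _ * X]big1 ?mulr1.
  by apply: eq_bigr => u ->.
by move=> u /negbTE ->.
Qed.

Lemma card_mostly_in (R : realFieldType) (U : finType) (A : {set U})
    (M B : nat) (x y : R) :
  0 < y -> y <= x -> (B <= M)%N ->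
  #|[set D : {set U} | (#|D| == M) && (#|D :\: A| <= B)%N]|%:R
    * (x ^+ (M - B) * y ^+ B) <= (1 + x) ^+ #|A| * (1 + y) ^+ #|~: A|.
Proof.
(* Give weight [x] to the elements of [A] and [y] to the others: each counted set
   weighs at least [x ^+ (M - B) * y ^+ B], and all sets together weigh the product. *)
move=> y0 yx BM; have x0 : 0 < x by exact: lt_le_trans yx.
set F := finset _.
have -> : (1 + x) ^+ #|A| * (1 + y) ^+ #|~: A| =
    \prod_u (1 + (if u \in A then x else y)).
  rewrite (bigID [in A]) /= -!prodr_const; congr (_ * _).
    by apply: eq_bigr => u ->.
  by apply: eq_big => u; rewrite inE // => /negbTE ->.
rewrite -sum_set_weights mulr_natl -sumr_const.
rewrite [leRHS](bigID [in F]) /= -[leLHS]addr0 lerD //; last first.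
  apply: sumr_ge0 => D _; apply: prodr_ge0 => u _.
  by case: ifP => _; apply: ltW.
apply: ler_sum => D; rewrite inE => /andP[/eqP DM DB].
rewrite (big_setID A) /=.
rewrite (eq_bigr (fun=> x)); last by move=> u; rewrite inE => /andP[_ ->].
rewrite [X in _ <= _ * X](eq_bigr (fun=> y)); last first.
  by move=> u; rewrite inE => /andP[/negbTE -> _].
rewrite !prodr_const.
have := cardsID A D; rewrite DM; move: #|_ :&: _| #|_ :\: _| DB => a b bB ab.
have -> : y ^+ B = y ^+ (B - b) * y ^+ b by rewrite -exprD subnK.
rewrite mulrA ler_wpM2r ?exprn_ge0 ?(ltW y0)//.
have -> : a = (M - B + (B - b))%N by rewrite -ab; lia.
rewrite exprD ler_wpM2l ?exprn_ge0 ?(ltW x0)//.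
by rewrite lerXn2r// nnegrE (ltW x0, ltW y0).
Qed.

Lemma exprD1_le_expR (R : realType) (x : R) (n : nat) :
  0 <= x -> (1 + x) ^+ n <= expR (x * n%:R).
Proof.
move=> x0; rewrite mulrC expRM_natl lerXn2r ?nnegrE ?expR_ge0 ?addr_ge0 //.
exact: expR_ge1Dx.
Qed.

(** The crude form of Stirling's bound, by induction from (1 + 1/n)^n <= e. *)
Lemma exprn_le_expR_fact (R : realType) (n : nat) :
  n%:R ^+ n <= expR n%:R * n`!%:R :> R.
Proof.
elim: n => [|n IH]; first by rewrite fact0 expr0 expR0 mulr1.
have h : n.+1%:R ^+ n <= expR 1 * n%:R ^+ n :> R.
  have [->|n0] := posnP n; first by have := expR_ge1Dx (1 : R); rewrite !expr0 mulr1; lra.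
  have -> : n.+1%:R = (1 + n%:R^-1) * n%:R :> R.
    by rewrite mulrDl mul1r mulVf ?pnatr_eq0 -?lt0n // natr1.
  rewrite exprMn ler_wpM2r ?exprn_ge0 //.
  have := @exprD1_le_expR R n%:R^-1 n; rewrite mulVf ?pnatr_eq0 -?lt0n //.
  by apply; rewrite invr_ge0.
rewrite exprS factS natrM.
apply: le_trans (ler_wpM2l _ h) _ => //.
rewrite -natr1 expRD !mulrA [_ * expR 1]mulrC -!mulrA.
have := ler_wpM2l (_ : 0 <= expR 1 * (n%:R + 1) :> R) IH.
move=> /(_ (mulr_ge0 (expR_ge0 _) (addr_ge0 (ler0n _ _) ler01))).
by move=> H; apply: le_trans (le_trans H _); rewrite le_eqVlt; apply/orP; left;
  apply/eqP; ring.
Qed.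

Section GoodGraphs.
Variables (R : realType) (S : finType) (al : rel S) (d n : nat).

Definition bad_vertices (V : finType) (c : V -> S) (E : {set V * V}) : {set V} :=
  [set v | [exists w, ((v, w) \in E) && ~~ al (c v) (c w)]].

(** Twice the fair share per colour leaves room for a limit argument. The factor 16d bounds the
    number of edges at bad vertices of a d-regular graph by n/16, which is within the margin of the
    exponents. *)
Definition good_coloring (c : 'I_n -> S) (E : {set 'I_n * 'I_n}) : bool :=
  [forall s, #|[set v | c v == s]| * #|S| <= 2 * n]%N &&
  (16 * d * #|bad_vertices c E| <= n)%N.

Definition allowed_pairs (V W : finType) (c : V -> S) (c' : W -> S) : {set V * W} :=
  [set p | al (c p.1) (c' p.2)].

(** A vertex admits at most [k] colours at its neighbours, and each colour class has at most 2n/(k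
    rho) elements; so a share of about 2/rho of all pairs is allowed. *)
Lemma card_allowed_pairs (c : 'I_n -> S) (k rho : nat) :
  (forall s, #|al s| <= k)%N -> #|S| = (k * rho)%N -> (0 < k)%N ->
  (forall s, #|[set v | c v == s]| * #|S| <= 2 * n)%N ->
  (#|allowed_pairs c c| * rho <= 2 * n ^ 2)%N.
Proof.
move=> alk Sk k0 hc.
have -> : #|allowed_pairs c c| = (\sum_u #|[pred v | al (c u) (c v)]|)%N.
  rewrite -(card_dep_pairs predT (fun u => [pred v | al (c u) (c v)])).
  by apply: eq_card => -[u v]; rewrite !inE.
suff h u : (#|[pred v | al (c u) (c v)]| * rho <= 2 * n)%N.
  rewrite big_distrl /=; apply: leq_trans (leq_sum _ (fun u _ => h u)) _.
  by rewrite sum_nat_const card_ord; nia.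
have -> : #|[pred v | al (c u) (c v)]| = (\sum_(s | al (c u) s) #|[set v | c v == s]|)%N.
  rewrite -sum1_card (partition_big c (al (c u))) //=.
  apply: eq_bigr => s als; rewrite -sum1_card; apply: eq_bigl => v.
  by rewrite !inE; case: eqP => [->|]; rewrite ?als ?andbF.
rewrite -(leq_pmul2r k0) -mulnA [(rho * k)%N]mulnC -Sk big_distrl /=.
apply: leq_trans (leq_sum _ (fun s _ => hc s)) _.
rewrite sum_nat_const mulnC leq_mul2l; apply/orP; right.
exact: leq_trans (alk (c u)).
Qed.

(** Each edge is kept in one direction only, so that a regular graph becomes a set of nd/2 ordered
    pairs. Counting symmetric sets of nd pairs as arbitrary ones would lose a square root. *)
Definition half_graph (E : {set 'I_n * 'I_n}) : {set 'I_n * 'I_n} :=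
  [set p in E | (p.1 < p.2)%N].

Lemma half_graph_inj :
  {in [pred E | simple_graph E] &, injective half_graph}.
Proof.
move=> E E'; rewrite !inE => /simple_graphP[iE sE] /simple_graphP[iE' sE'] h.
have H (u v : 'I_n) : (u < v)%N -> ((u, v) \in E) = ((u, v) \in E').
  by move=> uv; have := congr1 (fun X : {set _} => (u, v) \in X) h; rewrite !inE /= uv !andbT.
apply/setP => -[u v]; have [uv|vu|uv] := ltngtP u v; first exact: H.
  by rewrite sE sE' H.
by rewrite (val_inj uv) iE iE'.
Qed.

Lemma card_half_graph (E : {set 'I_n * 'I_n}) :
  regular_graph d E -> (2 * #|half_graph E| = n * d)%N.
Proof.
rewrite regular_graphE => /andP[gE /forallP dE].
have [iE sE] := simple_graphP _ gE.
have <- : #|E| = (n * d)%N.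
  have -> : #|E| = #|[set p in E | p.1 \in [set: 'I_n]]|.
    by apply: eq_card => p; rewrite !inE andbT.
  rewrite card_edges_from (eq_bigr (fun=> d)); last by move=> u _; apply/eqP.
  by rewrite sum_nat_const cardsT card_ord.
have swap_inj : injective (fun p : 'I_n * 'I_n => (p.2, p.1)) by move=> [? ?] [? ?] [-> ->].
have EE : E = half_graph E :|: [set (p.2, p.1) | p in half_graph E].
  apply/setP => -[u v]; rewrite inE; apply/idP/orP => [uvE|].
    have [uv|vu|uv] := ltngtP u v; first by left; rewrite !inE uvE uv.
      by right; apply/imsetP; exists (v, u) => //; rewrite !inE -sE uvE vu.
    by rewrite (val_inj uv) iE in uvE.
  case; first by rewrite !inE => /andP[].
  by move=> /imsetP[[x y]]; rewrite !inE /= => /andP[h _] [-> ->]; rewrite sE.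
rewrite {2}EE cardsU disjoint_setI0.
  by rewrite cards0 subn0 (card_imset _ swap_inj) mul2n addnn.
apply/pred0P => -[u v] /=; rewrite !inE; apply/negbTE/negP.
move=> /andP[/andP[_ /= uv] /imsetP[[x y]]]; rewrite !inE /= => /andP[_ xy] [ux vy].
by rewrite ux vy in uv; have := ltn_trans xy uv; rewrite ltnn.
Qed.

Lemma card_good_for_coloring (c : 'I_n -> S) (k rho M : nat) :
  (forall s, #|al s| <= k)%N -> #|S| = (k * rho)%N -> (0 < k)%N -> (0 < rho)%N ->
  (0 < n)%N -> (2 <= d)%N -> (2 * M = n * d)%N ->
  #|[set E | regular_graph d E & good_coloring c E]|%:R * rho%:R ^+ (M - n %/ 16)
    <= expR (3 * n%:R) * n%:R ^+ M :> R.
Proof.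
move=> alk Sk k0 rho0 n0 d2 nd; set B := (n %/ 16)%N.
have BM : (B <= M)%N by rewrite /B; nia.
have [hc|nhc] := boolP [forall s, #|[set v | c v == s]| * #|S| <= 2 * n]%N; last first.
  rewrite (_ : [set E | _ & _] = finset.set0) ?cards0 ?mul0r ?mulr_ge0 ?exprn_ge0 ?expR_ge0//.
  by apply/setP => E; rewrite !inE /good_coloring (negbTE nhc) andbF.
set A := allowed_pairs c c.
have cA : (#|A| * rho <= 2 * n ^ 2)%N by apply: card_allowed_pairs alk Sk k0 (forallP hc).
set F := [set E | _ & _].
have n0R : 0 < n%:R :> R by rewrite ltr0n.
have FD : (#|F| <= #|[set D : {set 'I_n * 'I_n} | (#|D| == M) && (#|D :\: A| <= B)%N]|)%N.
  rewrite -(@card_in_imset _ _ half_graph F); last first.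
    move=> E E'; rewrite !inE !regular_graphE => /andP[/andP[gE _] _] /andP[/andP[gE' _] _].
    exact: half_graph_inj.
  apply: subset_leq_card; apply/fintype.subsetP => _ /imsetP[E + ->].
  rewrite !inE => /andP[rE /andP[_ bE]]; apply/andP; split.
    by rewrite -(eqn_pmul2l (isT : 0 < 2)%N) card_half_graph // nd.
  (* An inadmissible edge starts at a bad vertex, and each bad vertex starts d edges. *)
  have : (#|half_graph E :\: A| <= #|[set p in E | p.1 \in bad_vertices c E]|)%N.
    apply: subset_leq_card; apply/fintype.subsetP => -[u v]; rewrite !inE /=.
    move=> /andP[nal /andP[uvE _]]; rewrite uvE /=; apply/existsP; exists v.
    by rewrite uvE.
  rewrite card_edges_from; move: (rE); rewrite regular_graphE => /andP[_ /forallP dE].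
  rewrite (eq_bigr (fun=> d)); last by move=> u _; apply/eqP.
  rewrite sum_nat_const /B leq_divRL // => h; apply: leq_trans bE.
  by move: h; move: #|_ :\: _| #|bad_vertices _ _| => X Y h; nia.
(* The weights are rho/n on the at most 2n^2/rho allowed pairs and 1/n on the at most n^2 others.
   The two products are then at most e^(2n) and e^n. *)
have y0 : 0 < n%:R^-1 :> R by rewrite invr_gt0.
have yx : n%:R^-1 <= rho%:R / n%:R :> R by rewrite ler_peMl ?(ltW y0) // ler1n.
have := card_mostly_in A y0 yx BM.
rewrite -(ler_nat R) in FD.
move=> H; have {H} : #|F|%:R * ((rho%:R / n%:R) ^+ (M - B) * n%:R^-1 ^+ B) <= expR (3 * n%:R) :> R.
  apply: le_trans (le_trans H _).
    by apply: ler_wpM2r FD; rewrite mulr_ge0 // exprn_ge0 // ?divr_ge0 // invr_ge0.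
  have -> : 3 * n%:R = 2 * n%:R + n%:R :> R by ring.
  rewrite expRD ler_pM ?exprn_ge0 ?addr_ge0 ?divr_ge0 ?invr_ge0 //.
    apply: le_trans (exprD1_le_expR _ _) _; first by rewrite divr_ge0.
    rewrite ler_expR mulrAC ler_pdivrMr //.
    by move: cA; rewrite -(ler_nat R) !natrM; lra.
  apply: le_trans (exprD1_le_expR _ _) _; first by rewrite invr_ge0.
  rewrite ler_expR mulrC ler_pdivrMr // -natrM ler_nat mulnn.
  by apply: leq_trans (max_card _) _; rewrite card_prod card_ord mulnn.
have -> : (rho%:R / n%:R) ^+ (M - B) * n%:R^-1 ^+ B = rho%:R ^+ (M - B) / n%:R ^+ M :> R.
  by rewrite exprMn -mulrA -exprD subnK // exprVn.
by rewrite mulrA ler_pdivrMr // exprn_gt0.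
Qed.

Definition good_graph (E : {set 'I_n * 'I_n}) : Prop :=
  exists c : 'I_n -> S, good_coloring c E.

Lemma card_good_graphs (k rho M : nat) :
  (forall s, #|al s| <= k)%N -> #|S| = (k * rho)%N -> (0 < k)%N -> (0 < rho)%N ->
  (0 < n)%N -> (2 <= d)%N -> (2 * M = n * d)%N ->
  #|[set E | regular_graph d E & `[< good_graph E >]]|%:R * rho%:R ^+ (M - n %/ 16)
    <= #|S|%:R ^+ n * (expR (3 * n%:R) * n%:R ^+ M) :> R.
Proof.
move=> alk Sk k0 rho0 n0 d2 nd.
set G := (X in #|X|).
have : (#|G| <= \sum_(c : {ffun 'I_n -> S}) #|[set E | regular_graph d E & good_coloring c E]|)%N.
  have sub : G \subset \bigcup_(c : {ffun 'I_n -> S}) [set E | regular_graph d E & good_coloring c E].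
    apply/fintype.subsetP => E; rewrite inE => /andP[rE /asboolP[c cE]].
    apply/bigcupP; exists (finfun c) => //; rewrite inE rE.
    rewrite (_ : (finfun c : _ -> _) = c) //; apply: funext => v; exact: ffunE.
  apply: leq_trans (subset_leq_card sub) _.
  elim/big_rec2: _ => [|c m X _ h]; first by rewrite cards0.
  by apply: leq_trans (leq_card_setU _ _) _; rewrite leq_add2l.
rewrite -(ler_nat R) natr_sum => h.
apply: le_trans (ler_wpM2r _ h) _; first exact: exprn_ge0.
rewrite mulr_suml.
apply: (@le_trans _ _ (\sum_(c : {ffun 'I_n -> S}) (expR (3 * n%:R) * n%:R ^+ M))).
  by apply: ler_sum => c _; exact: card_good_for_coloring.
by rewrite sumr_const card_ffun card_ord -[X in X <= _]mulr_natl natrX.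
Qed.

End GoodGraphs.

Section RareGoodGraphs.
Variables (R : realType) (d : nat).
Hypothesis d3 : (3 <= d)%N.

(** If at least half of the N regular graphs were good, the lower bound for N^2 and the union bound
    over the colourings would leave q^(3n) <= 4 D K^n. Here [K] collects all factors independent of
    q: C, e^6 from the squared count, and e^d from Stirling. This fails for q > K and n large. *)
Lemma good_graphs_rare : exists q0 : nat, forall q : nat, (q0 <= q)%N ->
  forall (S : finType) (al : rel S), #|S| = (q ^ 10)%N ->
    (forall s, #|al s| <= q ^ 2)%N ->
  exists n1 : nat, forall n, (n1 <= n)%N -> ~~ odd (d * n) -> (0 < num_regular d n)%N ->
    (2 * #|[set E : {set 'I_n * 'I_n} | regular_graph d E & `[< good_graph al d E >]]|
       < num_regular d n)%N.
Proof.
have [C [D CD]] := @num_regular_lb d (leq_trans (isT : 1 < 3)%N d3).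
pose K : R := C%:R * expR (6 + d%:R).
have [q1 Kq1] : exists q1 : nat, K < q1%:R.
  by exists (Num.bound K); apply: archi_boundP; rewrite mulr_ge0 ?expR_ge0.
exists (maxn 2 q1) => q; rewrite geq_max => /andP[q2 qq1] S al Sq alq.
have [n2 hn2] : exists n2 : nat, forall n, (n2 <= n)%N -> (4 * D%:R : R) < 2 ^+ n.
  exists (4 * D)%N => n hn; rewrite -natrM -natrX ltr_nat.
  exact: leq_ltn_trans hn (ltn_expl _ _).
exists (maxn (maxn (4 * d + 8) n2) 1) => n; rewrite !geq_max => /andP[/andP[hn hn2'] n0] ev Nn.
rewrite ltnNge; apply/negP; set G := #|_| => NG.
have {CD} := CD n hn Nn; move: (num_regular d n) Nn NG => N N0 NG hN.
have [M nd] : exists M, (2 * M = n * d)%N.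
  exists (n * d)./2; rewrite mul2n -[RHS]odd_double_half [(n * d)%N]mulnC.
  by rewrite (negbTE ev) add0n.
have q0 : (0 < q)%N by apply: leq_trans q2.
have k0 : (0 < q ^ 2)%N by rewrite expn_gt0 q0.
have rho0 : (0 < q ^ 8)%N by rewrite expn_gt0 q0.
have Sk : #|S| = (q ^ 2 * q ^ 8)%N by rewrite Sq -expnD.
have := @card_good_graphs R S al d n _ _ _ alq Sk k0 rho0 n0 (leq_trans (isT : 2 <= 3)%N d3) nd.
rewrite -/G Sq; set B := (n %/ 16)%N => H.
have BM : (B <= M)%N by rewrite /B; nia.
have G0 : (0 < G)%N by rewrite lt0n; apply/eqP => G0; move: NG N0; rewrite G0; lia.
pose X : R := q%:R; pose nn : R := n%:R; pose g : R := G%:R.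
have X1 : 1 <= X by rewrite /X ler1n.
have X0 : 0 < X by apply: lt_le_trans X1.
have g0 : 0 < g by rewrite /g ltr0n.
have H1 : g * X ^+ (8 * (M - B)) <= X ^+ (10 * n) * (expR (3 * nn) * nn ^+ M).
  by move: H; rewrite !natrX -!exprM.
(* Squaring matches the lower bound, which concerns the square of the number of graphs. The exponent
   21 is 20 + 1: the exceptional edges cost q^(16B) <= q^n. *)
have H2 : g ^+ 2 * X ^+ (8 * n * d) <= X ^+ (21 * n) * (expR (6 * nn) * nn ^+ (n * d)).
  have : (g * X ^+ (8 * (M - B))) ^+ 2 <= (X ^+ (10 * n) * (expR (3 * nn) * nn ^+ M)) ^+ 2.
    rewrite lerXn2r // nnegrE ?mulr_ge0 ?exprn_ge0 ?expR_ge0 ?(ltW X0) ?(ltW g0) //.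
  have -> : (X ^+ (10 * n) * (expR (3 * nn) * nn ^+ M)) ^+ 2 =
      X ^+ (20 * n) * (expR (6 * nn) * nn ^+ (n * d)).
    rewrite !exprMn -!exprM -nd -expRM_natl.
    by congr (X ^+ _ * (expR _ * _ ^+ _)); [clear; lia|ring|clear; lia].
  rewrite exprMn -exprM => h.
  apply: (@le_trans _ _ (g ^+ 2 * X ^+ (8 * (M - B) * 2) * X ^+ n)).
    rewrite -mulrA -exprD ler_wpM2l ?exprn_ge0 ?(ltW g0) //.
    by rewrite ler_weXn2l // /B; clear -nd; nia.
  apply: le_trans (ler_wpM2r _ h) _; first by rewrite exprn_ge0 ?ltW.
  by rewrite (mulSn 20) [(n + _)%N]addnC exprD mulrAC.
have H3 : nn ^+ (n * d) <= expR (d%:R * nn) * (4 * D%:R * C%:R ^+ n * g ^+ 2).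
  rewrite exprM; apply: (@le_trans _ _ ((expR nn * n`!%:R) ^+ d)).
    by rewrite lerXn2r ?nnegrE ?exprn_ge0 ?mulr_ge0 ?expR_ge0 // exprn_le_expR_fact.
  rewrite exprMn -expRM_natl ler_wpM2l ?expR_ge0 //.
  apply: (@le_trans _ _ (D * C ^ n * (2 * G) ^ 2)%:R).
    rewrite -natrX ler_nat; apply: leq_trans hN _.
    by rewrite leq_mul2l leq_exp2r // NG orbT.
  by rewrite !natrM natrX /g; rewrite le_eqVlt; apply/orP; left; apply/eqP; ring.
have H4 : X ^+ (8 * n * d) <= X ^+ (21 * n) * (4 * D%:R * K ^+ n).
  rewrite -(ler_pM2l (exprn_gt0 2 g0)); apply: le_trans H2 _.
  have -> : g ^+ 2 * (X ^+ (21 * n) * (4 * D%:R * K ^+ n)) =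
     X ^+ (21 * n) * (expR (6 * nn) * (expR (d%:R * nn) * (4 * D%:R * C%:R ^+ n * g ^+ 2))).
    rewrite /K exprMn -expRM_natl -/nn mulrDr expRD [nn * 6]mulrC [nn * d%:R]mulrC.
    by move: (expR (6 * nn)) (expR (d%:R * nn)) => u v; ring.
  by rewrite ler_wpM2l ?exprn_ge0 ?(ltW X0) // ler_wpM2l ?expR_ge0.
have H5 : X ^+ (3 * n) <= 4 * D%:R * K ^+ n.
  rewrite -(ler_pM2l (exprn_gt0 (21 * n) X0)); apply: le_trans H4.
  by rewrite -exprD ler_weXn2l //; clear -d3; nia.
have K0 : 0 <= K by rewrite mulr_ge0 ?expR_ge0.
have KX : K ^+ n <= X ^+ n.
  by rewrite lerXn2r ?nnegrE ?(ltW X0) // (le_trans (ltW Kq1)) // /X ler_nat.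
have H6 : X ^+ (2 * n) <= 4 * D%:R.
  rewrite -(ler_pM2r (exprn_gt0 n X0)) -exprD; have -> : (2 * n + n = 3 * n)%N by rewrite addnC -mulSn.
  by apply: le_trans H5 _; rewrite ler_wpM2l ?mulr_ge0.
have H7 : 2 ^+ n <= X ^+ (2 * n).
  apply: (@le_trans _ _ (X ^+ n)); first by rewrite lerXn2r ?nnegrE ?(ltW X0) // /X ler_nat.
  by rewrite ler_weXn2l // leq_pmull.
by have := lt_le_trans (hn2 n hn2') (le_trans H7 H6); rewrite ltxx.
Qed.

End RareGoodGraphs.

(** * First-moment bound for random lifts *)

Section Lifts.
Variables (S : finType) (al : rel S) (d m : nat) (K : finType) (sh : 'I_d -> K -> K).
Local Notation fibred := (K * 'I_m * bool)%type.
Local Notation lift_edge := (('I_d * K) * ('I_m * 'I_m))%type.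
Local Notation lift_perm := {ffun 'I_d * K -> {perm 'I_m}}.

(** The edge over (a, k) from index j on the side [true] to index j' on the side [false] is recorded
    as ((a, k), (j, j')). All lifts become subsets of equal size of one set, to which
    [card_mostly_in] applies. *)
Definition lift_edges (tau : lift_perm) : {set lift_edge} :=
  [set x | x.2.2 == tau x.1 x.2.1].

Definition allowed_edges (c : fibred -> S) : {set lift_edge} :=
  [set x | al (c (x.1.2, x.2.1, true)) (c (sh x.1.1 x.1.2, x.2.2, false))].

Lemma lift_edges_inj : injective lift_edges.
Proof.
move=> t t' tt'; apply/ffunP => e; apply/permP => j.
have := congr1 (fun X : {set lift_edge} => (e, (j, t e j)) \in X) tt'.
by rewrite !inE /= eqxx => /esym/eqP.
Qed.

Lemma card_lift_edges tau : #|lift_edges tau| = (d * #|K| * m)%N.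
Proof.
pose h (x : ('I_d * K) * 'I_m) : lift_edge := (x.1, (x.2, tau x.1 x.2)).
have hi : injective h by move=> [e j] [e' j'] [-> ->].
have -> : lift_edges tau = [set h x | x : ('I_d * K) * 'I_m].
  apply/setP => -[e [j j']]; rewrite !inE /=; apply/eqP/imsetP => [->|[[e0 j0] _ [-> -> ->]] //].
  by exists (e, j).
by rewrite (card_imset _ hi) !card_prod !card_ord.
Qed.

Variables (R : realType) (q : nat).
Hypothesis d3 : (3 <= d)%N.
Hypothesis q_large : expR (7 * d%:R) < q%:R :> R.
Hypothesis cardS : #|S| = (q ^ 10)%N.
Hypothesis m0 : (0 < m)%N.
Hypothesis K0 : (0 < #|K|)%N.

(** In place of balanced colour classes, the allowed edges are bounded directly: their expected
    number is what independence of distant vertices controls. The expectation is about 4 in place of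
    5. *)
Definition good_lift_coloring (tau : lift_perm) (c : fibred -> S) : bool :=
  (#|allowed_edges c| * q ^ 8 <= 5 * (d * #|K| * m) * m)%N &&
  (8 * #|lift_edges tau :\: allowed_edges c| <= #|K| * m)%N.

Lemma q_gt0 : (0 < q)%N.
Proof. by rewrite -(ltr_nat R); apply: lt_trans q_large; exact: expR_gt0. Qed.

Lemma card_good_lifts (c : fibred -> S) :
  #|[set tau | good_lift_coloring tau c]|%:R *
      (q%:R ^+ 8) ^+ (d * (#|K| * m) - #|K| * m %/ 8)
    <= expR (6 * (d * (#|K| * m))%:R) * m%:R ^+ (d * (#|K| * m)) :> R.
Proof.
set L := (#|K| * m)%N; set M := (d * L)%N; set B := (L %/ 8)%N.
have BM : (B <= M)%N by rewrite /B /M; nia.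
have [hc|nhc] := boolP (#|allowed_edges c| * q ^ 8 <= 5 * (d * #|K| * m) * m)%N; last first.
  rewrite (_ : [set tau | _] = finset.set0) ?cards0 ?mul0r ?mulr_ge0 ?exprn_ge0 ?expR_ge0//.
  by apply/setP => E; rewrite !inE /good_lift_coloring (negbTE nhc).
set A := allowed_edges c in hc; set F := [set tau | _].
have mR : 0 < m%:R :> R by rewrite ltr0n.
have qR : 1 <= q%:R ^+ 8 :> R by rewrite exprn_ege1 // ler1n q_gt0.
have FD : (#|F| <= #|[set D : {set lift_edge} | (#|D| == M) && (#|D :\: A| <= B)%N]|)%N.
  rewrite -(card_imset _ lift_edges_inj).
  apply: subset_leq_card; apply/fintype.subsetP => _ /imsetP[tau + ->].
  rewrite !inE => /andP[_ h]; rewrite card_lift_edges -mulnA eqxx /=.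
  by rewrite /B leq_divRL // mulnC.
(* The weights are q^8/m on the at most 5Mm/q^8 allowed edges and 1/m on the at most Mm others,
   which gives e^(5M) and e^M. *)
have y0 : 0 < m%:R^-1 :> R by rewrite invr_gt0.
have yx : m%:R^-1 <= q%:R ^+ 8 / m%:R :> R by rewrite ler_peMl ?(ltW y0).
have := card_mostly_in A y0 yx BM.
rewrite -(ler_nat R) in FD.
move=> H; have {H} : #|F|%:R * ((q%:R ^+ 8 / m%:R) ^+ (M - B) * m%:R^-1 ^+ B) <= expR (6 * M%:R) :> R.
  have xx : 0 <= q%:R ^+ 8 / m%:R :> R by rewrite divr_ge0 // (le_trans ler01).
  apply: le_trans (le_trans H _).
    by apply: ler_wpM2r FD; rewrite mulr_ge0 // exprn_ge0 // invr_ge0.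
  have -> : 6 * M%:R = 5 * M%:R + M%:R :> R by ring.
  rewrite expRD ler_pM ?exprn_ge0 ?addr_ge0 ?invr_ge0 //.
    apply: le_trans (exprD1_le_expR _ xx) _.
    rewrite ler_expR mulrAC ler_pdivrMr //.
    by rewrite -natrX -!natrM ler_nat mulnC; apply: leq_trans hc _; rewrite /M /L !mulnA.
  apply: le_trans (exprD1_le_expR _ _) _; first by rewrite invr_ge0.
  rewrite ler_expR mulrC ler_pdivrMr // -natrM ler_nat.
  apply: leq_trans (max_card _) _; rewrite !card_prod !card_ord /M /L.
  by rewrite !mulnA.
have -> : (q%:R ^+ 8 / m%:R) ^+ (M - B) * m%:R^-1 ^+ B = (q%:R ^+ 8) ^+ (M - B) / m%:R ^+ M :> R.
  by rewrite exprMn -mulrA -exprD subnK // exprVn.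
by rewrite mulrA ler_pdivrMr // exprn_gt0.
Qed.

(** There are m!^(d|K|) lifts and q^(20L) colourings. With Stirling the union bound becomes q^(8dL)
    <= q^(21L) e^(7dL) < q^(22L), impossible for d >= 3. *)
Lemma not_all_lifts_good :
  ~ (forall tau, exists c : fibred -> S, good_lift_coloring tau c).
Proof.
move=> ex; set L := (#|K| * m)%N; set M := (d * L)%N; set B := (L %/ 8)%N.
have L0 : (0 < L)%N by rewrite muln_gt0 K0.
have H : (#|{: lift_perm}| <= \sum_(c : {ffun fibred -> S}) #|[set tau | good_lift_coloring tau c]|)%N.
  rewrite -cardsT.
  have sub : [set: lift_perm] \subset \bigcup_(c : {ffun fibred -> S}) [set tau | good_lift_coloring tau c].
    apply/fintype.subsetP => tau _; have [c hc] := ex tau.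
    apply/bigcupP; exists (finfun c) => //; rewrite inE.
    rewrite (_ : (finfun c : _ -> _) = c) //; apply: funext => v; exact: ffunE.
  apply: leq_trans (subset_leq_card sub) _.
  elim/big_rec2: _ => [|c m' X _ h]; first by rewrite cards0.
  by apply: leq_trans (leq_card_setU _ _) _; rewrite leq_add2l.
have cl : #|{: lift_perm}| = (m`! ^ (d * #|K|))%N.
  by rewrite card_ffun card_prod card_ord card_Sn.
pose X : R := q%:R; pose mm : R := m%:R.
have qq : (0 < q)%N := q_gt0.
have X1 : 1 <= X by rewrite /X ler1n.
have X0 : 0 < X by apply: lt_le_trans X1.
have mm0 : 0 < mm by rewrite /mm ltr0n.
have mM : 0 < mm ^+ M by rewrite exprn_gt0.
have H1 : (m`!%:R ^+ (d * #|K|)) * X ^+ (8 * (M - B)) <=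
    X ^+ (20 * L) * (expR (6 * M%:R) * mm ^+ M).
  apply: (@le_trans _ _ ((\sum_(c : {ffun fibred -> S}) #|[set tau | good_lift_coloring tau c]|)%N%:R * X ^+ (8 * (M - B)))).
    by rewrite ler_pM2r ?exprn_gt0 // -natrX -cl ler_nat.
  rewrite natr_sum mulr_suml.
  apply: (@le_trans _ _ (\sum_(c : {ffun fibred -> S}) (expR (6 * M%:R) * mm ^+ M))).
    by apply: ler_sum => c _; rewrite exprM; exact: card_good_lifts.
  rewrite sumr_const card_ffun cardS !card_prod card_ord card_bool.
  rewrite -[X in X <= _]mulr_natl natrX natrX -exprM -/X.
  by rewrite (_ : 10 * (#|K| * m * 2) = 20 * L)%N // /L; clear; lia.
have H2 : mm ^+ M <= expR M%:R * m`!%:R ^+ (d * #|K|).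
  have -> : M = (m * (d * #|K|))%N by rewrite /M /L; clear; lia.
  rewrite exprM natrM [m%:R * _]mulrC expRM_natl -exprMn.
  rewrite lerXn2r ?nnegrE ?mulr_ge0 ?exprn_ge0 ?expR_ge0 ?(ltW mm0) //.
  exact: exprn_le_expR_fact.
have H3 : X ^+ (8 * (M - B)) <= X ^+ (20 * L) * expR (7 * M%:R).
  rewrite -(ler_pM2r mM).
  apply: (@le_trans _ _ (expR M%:R * (m`!%:R ^+ (d * #|K|) * X ^+ (8 * (M - B))))).
    by rewrite mulrC mulrA ler_wpM2r ?exprn_ge0 ?(ltW X0).
  apply: le_trans (ler_wpM2l _ H1) _; first exact: expR_ge0.
  have -> : 7 * M%:R = M%:R + 6 * M%:R :> R by ring.
  rewrite expRD.
  by move: (expR M%:R) (expR (6 * M%:R)) => u v; rewrite le_eqVlt; apply/orP; left; apply/eqP; ring.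
have H4 : X ^+ (8 * M) <= X ^+ (21 * L) * expR (7 * M%:R).
  apply: (@le_trans _ _ (X ^+ (8 * (M - B)) * X ^+ L)).
    by rewrite -exprD ler_weXn2l // /B /M; clear -d3; nia.
  apply: le_trans (ler_wpM2r _ H3) _; first by rewrite exprn_ge0 ?(ltW X0).
  by rewrite (mulSn 20) [(L + _)%N]addnC exprD mulrAC.
have H5 : expR (7 * M%:R) < X ^+ L.
  rewrite /M natrM mulrA mulrC expRM_natl ltrXn2r ?nnegrE ?expR_ge0 ?(ltW X0) //.
  by rewrite -lt0n L0.
have : X ^+ (8 * M) < X ^+ (22 * L).
  apply: le_lt_trans H4 _; rewrite (mulSn 21) [(L + _)%N]addnC exprD.
  by rewrite ltr_pM2l ?exprn_gt0.
rewrite ltNge ler_weXn2l // /M; clear -d3; nia.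
Qed.

End Lifts.

Import numFieldNormedType.Exports.
Local Open Scope classical_set_scope.
Local Open Scope ring_scope.

(** * Borel sets of configurations *)

HB.instance Definition _ (d : nat) := Countable.on (vertex d).

Definition box (I : eqType) (X : Type) (J : seq I) (D : I -> set X) : set (I -> X) :=
  [set x | forall i, i \in J -> D i (x i)].

Definition depends_on (I : eqType) (X : Type) (J : seq I) (A : set (I -> X)) : Prop :=
  forall x y : I -> X, (forall i, i \in J -> x i = y i) -> A x -> A y.

Section ConfigTopology.
Variables (d : nat) (X : ptopologicalType).
Notation conf := {ptws vertex d -> X}.

(** The sets that contain a box around [x] form a filter. It converges to [x] in every coordinate,
    hence in the product topology, and this convergence says that each neighbourhood contains a
    box. *)
Lemma nbhs_config_box (x : conf) (U : set conf) : nbhs x U ->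
  exists (J : seq (vertex d)) (D : vertex d -> set X),
    (forall v, nbhs (x v) (D v)) /\ box J D `<=` U.
Proof.
pose F : set_system (vertex d -> X) := [set U | exists (J : seq (vertex d)) (D : vertex d -> set X),
    (forall v, nbhs (x v) (D v)) /\ box J D `<=` U].
have FF : Filter F.
  split.
  - by exists [::], (fun=> setT); split => // v; exact: filterT.
  - move=> A B [J [D [hD sA]]] [J' [D' [hD' sB]]].
    exists (J ++ J'), (fun v => D v `&` D' v); split.
      by move=> v; apply: filterI.
    move=> y hy; split; [apply: sA|apply: sB] => v vJ.
      by have [] := hy v; rewrite ?mem_cat ?vJ.
    by have [] := hy v; rewrite ?mem_cat ?vJ ?orbT.
  - move=> A B AB [J [D [hD sA]]]; exists J, D; split=> //.
    exact: subset_trans sA AB.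
have FE : F --> (x : conf).
  apply/cvg_sup => v A /=; rewrite (@nbhsE (initial_topology (fun f : vertex d -> X => f v))) => -[B [[C oC <-] Bx] sA].
  exists [:: v], (fun w => [set z | w = v -> C z]); split.
    move=> w; have [->|wv] := eqVneq w v.
      have nC : nbhs (x v) C by apply: open_nbhs_nbhs.
      by apply: filterS nC => z Cz _.
    by apply: filterS (@filterT _ (nbhs (x w)) _) => z _ wv'; rewrite wv' eqxx in wv.
  by move=> y hy; apply: sA; exact: (hy v (mem_head _ _)).
exact: FE.
Qed.

Lemma open_coordinate (v : vertex d) (D : set X) :
  open D -> open [set x : conf | D (x v)].
Proof.
move=> oD; have := @proj_continuous _ (fun _ : vertex d => X) v.
by move=> cv; apply: (@open_comp conf X (fun x => x v) D) => // y _; exact: cv.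
Qed.

Variables (I : countType) (B : I -> set X).
Hypothesis basisB : forall x U, nbhs x U -> exists i, B i x /\ B i `<=` U.

Definition cylinder (c : seq (vertex d * I)) : set (vertex d -> X) :=
  [set x | forall p, p \in c -> B p.2 (x p.1)].

Lemma open_cylinders (U : set conf) : open U ->
  U = \bigcup_(c in [set c | cylinder c `<=` U]) cylinder c.
Proof.
move=> oU; apply/seteqP; split => [x Ux|x [c /= cU cx]]; last exact: cU.
have [J [D [hD sU]]] := nbhs_config_box (open_nbhs_nbhs (conj oU Ux)).
have h v : exists i, B i (x v) /\ B i `<=` D v by exact: basisB.
pose i_ v := sval (cid (h v)); have i_P v : B (i_ v) (x v) /\ B (i_ v) `<=` D v.
  by rewrite /i_; case: cid.
exists [seq (v, i_ v) | v <- J].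
  move=> y hy; apply: sU => v vJ; apply: (i_P v).2.
  exact: (hy (v, i_ v) (map_f _ vJ)).
by move=> p /mapP[v _ ->]; exact: (i_P v).1.
Qed.

(** There are only countably many cylinders, since both the vertices and the basis are countable; so
    every open set is a countable union of them. *)
Lemma sigma_cylinders (G : set (set (vertex d -> X))) :
  (forall c, G (cylinder c)) -> @measurable _ (config d X) `<=` <<s G >>.
Proof.
move=> cG; apply: smallest_sub; first exact: smallest_sigma_algebra.
move=> U oU; rewrite (open_cylinders oU).
(* Padding with empty sets turns this into a union over the whole countable type. *)
have -> : \bigcup_(c in [set c | cylinder c `<=` U]) cylinder c =
   \bigcup_c (if `[< cylinder c `<=` U >] then cylinder c else set0).
  apply/seteqP; split => [x [c cU cx]|x [c _]].
    by exists c => //; move/asboolP : (cU) => ->.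
  by case: asboolP => // cU cx; exists c.
apply: (@countable_bigcupT_measurable _ (g_sigma_algebraType G)) => [|c]; first exact: countableP.
case: ifP => _; last exact: (@measurable0 _ (g_sigma_algebraType G)).
exact: sub_sigma_algebra.
Qed.

Lemma measurable_to_config dT (T : measurableType dT) (f : T -> config d X) :
  (forall v i, measurable [set t | B i (f t v)]) -> measurable_fun setT f.
Proof.
move=> mf; pose G := range cylinder.
have mG : forall c, measurable (f @^-1` cylinder c).
  elim=> [|p c IH].
    rewrite (_ : _ @^-1` _ = setT); first exact: measurableT.
    by apply/seteqP; split.
  rewrite (_ : _ @^-1` _ = [set t | B p.2 (f t p.1)] `&` (f @^-1` cylinder c)).
    exact: measurableI.
  apply/seteqP; split => [t ht|t [h1 h2] q].
    by split; [exact: ht (mem_head _ _)|move=> q qc; apply: ht; rewrite inE qc orbT].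
  by rewrite inE => /orP[/eqP ->|/h2].
move=> _ A mA; rewrite setTI.
have sG : <<s G >> A by apply: (@sigma_cylinders G) mA => c; exists c.
move: A {mA} sG; apply: smallest_sub.
  split; first by rewrite /= preimage_set0; exact: measurable0.
    by move=> A /= mA; rewrite setTD preimage_setC; exact: measurableC.
  by move=> F /= mF; rewrite preimage_bigcup; exact: bigcupT_measurable.
by move=> _ [c _ <-]; exact: mG.
Qed.

End ConfigTopology.

Lemma discrete_basis (F : pfinType) (x : discrete F) (U : set (discrete F)) :
  nbhs x U -> exists i : F, [set i] x /\ [set i] `<=` U.
Proof. by move=> /nbhs_singleton Ux; exists x; split => // y ->. Qed.

Section RationalIntervals.
Variable R : realType.

Definition rat_itv (i : rat * rat) : set R := `]ratr i.1, ratr i.2[%classic.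

Lemma rat_itv_basis (x : R) (U : set R) : nbhs x U ->
  exists i, rat_itv i x /\ rat_itv i `<=` U.
Proof.
rewrite -nbhs_ballE => -[e /= e0 sU].
have xe : x - e < x by rewrite ltrBlDr ltrDl.
have ex : x < x + e by rewrite ltrDl.
have [a] := rat_in_itvoo xe; rewrite in_itv /= => /andP[a1 a2].
have [b] := rat_in_itvoo ex; rewrite in_itv /= => /andP[b1 b2].
exists (a, b); split; first by rewrite /rat_itv /= in_itv /= a2 b1.
move=> y; rewrite /rat_itv /= in_itv /= => /andP[h1 h2]; apply: sU.
by rewrite /ball /= ltr_distlC; lra.
Qed.

End RationalIntervals.

Section DiscreteConfig.
Variables (R : realType) (d : nat) (F : pfinType).
Notation conf := {ptws vertex d -> discrete F}.

Lemma open_depends_on (J : seq (vertex d)) (A : set conf) :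
  depends_on J A -> open A.
Proof.
move=> hA; rewrite openE => x Ax; rewrite /interior.
suff : nbhs x [set y : conf | forall v, v \in J -> x v = y v].
  by apply: filterS => y hy; exact: hA hy Ax.
elim: J {hA Ax} => [|v J IH]; first by apply: filterS filterT.
have nv : nbhs x [set y : conf | [set x v] (y v)].
  apply: open_nbhs_nbhs; split => //.
  by apply: (@open_coordinate d (discrete F) v [set x v]); exact: discrete_open.
apply: filterS (filterI nv IH) => y [/= yv hy] w.
by rewrite inE => /orP[/eqP ->|/hy].
Qed.

Lemma measurable_depends_on (J : seq (vertex d)) (A : set (config d (discrete F))) :
  depends_on J A -> measurable A.
Proof. by move=> /open_depends_on oA; apply: sub_sigma_algebra. Qed.

Lemma depends_onC (X : Type) (J : seq (vertex d)) (A : set (vertex d -> X)) :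
  depends_on J A -> depends_on J (~` A).
Proof. by move=> hA x y xy nAx Ay; apply: nAx; apply: hA Ay => v vJ; rewrite xy. Qed.

(** An event that depends on finitely many coordinates is open and closed, so its indicator is a
    continuous test function. *)
Lemma weak_cvg_depends_on (mu_ : nat -> process R d F) (mu : process R d F)
    (J : seq (vertex d)) (A : set (config d (discrete F))) :
  weak_cvg mu_ mu -> depends_on J A -> mu_ k A @[k --> \oo] --> mu A.
Proof.
move=> cv hA; have mA := measurable_depends_on hA.
have near_cst (x : conf) : \forall y \near x, \1_A y = \1_A x :> R.
  have [Ax|nAx] := pselect (A x).
    have : nbhs x A by apply: open_nbhs_nbhs; split => //; exact: open_depends_on hA.
    by apply: filterS => y Ay; rewrite !indicE !mem_set.
  have : nbhs x (~` A).
    by apply: open_nbhs_nbhs; split => //; exact: open_depends_on (depends_onC hA).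
  by apply: filterS => y Ay; rewrite !indicE !memNset.
have cont : continuous (\1_A : conf -> R).
  by move=> x; exact: (cvg_near_cst (\1_A x : R) (near_cst x)).
have := cv _ cont; rewrite integral_indic // setIT.
by under eq_fun do rewrite integral_indic // setIT.
Qed.

End DiscreteConfig.

(** * Construction of branching Markov processes *)

Section Digits.
Variables (R : realType) (b : nat).
Hypothesis b0 : (0 < b)%N.
Local Notation P := (uniform_prob (@ltr01 R)).

Definition expansion (n : nat) (t : R) : nat := Num.truncn (t * b%:R ^+ n).

Definition digit (i : nat) (t : R) : nat := (expansion i.+1 t %% b)%N.

Lemma expansionS n t : (expansion n.+1 t %/ b = expansion n t)%N.
Proof.
have bR : 0 < b%:R :> R by rewrite ltr0n.
have [t0|t0] := leP 0 t; last first.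
  rewrite /expansion.
  have h m : Num.truncn (t * b%:R ^+ m) = 0%N.
    apply/truncn0Pn; rewrite -ltNge.
    by apply: lt_trans (_ : 0 < 1) => //; rewrite nmulr_rlt0 // exprn_gt0.
  by rewrite !h div0n.
apply/esym; rewrite /expansion; apply: truncn_def.
have := @truncn_itv R (t * b%:R ^+ n.+1) (mulr_ge0 t0 (exprn_ge0 _ (ltW bR))).
set m := Num.truncn _ => /andP[h1 h2].
rewrite -(ler_pM2r bR) -(ltr_pM2r bR) -!mulrA -exprSr -!natrM.
apply/andP; split; first by apply: le_trans h1; rewrite ler_nat leq_divM.
by apply: lt_le_trans h2 _; rewrite ler_nat ltn_ceil.
Qed.

Lemma measurable_expansion (n : nat) (Q : pred nat) :
  measurable [set t : R | Q (expansion n t)].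
Proof.
have mgt k : measurable [set t : R | (k < expansion n t)%N].
  rewrite (_ : [set t | _] = `[k.+1%:R / b%:R ^+ n, +oo[%classic); first exact: measurable_itv.
  apply/seteqP; split => t /=; rewrite in_itv /= andbT truncn_gt_nat ler_pdivrMr //;
  by rewrite exprn_gt0 // ltr0n.
have meq k : measurable [set t : R | expansion n t = k].
  case: k => [|k].
    rewrite (_ : [set t | _] = ~` [set t : R | (0 < expansion n t)%N]); first exact: measurableC.
    by apply/seteqP; split => t /=; rewrite lt0n; [move=> ->|move=> /negP/negPn/eqP].
  rewrite (_ : [set t | _] = [set t : R | (k < expansion n t)%N] `&` ~` [set t : R | (k.+1 < expansion n t)%N]).
    by apply: measurableI => //; exact: measurableC.
  apply/seteqP; split => t /=; first by move=> ->; rewrite ltnSn ltnn.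
  move=> [h1 h2].
  by apply/eqP; rewrite eqn_leq h1 andbT leqNgt; apply/negP.
rewrite (_ : [set t | _] = \bigcup_k (if Q k then [set t | expansion n t = k] else set0)).
  by apply: bigcupT_measurable => k; case: ifP.
apply/seteqP; split => [t /= Qt|t [k _]]; first by exists (expansion n t) => //; rewrite Qt.
by case: ifP => // Qk /= ->.
Qed.

(** The conditions on the first n digits of t, read off the integer part of t b^n. The lowest digit
    of this integer is the digit of t with index n - 1, so the recursion removes the last condition
    first. *)
Fixpoint digits_ok (A : nat -> pred nat) (n k : nat) : bool :=
  if n is n'.+1 then digits_ok A n' (k %/ b)%N && A n' (k %% b)%N else true.

Lemma digits_okP (A : nat -> pred nat) (n : nat) (t : R) :
  reflect (forall i, (i < n)%N -> A i (digit i t)) (digits_ok A n (expansion n t)).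
Proof.
elim: n => [|n IH]; first by left.
rewrite /= expansionS; apply: (iffP andP) => [[/IH h1 h2] i|h].
  by rewrite ltnS leq_eqVlt => /orP[/eqP ->|/h1].
by split; [apply/IH => i /ltnW; exact: h|exact: h].
Qed.

Lemma sum_digits_ok (A : nat -> pred nat) (n : nat) :
  (\sum_(0 <= k < b ^ n) digits_ok A n k =
   \prod_(i < n) \sum_(0 <= r < b) A i r)%N.
Proof.
elim: n => [|n IH]; first by rewrite big_ord0 big_nat1.
rewrite big_ord_recr /= -IH expnSr big_nat_mul big_distrl /=.
apply: eq_bigr => k _.
rewrite -{1}[(k * b)%N]add0n -[(k.+1 * b)%N]addn0 mulSnr -addnA.
rewrite big_addn addKn addn0 big_distrr /=.
rewrite big_nat [RHS]big_nat; apply: eq_bigr => r /andP[_ rb].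
by rewrite /= [(r + _)%N]addnC divnMDl // divn_small // addn0 modnMDl modn_small // mulnb.
Qed.

Lemma uniform_prob_itvco (x y : R) : 0 <= x -> x <= y -> y <= 1 ->
  P `[x, y[%classic = (y - x)%:E.
Proof.
move=> x0 xy y1; rewrite /uniform_prob integral_uniform_pdf.
rewrite (_ : _ `&` _ = `[x, y[%classic); last first.
  by apply/seteqP; split => t /=; rewrite !in_itv /=; [case|lra].
rewrite (eq_integral (fun=> 1%E)); last first.
  move=> t; rewrite inE /= in_itv /= /uniform_pdf => h.
  by rewrite subr0 invr1 ifT //; lra.
rewrite integral_cst //= mul1e lebesgue_measure_itv /= lte_fin.
by move: xy; rewrite le_eqVlt => /orP[/eqP ->|->//]; rewrite ltxx subrr.
Qed.

(** Independence of the digits: each integer below b^n stands for an interval of length b^(-n), and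
    the number of admissible integers factors over the digits. *)
Lemma uniform_prob_digits_ok (A : nat -> pred nat) (n : nat) :
  P [set t | digits_ok A n (expansion n t)] =
  (\prod_(i < n) ((\sum_(0 <= r < b) A i r)%N%:R / b%:R))%:E.
Proof.
set U := [set t | _].
have mU : measurable U by exact: measurable_expansion.
pose c : R := b%:R ^+ n.
have c0 : 0 < c by rewrite exprn_gt0 // ltr0n.
have mle (m : nat) : (m <= b ^ n)%N -> m%:R / c <= 1.
  by move=> mb; rewrite ler_pdivrMr // mul1r /c -natrX ler_nat.
have step (m : nat) : (m <= b ^ n)%N ->
    P (U `&` `[0, m%:R / c[%classic) = ((\sum_(0 <= k < m) digits_ok A n k)%N%:R / c)%:E.
  elim: m => [|m IH] mb.
    by rewrite big_geq // !mul0r set_itvco0 setI0 measure0.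
  have mc : m%:R / c <= m.+1%:R / c by rewrite ler_pM2r ?invr_gt0 // ler_nat.
  have m0 : 0 <= m%:R / c by rewrite divr_ge0 // ltW.
  rewrite (_ : _ `&` _ = (U `&` `[0, m%:R / c[%classic) `|` (U `&` `[m%:R / c, m.+1%:R / c[%classic)); last first.
    by rewrite -setIUr; congr (_ `&` _); apply/seteqP; split => t /=; rewrite !in_itv /=; lra.
  rewrite measureU; first last.
  - by apply/seteqP; split => // t [[_ /=] + [_ /=]]; rewrite !in_itv /=; lra.
  - exact: measurableI.
  - exact: measurableI.
  rewrite big_nat_recr //= natrD mulrDl EFinD; congr (_ + _)%E; first exact: IH (ltnW mb).
  have em t : t \in `[m%:R / c, m.+1%:R / c[ -> expansion n t = m.
    by rewrite in_itv /= ler_pdivrMr // ltr_pdivlMr // => h; apply: truncn_def.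
  have [okm|okm] := boolP (digits_ok A n m).
    rewrite (_ : _ `&` _ = `[m%:R / c, m.+1%:R / c[%classic); last first.
      by apply/setIidPr => t /= /em; rewrite /U /= => ->.
    by rewrite uniform_prob_itvco // ?mle // -mulrBl -natrB // subSnn.
  rewrite (_ : _ `&` _ = set0) ?measure0 ?mul0r //.
  by apply/seteqP; split => // t [+ /= /em]; rewrite /U /= => + e; rewrite e (negbTE okm).
have P1 : P `[0, 1[%classic = 1%:E by rewrite uniform_prob_itvco // subr0.
(* The count concerns [0, 1); its complement is a null set, which also disposes of t = 1, where the
   expansion would be b^n. *)
have PU : P U = P (U `&` `[0, 1[%classic).
  rewrite -[in LHS](setIT U) -[setT](setvU (`[0, 1[%classic : set R)) setIUr measureU //.
  - rewrite [X in (X + _)%E](_ : _ = 0%E) ?add0e //.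
    apply/eqP; rewrite eq_le measure_ge0 andbT.
    apply: (@le_trans _ _ (P (~` `[0, 1[%classic))).
      by apply: le_measure; rewrite ?inE //; [apply: measurableI => //|]; exact: measurableC.
    have PC : P (~` `[0, 1[%classic) = (1 - P `[0%R, 1%R[%classic)%E by exact: probability_setC.
    by rewrite PC P1 -EFinB subrr.
  - by apply: measurableI => //; exact: measurableC.
  - exact: measurableI.
  - by rewrite setIACA setICl setI0.
have -> : P U = ((\sum_(0 <= k < b ^ n) digits_ok A n k)%N%:R / c)%:E.
  by rewrite PU -step // natrX divff // gt_eqF.
rewrite sum_digits_ok natr_prod /c; congr EFin.
by rewrite big_split /= prodr_const card_ord exprVn.
Qed.

Lemma measurable_digit (i : nat) (Q : pred nat) : measurable [set t : R | Q (digit i t)].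
Proof. exact: (measurable_expansion i.+1 (fun k => Q (k %% b)%N)). Qed.

End Digits.

(** A kernel presented as a deterministic move driven by a uniform element of [G], so that one
    uniform digit per vertex simulates it. *)
Definition step_kernel (R : realType) (S G : finType) (nxt : S -> G -> S) (s t : S) : R :=
  #|[pred z | nxt s z == t]|%:R / #|G|%:R.

Section BranchingExistence.
Variables (R : realType) (d : nat) (S : pfinType) (G : finType) (g0 : G).
Variable nxt : S -> G -> S.

Let D : finType := (S * G)%type.
Let b := #|D|.
Let b0 : (0 < b)%N. Proof. by apply/card_gt0P; exists (point, g0). Qed.
(* A single uniform number provides all the randomness: the base-[b] digit with
   the index of [v] is the random choice made at [v]. *)
Let dig (v : vertex d) (t : R) : D := nth (point, g0) (enum D) (digit b (pickle v) t).

(** The recursion follows the word, whose tail is the parent. The root uses the first component of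
    its digit, every other vertex the second; [point] only arises at words that are not reduced. *)
Let state (t : R) (v : vertex d) : S :=
  (fix st (w : seq 'I_d) : S :=
    if w is _ :: w' then
      if insub w is Some v then nxt (st w') (dig v t).2 else point
    else (dig (tree_root d) t).1) (val v).

Let state_root t : state t (tree_root d) = (dig (tree_root d) t).1.
Proof. by []. Qed.

Let stateS t v : v != tree_root d -> state t v = nxt (state t (parent v)) (dig v t).2.
Proof.
case: v => -[|a w] hw; first by move=> /eqP; case; apply: val_inj.
move=> _; rewrite /state /=; case: insubP => [u _ hu|]; last by rewrite hw.
by have -> : u = exist _ (a :: w) hw by exact: val_inj.
Qed.

Let sum_nth (Q : pred D) :
  (\sum_(0 <= r < b) Q (nth (point, g0) (enum D) r) = #|Q|)%N.
Proof.
transitivity (\sum_(z <- enum D) Q z)%N; first by rewrite (big_nth (point, g0)) -cardE.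
rewrite big_enum /= -sum1_card [RHS]big_mkcond /=; apply: eq_bigr => z _.
by rewrite unfold_in; case: (Q z).
Qed.

Let measurable_dig v (Q : pred D) : measurable [set t | Q (dig v t)].
Proof. exact: (measurable_digit b0 (pickle v) (fun r => Q (nth (point, g0) (enum D) r))). Qed.

Let measurable_state v s : measurable [set t | state t v = s].
Proof.
case: v => w hw; elim: w hw s => [|a w IH] hw s.
  have -> : exist _ [::] hw = tree_root d by exact: val_inj.
  rewrite (_ : [set t | _] = [set t | (dig (tree_root d) t).1 == s]).
    exact: (measurable_dig _ (fun z => z.1 == s)).
  by apply/seteqP; split => t /=; rewrite state_root => /eqP.
set v := exist _ _ _; have vr : v != tree_root d by [].
have hw' : reduced w by exact: path_sorted hw.
have pv : parent v = exist _ w hw' by exact: val_inj.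
rewrite (_ : [set t | _] = \big[setU/set0]_(s' : S)
   ([set t | state t (exist _ w hw') = s'] `&` [set t | nxt s' (dig v t).2 == s])).
  apply: bigsetU_measurable => s' _; apply: measurableI; first exact: IH.
  exact: (measurable_dig _ (fun z => nxt s' z.2 == s)).
rewrite -bigcup_seq; apply/seteqP; split => t /=; rewrite stateS // pv.
  by move=> h; exists (state t (exist _ w hw')); [rewrite /= mem_index_enum|split => //=; apply/eqP].
by move=> [s' _ [/= -> /eqP]].
Qed.

Lemma branching_markov_exists :
  exists nu : process R d S,
    branching_markov (step_kernel R nxt) (fun=> #|S|%:R^-1) nu.
Proof.
pose Y (t : measurableTypeR R) : config d (discrete S) := state t.
have mY : measurable_fun setT Y.
  apply: (measurable_to_config (@discrete_basis S)) => v s.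
  exact: measurable_state.
pose Ymix := isMeasurableFun.Build _ _ _ _ Y mY.
pose Yf : {mfun measurableTypeR R >-> config d (discrete S)} := HB.pack Y Ymix.
exists (distribution (uniform_prob (@ltr01 R)) Yf) => A uA rA pA x.
(* Once all states on [A] are prescribed, the event splits into one condition per vertex on its own
   digit, because the state of the parent is known. *)
pose Q (v : vertex d) (z : D) : bool :=
  if v == tree_root d then z.1 == x v else nxt (x (parent v)) z.2 == x v.
have Eset : Y @^-1` [set y | forall v, v \in A -> y v = x v] =
    [set t | forall v, v \in A -> Q v (dig v t)].
  apply/seteqP; split => t /= h.
    move=> v vA; rewrite /Q; case: eqP => [vr|/eqP vr].
      by have := h v vA; rewrite vr /= /Y state_root => ->.
    have hp : state t (parent v) = x (parent v) := h _ (pA v vA).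
    have hv : state t v = x v := h v vA.
    by move: hv; rewrite stateS // hp => ->.
  case=> w; elim: w => [|a w IH] hw vA.
    have er : exist _ [::] hw = tree_root d by exact: val_inj.
    by have := h _ vA; rewrite /Q er eqxx => /eqP <-.
  set v := exist _ _ _ in vA *; have vr : v != tree_root d by [].
  have hw' : reduced w by exact: path_sorted hw.
  have pv : parent v = exist _ w hw' by exact: val_inj.
  have := h _ vA; rewrite /Q (negbTE vr) => /eqP <-.
  by rewrite /Y stateS // pv; congr nxt; apply: IH; rewrite -pv; exact: pA.
transitivity (uniform_prob (@ltr01 R) (Y @^-1` [set y | forall v, v \in A -> y v = x v])); first by [].
rewrite Eset.
pose n := (\max_(v <- A) (@pickle (vertex d) v).+1)%N.
have vn v : v \in A -> (pickle v < n)%N.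
  by move=> vA; rewrite /n (big_rem v vA) /= leq_max leqnn.
(* The condition on the digit of index [i]; it is void, and contributes a factor 1, when [i] is not
   the index of a vertex of [A]. *)
pose B (i r : nat) : bool :=
  all (fun v => (pickle v == i) ==> Q v (nth (point, g0) (enum D) r)) A.
have -> : [set t | forall v, v \in A -> Q v (dig v t)] =
    [set t | digits_ok b B n (expansion b n t)].
  apply/seteqP; split => t /=.
    by move=> h; apply/(digits_okP b0) => i _; apply/allP => v vA; apply/implyP => /eqP <-; exact: h.
  move=> /(digits_okP b0) h v vA.
  by have /allP/(_ v vA) := h _ (vn v vA); rewrite /= eqxx.
rewrite uniform_prob_digits_ok //; congr EFin.
pose f i : R := (\sum_(0 <= r < b) B i r)%N%:R / b%:R.
have bR : b%:R != 0 :> R by rewrite pnatr_eq0 -lt0n.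
have f1 i : i \notin [seq pickle v | v <- A] -> f i = 1.
  move=> iA; rewrite /f (eq_bigr (fun=> 1%N)); first by rewrite sum_nat_const_nat subn0 muln1 divff.
  move=> r _; rewrite /B; suff -> : all (fun v => (pickle v == i) ==> Q v (nth (point, g0) (enum D) r)) A by [].
  by apply/allP => v vA; apply/implyP => /eqP e; rewrite -e map_f in iA.
have fA v : v \in A -> f (pickle v) = #|Q v|%:R / b%:R.
  move=> vA; rewrite /f -sum_nth; congr (_%:R / _); apply: eq_bigr => r _; congr nat_of_bool.
  apply/allP/idP => [/(_ v vA) /=|h w wA]; first by rewrite eqxx.
  by apply/implyP => /eqP /(pcan_inj pickleK) ->.
rewrite -(big_mkord predT f) (bigID (mem [seq pickle v | v <- A])) /=.
rewrite [X in _ * X]big1 ?mulr1 => [|i /f1 //].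
rewrite -big_filter (perm_big [seq pickle v | v <- A]) /=; last first.
  apply: uniq_perm.
  - by rewrite filter_uniq // iota_uniq.
  - by rewrite map_inj_uniq //; exact: (pcan_inj pickleK).
  move=> i; rewrite mem_filter mem_index_iota /= andb_idr //.
  by move=> /mapP[v vA ->]; exact: vn.
rewrite big_map big_seq (eq_bigr _ fA) -big_seq (bigD1_seq (tree_root d)) //=.
have GR : #|G|%:R != 0 :> R by rewrite pnatr_eq0 -lt0n; apply/card_gt0P; exists g0.
have SR : #|S|%:R != 0 :> R by rewrite pnatr_eq0 -lt0n; apply/card_gt0P; exists point.
have bE : b%:R = #|S|%:R * #|G|%:R :> R by rewrite /b card_prod natrM.
congr (_ * _).
  rewrite bE (_ : #|Q (tree_root d)| = #|G|).
    by rewrite invfM mulrCA divff // mulr1.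
  rewrite -[RHS]mul1n -(card1 (x (tree_root d))) -cardX; apply: eq_card => -[s z].
  by rewrite !inE unfold_in /Q /= andbT.
apply: eq_bigr => v vr; rewrite /step_kernel bE.
rewrite (_ : #|Q v| = #|S| * #|[pred z | nxt (x (parent v)) z == x v]|)%N.
  by rewrite natrM -mulf_div divff // mul1r.
rewrite -cardX; apply: eq_card => -[s z].
by rewrite !inE unfold_in /Q (negbTE vr).
Qed.

End BranchingExistence.

(** * Typical processes *)

Section BallTypes.
Variable F : Type.

(** The ball around [v] is isomorphic to both models and so identifies [H] with [H']; the
    identification is composed with the embedding at [w]. *)
Lemma ball_iso_transfer (V W : eqType) (e : rel V) (e' : rel W) (c : V -> F)
    (c' : W -> F) (r : nat) (H H' : rooted_colored_graph F) (v : V) (w : W) :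
  ball_iso e c r H v -> ball_iso e c r H' v ->
  ball_iso e' c' r H' w -> ball_iso e' c' r H w.
Proof.
move=> [f [fi fb fr fe fc]] [f' [fi' fb' fr' fe' fc']] [h [hi hb hr he hc]].
have ex i : exists j, f' j = f i by apply/fb'/fb; exists i.
have ex' j : exists i, f i = f' j by apply/fb/fb'; exists j.
pose g i := sval (cid (ex i)); have gP i : f' (g i) = f i by rewrite /g; case: cid.
pose g' j := sval (cid (ex' j)); have g'P j : f (g' j) = f' j by rewrite /g'; case: cid.
exists (h \o g); split.
- by move=> i j /hi gij; apply: fi; rewrite -!gP gij.
- move=> u; rewrite hb; split => [[j <-]|[i <-]]; last by exists (g i).
  by exists (g' j) => /=; congr h; apply: fi'; rewrite gP g'P.
- by rewrite /= -hr; congr h; apply: fi'; rewrite gP fr fr'.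
- by move=> i j; rewrite /= he -fe' !gP fe.
- by move=> i; rewrite /= hc -fc' gP fc.
Qed.

Definition point_graph (s : F) : rooted_colored_graph F :=
  RootedColoredGraph (fun _ _ : 'I_1 => false) ord0 (fun=> s).

Definition star_graph (d : nat) (s : F) (t : 'I_d -> F) : rooted_colored_graph F :=
  RootedColoredGraph (fun i j : 'I_d.+1 => (i == ord0) (+) (j == ord0)) ord0
    (fun i => if unlift ord0 i is Some j then t j else s).

Lemma in_ball0 (V : eqType) (e : rel V) (v u : V) : in_ball e v 0 u <-> u = v.
Proof.
split => [[p []]|->]; last by exists [::].
by case: p.
Qed.

Lemma in_ball1 (V : eqType) (e : rel V) (v u : V) :
  in_ball e v 1 u <-> u = v \/ e v u.
Proof.
split => [[[|w [|z p]] [//= h1 h2 _]]|[->|vu]].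
- by left.
- by right; rewrite -h2; move: h1; rewrite andbT.
- by exists [::].
by exists [:: u]; rewrite /= vu.
Qed.

Lemma ball_iso_point (V : eqType) (e : rel V) (c : V -> F) (s : F) (v : V) :
  e v v = false -> ball_iso e c 0 (point_graph s) v <-> c v = s.
Proof.
move=> evv; split => [[f [fi fb <- fe fc]]|<-]; first by rewrite fc.
exists (fun=> v); split => //.
- by move=> i j _; rewrite !ord1.
- by move=> u; rewrite in_ball0; split => [->|[_ <-]//]; exists ord0.
Qed.

Lemma ball_iso_star_nbr (d : nat) (V : eqType) (e : rel V) (c : V -> F) (s : F)
    (t : 'I_d -> F) (v w : V) :
  ball_iso e c 1 (star_graph s t) v -> e v w -> c v = s /\ exists j, c w = t j.
Proof.
move=> [f [fi fb fr fe fc]] vw.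
have [i iw] : exists i, f i = w by apply/fb/in_ball1; right.
split; first by rewrite -fr fc /= unlift_none.
move: vw; rewrite -fr -iw fe /= => ine; case: (unliftP ord0 i) ine => [j ij _|->//].
by exists j; rewrite fc /= ij liftK.
Qed.

End BallTypes.

Section TreeBalls.
Variable d : nat.

Definition letter (j : 'I_d) : vertex d := exist _ [:: j] isT.

Lemma tadj_root (u : vertex d) : tadj (tree_root d) u <-> exists j, u = letter j.
Proof.
split => [|[j ->]].
  rewrite /tadj [_ || (~~ _ && _)]orbC eqxx /= => /andP[]; case: u => -[|j [|k w]] hw //= _ _.
  by exists j; exact: val_inj.
by rewrite /tadj [_ || (~~ _ && _)]orbC eqxx /=; apply/eqP/val_inj.
Qed.

Lemma tree_ball_star (F : Type) (x : vertex d -> F) :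
  ball_iso (@tadj d) x 1 (star_graph (x (tree_root d)) (x \o letter)) (tree_root d).
Proof.
exists (fun i : 'I_d.+1 => if unlift ord0 i is Some j then letter j else tree_root d); split.
- move=> i j; case: unliftP => [i' ->|->]; case: unliftP => [j' ->|->] //.
  by case=> ->.
- move=> u; rewrite in_ball1; split => [[->|/tadj_root[j ->]]|[i <-]].
  + by exists ord0; rewrite unlift_none.
  + by exists (lift ord0 j); rewrite liftK.
  by case: unliftP => [j _|_]; [right; apply/tadj_root; exists j|left].
- by rewrite /= unlift_none.
- have nl j : (lift ord0 j == ord0 :> 'I_d.+1) = false.
    by rewrite eq_sym (negbTE (neq_lift _ _)).
  have lr j : tadj (tree_root d) (letter j) by apply/tadj_root; exists j.
  move=> i j /=; case: unliftP => [i' ->|->]; case: unliftP => [j' ->|->]; rewrite ?eqxx ?nl.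
  + by apply/negbTE/negP => /orP[] /andP[_ /eqP /(congr1 val)].
  + by rewrite /tadj orbC; exact: lr.
  + exact: lr.
  + by rewrite /tadj eqxx.
by move=> i /=; case: unliftP.
Qed.

End TreeBalls.

Lemma measure_big_setU_le d (T : measurableType d) (R : realType)
    (mu : {measure set T -> \bar R}) (I : Type) (r : seq I) (P : pred I) (A : I -> set T) :
  (forall i, measurable (A i)) ->
  (mu (\big[setU/set0]_(i <- r | P i) A i) <= \sum_(i <- r | P i) mu (A i))%E.
Proof.
move=> mA; elim: r => [|i r IH]; first by rewrite !big_nil measure0.
rewrite !big_cons; case: ifP => // _.
have mr : measurable (\big[setU/set0]_(i <- r | P i) A i) by exact: bigsetU_measurable. apply: (le_trans (measureU2 _ (mA i) mr)).
by rewrite leeD2l.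
Qed.

Section EventuallyGood.
Variables (R : realType) (d : nat) (S : pfinType) (al : rel S).
Variable mu : process R d S.
Hypothesis d0 : (0 < d)%N.
Hypothesis mu_root : forall s, mu [set x | x (tree_root d) = s] = (#|S|%:R^-1)%:E.
Hypothesis mu_star :
  mu [set x | forall j, al (x (tree_root d)) (x (letter j))] = 1%E.

Let tree_vertices : seq (vertex d) := tree_root d :: [seq letter j | j <- enum 'I_d].

Lemma in_ball_tree_vertices (u : vertex d) :
  in_ball (@tadj d) (tree_root d) 1 u -> u \in tree_vertices.
Proof.
move=> /in_ball1; rewrite /tree_vertices inE => -[->|/tadj_root[j ->]]; first by rewrite eqxx.
by rewrite map_f ?orbT // mem_enum.
Qed.

Lemma depends_on_ball_iso1 H :
  depends_on tree_vertices [set x : vertex d -> S | ball_iso (@tadj d) x 1 H (tree_root d)].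
Proof.
move=> x y xy [f [fi fb fr fe fc]]; exists f; split => // i.
by rewrite -fc xy // in_ball_tree_vertices //; apply/fb; exists i.
Qed.

Let I := (S * {ffun 'I_d -> S})%type.
Let star (p : I) := star_graph p.1 p.2.
(** Isomorphism of the two stars, expressed by what they recognise in arbitrary coloured graphs. *)
Let same (p q : I) : Prop :=
  forall (V : eqType) (e : rel V) (c : V -> S) (v : V),
    ball_iso e c 1 (star p) v <-> ball_iso e c 1 (star q) v.
Let sameb (p q : I) : bool := `[< same p q >].
Let rep (p : I) : I := odflt p [pick q | sameb p q].
Let allowed (p : I) : bool := [forall j, al p.1 (p.2 j)].
(* Stars that differ by a permutation of the leaves have the same balls, so the
   events of being isomorphic to a star are disjoint only over representatives. *)
Let reps : {set I} := [set rep p | p in allowed].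

Let rep_same p : same p (rep p).
Proof. by rewrite /rep; case: pickP => [q /asboolP //|_] /=; split. Qed.

Let same_rep p q : same p q -> rep p = rep q.
Proof.
move=> pq; rewrite /rep (@eq_pick _ _ (sameb q)); last first.
  move=> r; apply/asboolP/asboolP => h V e c v; first by rewrite -(pq V e c v); exact: h.
  by rewrite (pq V e c v); exact: h.
by case: pickP => // /(_ q) /asboolP []; split.
Qed.

Let reps_inj p q (V : eqType) (e : rel V) (c : V -> S) (v : V) :
  p \in reps -> q \in reps ->
  ball_iso e c 1 (star p) v -> ball_iso e c 1 (star q) v -> p = q.
Proof.
move=> /imsetP[p' _ ->] /imsetP[q' _ ->] hp hq.
have rr r : rep (rep r) = rep r by apply/esym/same_rep/rep_same.
rewrite -rr -[RHS]rr; apply: same_rep => W e' c' w.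
by split; [exact: ball_iso_transfer hq hp|exact: ball_iso_transfer hp hq].
Qed.

Let reps_good p (V : eqType) (e : rel V) (c : V -> S) (v w : V) :
  p \in reps -> ball_iso e c 1 (star p) v -> e v w -> al (c v) (c w).
Proof.
move=> /imsetP[p' /forallP ap ->] /(rep_same p' _ _ _) h vw.
by have [-> [j ->]] := ball_iso_star_nbr h vw.
Qed.

Lemma sum_mu_reps :
  (1 <= \sum_(p in reps) mu [set x | ball_iso (@tadj d) x 1 (star p) (tree_root d)])%E.
Proof.
rewrite -mu_star.
have mB p : measurable [set x : config d (discrete S) | ball_iso (@tadj d) x 1 (star p) (tree_root d)].
  by apply: (@measurable_depends_on d S tree_vertices); exact: depends_on_ball_iso1.
have mA : measurable [set x : config d (discrete S) | forall j, al (x (tree_root d)) (x (letter j))].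
  apply: (@measurable_depends_on d S tree_vertices) => x y xy h j.
  have hr : tree_root d \in tree_vertices by apply: in_ball_tree_vertices; apply/in_ball1; left.
  have hj : letter j \in tree_vertices.
    by apply: in_ball_tree_vertices; apply/in_ball1; right; apply/tadj_root; exists j.
  by rewrite -(xy _ hr) -(xy _ hj); exact: h.
apply: (@le_trans _ _ (mu (\big[setU/set0]_(p in reps)
    [set x : config d (discrete S) | ball_iso (@tadj d) x 1 (star p) (tree_root d)]))).
  apply: le_measure; rewrite ?inE //; first by apply: bigsetU_measurable => p _; exact: mB.
  move=> x /= h; pose x' : vertex d -> S := x.
  pose p : I := (x' (tree_root d), [ffun j => x' (letter j)]).
  rewrite -bigcup_seq_cond; exists (rep p).
    rewrite /= mem_index_enum /=; apply/imsetP; exists p => //.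
    by apply/forallP => j; rewrite /= ffunE.
  have hp : ball_iso (@tadj d) x' 1 (star p) (tree_root d).
    have -> : star p = star_graph (x' (tree_root d)) (x' \o @letter d).
      by congr star_graph; apply/funext => j; rewrite /= ffunE.
    exact: tree_ball_star.
  by have [hs _] := rep_same p (@tadj d) x' (tree_root d); exact: hs.
by apply: measure_big_setU_le => p; exact: mB.
Qed.

Variables (V : nat -> finType) (E : forall i, {set V i * V i}).
Variable f : forall i, V i -> S.
Hypothesis bs : benjamini_schramm_limit E f mu.

(** Balls of radius 0 see the colour of the root. The factor 2 turns the limiting frequency 1/|S|
    into a bound valid from some index on. *)
Lemma eventually_few_of_color (s : S) : \forall i \near \oo,
  simple_graph (E i) -> (#|[set v | @f i v == s]%SET| * #|S| <= 2 * #|V i|)%N.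
Proof.
have := @bs 0%N (point_graph s).
rewrite (_ : [set x | _] = [set x | x (tree_root d) = s]); last first.
  by apply/seteqP; split => x /=; rewrite ball_iso_point // /tadj eqxx.
rewrite mu_root => /fine_cvg /cvgr_lt.
have S0 : 0 < #|S|%:R :> R by rewrite ltr0n; apply/card_gt0P; exists s.
move=> /(_ (2 * #|S|%:R^-1)) []; first by rewrite ltr_pMl ?invr_gt0 // ltr1n.
move=> i0 _ H; exists i0 => // i /H /= + /simple_graphP[iE _].
have [V0|V0] := posnP #|V i|.
  move=> _; rewrite V0 muln0 leqn0 muln_eq0; apply/orP; left.
  by rewrite -leqn0 -V0; exact: max_card.
rewrite /vertex_frequency ltr_pdivrMr ?ltr0n // mulrAC ltr_pdivlMr //.
rewrite -!natrM ltr_nat => /ltnW; apply: leq_trans.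
rewrite leq_mul2r; apply/orP; right.
apply: subset_leq_card; apply/fintype.subsetP => v; rewrite !inE => /eqP fv.
by do 2 apply/asboolP; exact: (@ball_iso_point _ _ (edge (E i)) (@f i) s v (iE v)).2.
Qed.

(** The frequencies of the finitely many allowed stars sum to at least 1 in the limit, hence
    eventually to more than 1 - 1/(16d). In the finite graph no vertex is counted for two
    representatives, and a counted vertex is not bad. *)
Lemma eventually_few_bad_vertices : \forall i \near \oo,
  regular_graph d (E i) -> (16 * d * #|bad_vertices al (@f i) (E i)| <= #|V i|)%N.
Proof.
pose m (p : I) : R := fine (mu [set x | ball_iso (@tadj d) x 1 (star p) (tree_root d)]).
pose fr (p : I) (i : nat) : R := vertex_frequency R (ball_iso (edge (E i)) (@f i) 1 (star p)).
have mE p : mu [set x | ball_iso (@tadj d) x 1 (star p) (tree_root d)] = (m p)%:E.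
  rewrite /m fineK // fin_num_measure //.
  by apply: (@measurable_depends_on d S tree_vertices); exact: depends_on_ball_iso1.
have frm p : fr p i @[i --> \oo] --> m p.
  by have := @bs 1%N (star p); rewrite mE => /fine_cvg.
have sm : 1 <= \sum_(p in reps) m p.
  have := sum_mu_reps; rewrite (eq_bigr (fun p => (m p)%:E)) => [|p _]; last exact: mE.
  by rewrite sumEFin lee_fin.
have cv : \sum_(p in reps) fr p i @[i --> \oo] --> \sum_(p in reps) m p.
  by apply: cvg_big => //; exact: add_continuous.
have d0R : 0 < (16 * d)%N%:R :> R by rewrite ltr0n muln_gt0.
have {cv} /cvgr_gt /(_ (1 - (16 * d)%N%:R^-1)) [] := cv.
  by apply: lt_le_trans sm; rewrite ltrBlDr ltrDl invr_gt0.
move=> i0 _ H; exists i0 => // i /H /= + rE.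
have [V0|V0] := posnP #|V i|.
  move=> _; rewrite V0 leqn0 muln_eq0; apply/orP; right.
  by rewrite -leqn0 -V0; exact: max_card.
have VR : 0 < #|V i|%:R :> R by rewrite ltr0n.
rewrite /fr /vertex_frequency -mulr_suml ltr_pdivlMr // => h.
have : (\sum_(p in reps) #|[pred v | `[< ball_iso (edge (E i)) (@f i) 1 (star p) v >]]|
   <= #|V i| - #|bad_vertices al (@f i) (E i)|)%N.
  rewrite -(cardsC (bad_vertices al (@f i) (E i))) addKn.
  rewrite (eq_bigr (fun p => \sum_v `[< ball_iso (edge (E i)) (@f i) 1 (star p) v >])%N); last first.
    by move=> p _; rewrite -sum1_card big_mkcond /=; apply: eq_bigr => v _; rewrite inE; case: asboolP.
  rewrite exchange_big /= -sum1_card [leqRHS]big_mkcond /=; apply: leq_sum => v _.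
  have [[p [pr hp]]|no] := pselect (exists p, p \in reps /\ ball_iso (edge (E i)) (@f i) 1 (star p) v).
    rewrite (bigD1 p) //= big1 ?addn0 => [|q /andP[qr qp]]; last first.
      by case: asboolP => // hq; move: qp; rewrite (reps_inj qr pr hq hp) eqxx.
    rewrite (_ : v \in _); first exact: leq_b1.
    rewrite inE inE; apply/existsP => -[w /andP[vw /negP]]; apply.
    exact: reps_good pr hp vw.
  rewrite big1 // => p pr; case: asboolP => // hp.
  by case: no; exists p.
have bV : (#|bad_vertices al (@f i) (E i)| <= #|V i|)%N by exact: max_card.
rewrite -(ler_nat R) natr_sum natrB // => h2.
have := lt_le_trans h h2.
rewrite mulrBl mul1r ltrD2l ltrN2 mulrC ltr_pdivlMr // -natrM ltr_nat => /ltnW.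
by rewrite mulnC.
Qed.

End EventuallyGood.

Section NotTypical.
Variables (R : realType) (d : nat) (S : pfinType) (al : rel S).
Variable mu : process R d S.
Hypothesis d0 : (0 < d)%N.
Hypothesis mu_root : forall s, mu [set x | x (tree_root d) = s] = (#|S|%:R^-1)%:E.
Hypothesis mu_star :
  mu [set x | forall j, al (x (tree_root d)) (x (letter j))] = 1%E.

Lemma eventually_good_graph (n : nat -> nat) (E : forall i, {set 'I_(n i) * 'I_(n i)}) :
  limit_of_colorings E mu ->
  exists i0, forall i, (i0 <= i)%N -> regular_graph d (E i) -> good_graph al d (E i).
Proof.
move=> [_ _ [f bs]].
have [i1 _ h1] := eventually_few_bad_vertices d0 mu_star bs.
have [i2 _ h2] := filter_forall _ (fun s => eventually_few_of_color mu_root bs s).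
exists (maxn i1 i2) => i; rewrite geq_max => /andP[i1i i2i] rE; exists (@f i).
rewrite /good_coloring; apply/andP; split; last by have /= := h1 i i1i rE; rewrite card_ord.
apply/forallP => s; have /= := h2 i i2i s; rewrite card_ord; apply.
by move: rE; rewrite regular_graphE => /andP[].
Qed.

(** The events [M j], that all graphs from index [j] on are good, increase with [j]. Each has
    probability at most 1/2 because a late single graph is good with at most that probability, while
    typicality would give their union probability 1. *)
Lemma not_typical :
  (exists n1, forall n, (n1 <= n)%N -> ~~ odd (d * n) -> (0 < num_regular d n)%N ->
    (2 * #|[set E : {set 'I_n * 'I_n} | regular_graph d E & `[< good_graph al d E >]]%SET|
       < num_regular d n)%N) ->
  ~ typical mu.
Proof.
move=> [n1 rare] [_ [n [n0 ev ncvg [dO [Om [P [G [[mG PG _] ae]]]]]]]].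
pose good i : {set {set 'I_(n i) * 'I_(n i)}} :=
  [set E | regular_graph d E & `[< good_graph al d E >]]%SET.
have mset i (B : {set {set 'I_(n i) * 'I_(n i)}}) : measurable [set w | G i w \in B].
  rewrite (_ : [set w | _] = \big[setU/set0]_(E in B) (G i @^-1` [set E])).
    by apply: bigsetU_measurable => E _; exact: mG.
  rewrite -bigcup_seq_cond; apply/seteqP; split => [w /= wB|w [E /= /andP[_ EB] ->]] //.
  by exists (G i w) => //=; rewrite mem_index_enum.
have Pset i (B : {set {set 'I_(n i) * 'I_(n i)}}) :
    (P [set w | G i w \in B] <= \sum_(E in B) P (G i @^-1` [set E]))%E.
  rewrite (_ : [set w | _] = \big[setU/set0]_(E in B) (G i @^-1` [set E])).
    by apply: measure_big_setU_le => E; exact: mG.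
  rewrite -bigcup_seq_cond; apply/seteqP; split => [w /= wB|w [E /= /andP[_ EB] ->]] //.
  by exists (G i w) => //=; rewrite mem_index_enum.
(* Without regular graphs every point probability would be 0, by the convention that 0 has inverse
   0, although the total mass is 1. *)
have Nreg i : (0 < num_regular d (n i))%N.
  rewrite lt0n; apply/eqP => N0.
  have := Pset i [set: _]%SET; rewrite big1 => [|E _].
    rewrite (_ : [set w | _] = setT); last by apply/seteqP; split => w //= _; rewrite inE.
    by rewrite probability_setT lee_fin ler10.
  by rewrite PG -/(num_regular _ _) N0 invr0 mulr0.
have Pgood i : (n1 <= n i)%N -> (P [set w | G i w \in good i] <= (2^-1)%:E)%E.
  move=> ni; apply: le_trans (Pset _ _) _.
  rewrite (eq_bigr (fun=> ((num_regular d (n i))%:R^-1)%:E)); last first.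
    by move=> E; rewrite inE => /andP[rE _]; rewrite PG rE mul1r.
  rewrite sumEFin lee_fin sumr_const -[_ *+ #|_|]mulr_natl ler_pdivrMr ?ltr0n //.
  rewrite ler_pdivlMl // -natrM ler_nat; apply: ltnW.
  exact: rare.
have Pirr i : P [set w | ~~ regular_graph d (G i w)] = 0%E.
  apply/eqP; rewrite eq_le measure_ge0 andbT.
  have := Pset i [set E | ~~ regular_graph d E]%SET; rewrite big1 => [|E].
    by congr (P _ <= _)%E; apply/seteqP; split => w /=; rewrite inE.
  by rewrite inE => /negbTE rE; rewrite PG rE mul0r.
pose M j := \bigcap_(i in [set i | (j <= i)%N]) [set w | G i w \in good i].
have mM j : measurable (M j).
  by apply: bigcap_measurable => [|i _]; [exists j => /=|exact: mset].
have ndM : nondecreasing_seq M.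
  move=> j k jk; apply/subsetPset => w h i /= ki; apply: h => /=.
  exact: leq_trans ki.
have mU : measurable (\bigcup_j M j) by exact: bigcupT_measurable.
have PM j : (P (M j) <= (2^-1)%:E)%E.
  have [i1 _ hi1] := (cvgnyPge n).1 ncvg n1.
  apply: (@le_trans _ _ (P [set w | G (maxn j i1) w \in good (maxn j i1)])).
    apply: le_measure; [by apply/mem_set|by apply/mem_set; exact: mset|].
    by move=> w h; apply: h => /=; exact: leq_maxl.
  by apply: Pgood; apply: hi1 => /=; exact: leq_maxr.
have PU : (P (\bigcup_j M j) <= (2^-1)%:E)%E.
  have cv := @nondecreasing_cvg_mu _ _ _ P _ mM mU ndM.
  rewrite -(cvg_lim _ cv) //; apply: lime_le; first by apply/cvg_ex; eexists; exact: cv.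
  by apply: nearW => j; exact: PM.
have negU : P.-negligible (~` \bigcup_j M j).
  apply: (@negligibleS _ _ _ P
    (~` (fun w => limit_of_colorings (fun i => G i w) mu) `|`
     \bigcup_i [set w | ~~ regular_graph d (G i w)])); last first.
    apply: negligibleU; first exact: ae.
    apply: negligible_bigcup => i; exists [set w | ~~ regular_graph d (G i w)]; split; [|exact: Pirr|by []].
    have := mset i [set E | ~~ regular_graph d E]%SET.
    by congr (measurable _); apply/seteqP; split => w /=; rewrite inE.
  move=> w nM; have [lw|nl] := pselect (limit_of_colorings (fun i => G i w) mu); last by left.
  right; apply: contrapT => nreg; apply: nM.
  have [i0 hi0] := eventually_good_graph lw; exists i0 => // i /= ii0.
  have rE : regular_graph d (G i w).
    by apply: contrapT => /negP nr; apply: nreg; exists i.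
  by rewrite inE rE; apply/asboolP; exact: hi0.
have PC : P (~` \bigcup_j M j) = 0%E by apply: measure_negligible => //; exact: measurableC.
have : (P setT <= 0 + (2^-1)%:E)%E.
  rewrite -(setvU (\bigcup_j M j)).
  apply: le_trans (measureU2 P (measurableC mU) mU) _.
  apply: leeD; last exact: PU.
  by rewrite le_eqVlt; apply/orP; left; apply/eqP; exact: PC.
by rewrite probability_setT add0e lee_fin; lra.
Qed.

End NotTypical.

(** * Factors of i.i.d. processes *)

Section RealConfig.
Variables (R : realType) (d : nat).
Local Notation conf := (config d R).

Lemma measurable_coordinate (v : vertex d) :
  measurable_fun setT (fun x : conf => x v : measurableTypeR R).
Proof.
apply: (measurability _ (RGenOInfty.measurableE R)) => _ [_ [a ->] <-].
rewrite setTI; apply: sub_sigma_algebra.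
apply: (@open_coordinate d R v `]a, +oo[%classic); exact: interval_open.
Qed.

Lemma measurable_box (J : seq (vertex d)) (D : vertex d -> set R) :
  (forall v, measurable (D v)) -> measurable (box J D : set conf).
Proof.
move=> mD; elim: J => [|v J IH].
  by rewrite (_ : box _ _ = setT) //; apply/seteqP; split.
rewrite (_ : box _ _ = ((fun x : conf => x v) @^-1` D v) `&` box J D).
  by apply: measurableI => //; have := measurable_coordinate v measurableT (mD v); rewrite setTI.
apply/seteqP; split => [x hx|x [hv hJ] w].
  by split; [exact: (hx v (mem_head _ _))|move=> w wJ; apply: hx; rewrite inE wJ orbT].
by rewrite inE => /orP[/eqP ->|/hJ].
Qed.

(** A generating class closed under intersection, on which the law of the i.i.d. labels is a
    product; two finite measures agreeing on it are equal. *)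
Definition boxes : set (set (vertex d -> R)) :=
  [set A | exists (J : seq (vertex d)) (D : vertex d -> set R),
    [/\ uniq J, forall v, measurable (D v) & A = box J D]].

Lemma boxes_measurable : boxes `<=` (@measurable _ conf).
Proof. by move=> _ [J [D [_ mD ->]]]; exact: measurable_box. Qed.

Lemma measurable_implied (b : bool) (D : set R) :
  measurable D -> measurable [set t | b -> D t].
Proof.
move=> mD; case: b.
  by rewrite (_ : [set t | _] = D) //; apply/seteqP; split => t //=; apply.
by rewrite (_ : [set t | _] = setT) //; apply/seteqP; split.
Qed.

Lemma boxes_setI : setI_closed boxes.
Proof.
move=> _ _ [J [D [_ mD ->]]] [J' [D' [_ mD' ->]]].
exists (undup (J ++ J')), (fun v => [set t | v \in J -> D v t] `&` [set t | v \in J' -> D' v t]).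
split; first exact: undup_uniq.
  by move=> v; apply: measurableI; exact: measurable_implied.
apply/seteqP; split => x.
  by move=> [h h'] v _; split => /= vJ; [exact: h|exact: h'].
move=> h; split => v vJ.
  by apply: (h v _).1; rewrite ?mem_undup ?mem_cat ?vJ.
by apply: (h v _).2; rewrite ?mem_undup ?mem_cat ?vJ ?orbT.
Qed.

Lemma cylinder_boxes (c : seq (vertex d * (rat * rat))) :
  boxes (cylinder (@rat_itv R) c).
Proof.
exists (undup [seq p.1 | p <- c]),
  (fun v => [set t | forall i, (v, i) \in c -> rat_itv i t]); split.
- exact: undup_uniq.
- move=> v; elim: c => [|[w i] c IH].
    by rewrite (_ : [set t | _] = setT) //; apply/seteqP; split.
  rewrite (_ : [set t | _] = [set t | (v == w) -> rat_itv i t] `&`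
     [set t | forall i, (v, i) \in c -> rat_itv i t]).
    by apply: measurableI => //; apply: measurable_implied; exact: measurable_itv.
  apply/seteqP; split => t.
    move=> h; split => /= [/eqP vw|j jc]; first by apply: h; rewrite vw mem_head.
    by apply: h; rewrite inE jc orbT.
  move=> [h1 h2] j; rewrite inE => /orP[/eqP[vw ->]|]; last exact: h2.
  by apply: h1; rewrite vw eqxx.
apply/seteqP; split => x h.
  by move=> v _ i vi; exact: (h (v, i)).
move=> [v i] vi; apply: (h v) => //.
by rewrite mem_undup; apply/mapP; exists (v, i).
Qed.

Lemma sigma_boxes : (@measurable _ conf) `<=` <<s boxes >>.
Proof. by apply: (sigma_cylinders (@rat_itv_basis R)); exact: cylinder_boxes. Qed.

Lemma eq_measure_boxes (m1 m2 : {measure set conf -> \bar R}) :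
  (m1 setT < +oo)%E ->
  (forall A, boxes A -> m1 A = m2 A) -> forall A, measurable A -> m1 A = m2 A.
Proof.
move=> fin e A mA; apply: (@g_sigma_algebra_measure_unique _ R conf boxes boxes_measurable (fun=> setT)) => //.
- move=> _; exists [::], (fun=> setT); split => //.
  by apply/seteqP; split.
- by apply/seteqP; split => // x _; exists 0%N.
- exact: boxes_setI.
- exact: sigma_boxes.
Qed.

End RealConfig.

Section IidLaw.
Variables (R : realType) (d : nat) (dO : measure_display) (Om : measurableType dO).
Variables (P : probability Om R) (X : vertex d -> Om -> R).
Hypothesis iidX : iid_uniform P X.
Local Notation conf := (config d R).
Local Notation U := (uniform_prob (@ltr01 R)).

Definition relabel (k : vertex d -> vertex d) (w : Om) : conf := fun v => X (k v) w.

Lemma measurable_relabel k : measurable_fun setT (relabel k).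
Proof.
have [_ mX _ _] := iidX.
apply: (measurable_to_config (@rat_itv_basis R)) => v i.
by have := mX (k v) measurableT _ (measurable_itv `]ratr i.1, ratr i.2[); rewrite setTI.
Qed.

Lemma measurable_relabel_preimage k (A : set conf) :
  measurable A -> measurable (relabel k @^-1` A).
Proof. by move=> mA; have := measurable_relabel k measurableT mA; rewrite setTI. Qed.

HB.instance Definition _ k := isMeasurableFun.Build _ _ _ _ (relabel k) (measurable_relabel k).

(** Mutual independence takes one event per label, so the two boxes are merged into a single family
    [A] over all labels read. Injectivity and disjointness of [k] and [k'] ensure that each label
    receives a single condition. *)
Lemma prob_boxes2 (k k' : vertex d -> vertex d) (J J' : seq (vertex d))
    (D D' : vertex d -> set R) :
  injective k -> injective k' -> (forall u v, k u <> k' v) ->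
  uniq J -> uniq J' -> (forall v, measurable (D v)) -> (forall v, measurable (D' v)) ->
  P (relabel k @^-1` box J D `&` relabel k' @^-1` box J' D') =
  (\prod_(v <- J) U (D v) * \prod_(v <- J') U (D' v))%E.
Proof.
move=> ki ki' kk uJ uJ' mD mD'; have [_ mX lX indX] := iidX.
pose A (i : vertex d) : set R :=
  [set t | (forall v, v \in J -> k v = i -> D v t) /\ (forall v, v \in J' -> k' v = i -> D' v t)].
have AJ v : v \in J -> A (k v) = D v.
  move=> vJ; apply/seteqP; split => t; first by move=> [h _]; exact: h.
  by move=> h; split => u uJ0; [move/ki => ->|move=> /esym/kk].
have AJ' v : v \in J' -> A (k' v) = D' v.
  move=> vJ; apply/seteqP; split => t; first by move=> [_ h]; exact: h.
  by move=> h; split => u uJ0; [move=> /kk|move/ki' => ->].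
pose K := [seq k v | v <- J] ++ [seq k' v | v <- J'].
have uK : uniq K.
  rewrite cat_uniq !map_inj_uniq // uJ uJ' andbT /=; apply/hasPn => i /mapP[v _ ->].
  by apply/mapP => -[u _ /esym/kk].
have := indX K (fun i => X i @^-1` A i) uK.
have -> : \bigcap_(i in [set` K]) X i @^-1` A i = relabel k @^-1` box J D `&` relabel k' @^-1` box J' D'.
  apply/seteqP; split => w h.
    split => v vJ; rewrite /relabel /=.
      by rewrite -(AJ v vJ); apply: h; rewrite /= mem_cat map_f.
    by rewrite -(AJ' v vJ); apply: h; rewrite /= mem_cat map_f ?orbT.
  move=> i; rewrite /= mem_cat => /orP[] /mapP[v vJ ->].
    by rewrite /= AJ //; exact: (h.1 v vJ).
  by rewrite /= AJ' //; exact: (h.2 v vJ).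
move=> ->; last first.
  move=> i; rewrite mem_cat => /orP[] /mapP[v vJ ->].
    by exists (D v); rewrite ?AJ.
  by exists (D' v); rewrite ?AJ'.
rewrite big_cat !big_map; congr (_ * _)%E; rewrite big_seq [RHS]big_seq; apply: eq_bigr => v vJ.
  by rewrite AJ // lX.
by rewrite AJ' // lX.
Qed.

Lemma relabel_indep_boxes (k k' : vertex d -> vertex d) (A A' : set conf) :
  injective k -> injective k' -> (forall u v, k u <> k' v) ->
  boxes A -> boxes A' ->
  P (relabel k @^-1` A `&` relabel k' @^-1` A') =
  (P (relabel k @^-1` A) * P (relabel k' @^-1` A'))%E.
Proof.
move=> ki ki' kk [J [D [uJ mD ->]]] [J' [D' [uJ' mD' ->]]].
have T0 (D0 : vertex d -> set R) q : relabel q @^-1` box [::] D0 = setT by apply/seteqP; split.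
have := @prob_boxes2 k k' J [::] D (fun=> setT) ki ki' kk uJ isT mD (fun=> measurableT).
rewrite T0 setIT big_nil mule1 => ->.
have := @prob_boxes2 k k' [::] J' (fun=> setT) D' ki ki' kk isT uJ' (fun=> measurableT) mD'.
rewrite T0 setTI big_nil mul1e => ->.
exact: prob_boxes2.
Qed.

(** For fixed [B] both sides are finite measures in [A]: the law restricted to [B], and the law
    scaled by the probability of [B]. Used once for each of the two events, it extends independence
    from boxes to Borel sets. *)
Lemma indep_of_boxes (k : vertex d -> vertex d) (B : set Om) : measurable B ->
  (forall A, boxes A -> P (relabel k @^-1` A `&` B) = (P (relabel k @^-1` A) * P B)%E) ->
  forall A, measurable A -> P (relabel k @^-1` A `&` B) = (P (relabel k @^-1` A) * P B)%E.
Proof.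
move=> mB hB A mA.
have PB0 : 0 <= fine (P B) by rewrite fine_ge0.
have PBE : (fine (P B))%:E = P B by rewrite fineK // fin_num_measure.
pose m1_ : {measure set conf -> \bar R} := pushforward (mrestr P mB) (relabel k).
pose m1 := m1_ (measurable_relabel k).
pose m2 : {measure set conf -> \bar R} := mscale (NngNum PB0) (distribution P (relabel k)).
have e C : m1 C = P (relabel k @^-1` C `&` B) by [].
have e2 C : m2 C = (P B * P (relabel k @^-1` C))%E by rewrite -[in RHS]PBE.
rewrite -e muleC -e2; apply: eq_measure_boxes => //.
  rewrite e; apply: le_lt_trans (probability_le1 _ _) _; rewrite ?ltry //.
  by apply: measurableI => //; exact: measurable_relabel_preimage.
by move=> C bC; rewrite e e2 hB // muleC.
Qed.

Lemma relabel_indep (k k' : vertex d -> vertex d) (A A' : set conf) :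
  injective k -> injective k' -> (forall u v, k u <> k' v) ->
  measurable A -> measurable A' ->
  P (relabel k @^-1` A `&` relabel k' @^-1` A') =
  (P (relabel k @^-1` A) * P (relabel k' @^-1` A'))%E.
Proof.
move=> ki ki' kk mA mA'.
apply: indep_of_boxes => //; first exact: measurable_relabel_preimage.
move=> C bC; rewrite setIC muleC; apply: indep_of_boxes => //.
  by apply: measurable_relabel_preimage; exact: boxes_measurable.
move=> C' bC'; rewrite setIC muleC; exact: relabel_indep_boxes.
Qed.

Lemma relabel_law (k k' : vertex d -> vertex d) (A : set conf) :
  injective k -> injective k' -> measurable A ->
  P (relabel k @^-1` A) = P (relabel k' @^-1` A).
Proof.
suff h q : injective q -> forall J D, uniq J -> (forall v, measurable (D v)) ->
    P (relabel q @^-1` box J D) = (\prod_(v <- J) U (D v))%E.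
  move=> ki ki' mA.
  apply: (@eq_measure_boxes R d (distribution P (relabel k)) (distribution P (relabel k'))) => //.
    by apply: le_lt_trans (probability_le1 (distribution P (relabel k)) measurableT) _; exact: ltry.
  by move=> _ [J [D [uJ mD ->]]]; exact: (etrans (h k ki J D uJ mD) (esym (h k' ki' J D uJ mD))).
move=> qi J D uJ mD; have [_ mX lX indX] := iidX.
pose A0 (i : vertex d) : set R := [set t | forall v, v \in J -> q v = i -> D v t].
have AJ v : v \in J -> A0 (q v) = D v.
  move=> vJ; apply/seteqP; split => t; first by move=> h; exact: h.
  by move=> h u uJ0 /qi ->.
have uK : uniq [seq q v | v <- J] by rewrite map_inj_uniq.
have := indX _ (fun i => X i @^-1` A0 i) uK.
have -> : \bigcap_(i in [set` [seq q v | v <- J]]) X i @^-1` A0 i = relabel q @^-1` box J D.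
  apply/seteqP; split => w h.
    by move=> v vJ; rewrite /relabel -(AJ v vJ); apply: h; rewrite /= map_f.
  by move=> i /= /mapP[v vJ ->]; rewrite /= AJ //; exact: (h v vJ).
move=> ->; last by move=> i /mapP[v vJ ->]; exists (D v); rewrite ?AJ.
rewrite big_map big_seq [RHS]big_seq; apply: eq_bigr => v vJ.
by rewrite AJ // lX.
Qed.

End IidLaw.

(** * Approximation of events and rules by finitely many labels *)

Definition sym_diff (T : Type) (A B : set T) : set T := (A `\` B) `|` (B `\` A).

Section FiniteApprox.
Variables (R : realType) (d : nat) (mu : probability (config d R) R).
Local Notation conf := (config d R).

Definition approximable (A : set conf) : Prop :=
  measurable A /\ forall e : R, 0 < e -> exists (J : seq (vertex d)) (C : set conf),
    [/\ measurable C, depends_on J C & (mu (sym_diff A C) <= e%:E)%E].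

Lemma measurable_sym_diff (A C : set conf) :
  measurable A -> measurable C -> measurable (sym_diff A C).
Proof. by move=> mA mC; apply: measurableU; apply: measurableD. Qed.

Lemma approximableC A : approximable A -> approximable (~` A).
Proof.
move=> [mA hA]; split=> [|e e0]; first exact: measurableC.
have [J [C [mC dC AC]]] := hA e e0; exists J, (~` C); split.
- exact: measurableC.
- by move=> x y xy nCx Cy; apply: nCx; apply: dC Cy => v vJ; rewrite xy.
rewrite (_ : sym_diff _ _ = sym_diff A C) //.
apply/seteqP; split => x [[h1 h2]|[h1 h2]]; rewrite /sym_diff /=.
- by right; split => //; apply: contrapT.
- by left; split => //; apply: contrapT.
- by right; split.
- by left; split.
Qed.

Lemma approximableU A B : approximable A -> approximable B -> approximable (A `|` B).
Proof.
move=> [mA hA] [mB hB]; split=> [|e e0]; first exact: measurableU.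
have e20 : 0 < e / 2 by rewrite divr_gt0.
have [J [C [mC dC AC]]] := hA _ e20; have [J' [C' [mC' dC' BC]]] := hB _ e20.
exists (J ++ J'), (C `|` C'); split.
- exact: measurableU.
- move=> x y xy [Cx|C'x]; [left; apply: dC Cx|right; apply: dC' C'x] => v vJ; apply: xy.
    by rewrite mem_cat vJ.
  by rewrite mem_cat vJ orbT.
apply: (@le_trans _ _ (mu (sym_diff A C `|` sym_diff B C'))).
  apply: le_measure; rewrite ?inE.
  - by apply: measurable_sym_diff; exact: measurableU.
  - by apply: measurableU; exact: measurable_sym_diff.
  move=> x [[[Ax|Bx] nC]|[[Cx|C'x] nA]].
  - by left; left; split => // Cx; apply: nC; left.
  - by right; left; split => // Cx; apply: nC; right.
  - by left; right; split => // Ax; apply: nA; left.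
  - by right; right; split => // Ax; apply: nA; right.
apply: le_trans (measureU2 mu (measurable_sym_diff mA mC) (measurable_sym_diff mB mC')) _.
by rewrite [e in leRHS]splitr EFinD; apply: leeD.
Qed.

Lemma approximable0 : approximable set0.
Proof.
split=> [|e e0]; first exact: measurable0.
exists [::], set0; split => //.
by rewrite /sym_diff set0D setU0 measure0 lee_fin ltW.
Qed.

Lemma approximable_bigcup (F : (set conf)^nat) :
  (forall n, approximable (F n)) -> approximable (\bigcup_n F n).
Proof.
move=> hF; have mF n : measurable (F n) by have [] := hF n.
have mU : measurable (\bigcup_n F n) by exact: bigcupT_measurable.
split=> // e e0; have e20 : 0 < e / 2 by rewrite divr_gt0.
pose B n := \big[setU/set0]_(i < n) F i.
have aB n : approximable (B n).
  by apply: big_ind => //; [exact: approximable0|exact: approximableU].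
have mB n : measurable (B n) by have [] := aB n.
have BU n : B n `<=` \bigcup_n F n by rewrite /B -bigcup_mkord; apply: bigcup_sub => i _ x Fx; exists i.
have ndB : nondecreasing_seq B.
  by move=> i j ij; apply/subsetPset; exact: subset_bigsetU.
have UB : \bigcup_n B n = \bigcup_n F n.
  apply/seteqP; split => x [n _ h]; first exact: BU h.
  by exists n.+1 => //; rewrite /B -bigcup_mkord; exists n => //=.
have mUB : measurable (\bigcup_n B n) by rewrite UB.
have cv := @nondecreasing_cvg_mu _ _ _ mu _ mB mUB ndB.
(* Continuity from below: a finite union misses at most half of the permitted error, and the other
   half goes to approximating it. *)
have [n hn] : exists n, (mu (\bigcup_n F n `\` B n) <= (e / 2)%:E)%E.
  have fE C : measurable C -> mu C = (fine (mu C))%:E by move=> mC; rewrite fineK // fin_num_measure.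
  have : mu (B n) @[n --> \oo] --> (fine (mu (\bigcup_n F n)))%:E.
    by rewrite -fE // -UB; exact: cv.
  move=> /fine_cvg /cvgr_gt /(_ (fine (mu (\bigcup_n F n)) - e / 2)) [].
    by rewrite ltrBlDr ltrDl.
  move=> n _ /(_ n (leqnn n)) /= h; exists n.
  rewrite measureD //; last by apply: le_lt_trans (probability_le1 _ _) _; rewrite ?ltry.
  rewrite setIidr; last exact: BU.
  by rewrite [X in (X - _)%E]fE // [X in (_ - X)%E]fE // -EFinB lee_fin; move: h; lra.
have [_ /(_ _ e20)[J [C [mC dC BC]]]] := aB n.
exists J, C; split => //.
apply: (@le_trans _ _ (mu ((\bigcup_n F n `\` B n) `|` sym_diff (B n) C))).
  have mUB' : measurable (\bigcup_n F n `\` B n) by exact: measurableD.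
  apply: le_measure; rewrite ?inE.
  - exact: measurable_sym_diff.
  - by apply: measurableU => //; exact: measurable_sym_diff.
  move=> x [[Ux nC]|[Cx nU]].
    have [Bx|nB] := pselect (B n x); last by left.
    by right; left.
  by right; right; split => // Bx; apply: nU; exact: BU Bx.
apply: le_trans (measureU2 mu (measurableD mU (mB n)) (measurable_sym_diff (mB n) mC)) _.
by rewrite [e in leRHS]splitr EFinD; apply: leeD.
Qed.

(** The approximable sets form a sigma-algebra, and boxes belong to it since they depend on finitely
    many coordinates themselves. *)
Lemma measurable_approximable (A : set conf) : measurable A -> approximable A.
Proof.
move=> mA; have sA := sigma_boxes mA.
move: A {mA} sA; apply: smallest_sub.
  split; first exact: approximable0.
    by move=> A hA; rewrite setTD; exact: approximableC.
  exact: approximable_bigcup.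
move=> A bA; have mA := boxes_measurable bA; split=> // e e0.
have [J [D [_ mD AE]]] := bA; exists J, A; split => //.
  by rewrite AE => x y xy h v vJ; rewrite -xy //; exact: h.
by rewrite /sym_diff setDv setU0 measure0 lee_fin ltW.
Qed.

End FiniteApprox.

Section ApproxFunction.
Variables (R : realType) (d : nat) (mu : probability (config d R) R).
Variable S : pfinType.

(** Each level set of [f] is approximated up to e/|S| and [g] picks a state whose approximant
    contains the point. The set [W] will be the unit cube, the only place where a factor rule is
    known to be measurable. *)
Lemma finite_range_approx (f : config d R -> S) (W : set (config d R)) (e : R) : 0 < e ->
  (forall B : set S, measurable (W `&` f @^-1` B)) -> mu W = 1%E ->
  exists (J : seq (vertex d)) (g : config d R -> S),
  [/\ (forall x y : vertex d -> R, (forall v, v \in J -> x v = y v) -> g x = g y),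
      (forall B : set S, measurable (g @^-1` B)),
      measurable [set x | W x /\ f x <> g x]
    & (mu [set x | W x /\ f x <> g x] <= e%:E)%E].
Proof.
move=> e0 mf mW.
have NS : 0 < #|S|%:R :> R by rewrite ltr0n; apply/card_gt0P; exists point.
have es : 0 < e / #|S|%:R by rewrite divr_gt0.
have H s : exists JC : seq (vertex d) * set (config d R),
  [/\ measurable JC.2, depends_on JC.1 JC.2
    & (mu (sym_diff (W `&` f @^-1` [set s]) JC.2) <= (e / #|S|%:R)%:E)%E].
  have [_ /(_ _ es)[J [C hC]]] := measurable_approximable mu (mf [set s]).
  by exists (J, C).
pose JC s := sval (cid (H s)); have JCP s := svalP (cid (H s)).
pose g (x : config d R) : S := odflt point [pick s | `[< (JC s).2 x >]].
have dg : forall x y : vertex d -> R,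
  (forall v, v \in flatten [seq (JC s).1 | s <- enum S] -> x v = y v) -> g x = g y.
  move=> x y xy; rewrite /g; congr odflt; apply: eq_pick => s.
  have [_ dC _] := JCP s.
  have hJ v : v \in (JC s).1 -> x v = y v.
    by move=> vJ; apply: xy; apply/flattenP; exists (JC s).1 => //; apply/mapP; exists s; rewrite ?mem_enum.
  by apply/asboolP/asboolP; apply: dC => v vJ; rewrite hJ.
have mgB : forall B : set S, measurable (g @^-1` B).
  (* The value of [g] depends only on the set [T] of states whose approximants contain the point,
     and there are finitely many such sets. *)
  move=> B; pose K (T : {set S}) : set (config d R) := [set x | T = [set s | `[< (JC s).2 x >]]%SET].
  have mK T : measurable (K T).
    rewrite (_ : K T = \bigcap_(s in [set: S]) [set x | (s \in T) = `[< (JC s).2 x >]]).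
      apply: fin_bigcap_measurable => // s _; have [mC _ _] := JCP s.
      case: (s \in T).
        rewrite (_ : [set x | _] = (JC s).2) //; apply/seteqP; split => x /=.
          by move=> /esym/asboolP.
        by move=> h; apply/esym/asboolP.
      rewrite (_ : [set x | _] = ~` (JC s).2); first exact: measurableC.
      apply/seteqP; split => x /=; first by move=> /esym/asboolP.
      by move=> h; apply/esym/asboolP.
    apply/seteqP; split => x; first by move=> -> s _ /=; rewrite inE.
    by move=> h; apply/setP => s; rewrite inE; exact: h.
  pose gT (T : {set S}) : S := odflt point [pick s in T].
  rewrite (_ : g @^-1` B = \bigcup_(T in [set T | B (gT T)]) K T).
    by apply: fin_bigcup_measurable => //; exact: finite_finset.
  have gK x T : K T x -> g x = gT T.
    by move=> ->; rewrite /g /gT; congr odflt; apply: eq_pick => s; rewrite inE.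
  apply/seteqP; split => x.
    move=> Bx; exists [set s | `[< (JC s).2 x >]]%SET => //=.
    by rewrite -(gK x).
  by move=> [T /= BT KT]; rewrite /= (gK x T KT).
have mD s : measurable (sym_diff (W `&` f @^-1` [set s]) (JC s).2).
  by apply: measurable_sym_diff => //; have [mC _ _] := JCP s.
have mE : measurable [set x | W x /\ f x <> g x].
  rewrite (_ : [set x | _] = \big[setU/set0]_(s : S) ((W `&` f @^-1` [set s]) `&` g @^-1` (~` [set s]))).
    by apply: bigsetU_measurable => s _; apply: measurableI.
  rewrite -bigcup_seq; apply/seteqP; split => x.
    by move=> [Wx fg]; exists (f x) => /=; [exact: mem_index_enum|split => // /esym].
  by move=> [s _ [[Wx <-] /= gf]]; split => // /esym.
exists (flatten [seq (JC s).1 | s <- enum S]), g; split => //.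
apply: (@le_trans _ _ (mu (\big[setU/set0]_(s : S) sym_diff (W `&` f @^-1` [set s]) (JC s).2))).
  apply: le_measure; rewrite ?inE.
  - by [].
  - by apply: bigsetU_measurable.
  move=> x [Wx fg]; rewrite -bigcup_seq.
  (* If [f x <> g x], either the approximant of [f x] misses [x], or that of the other state [g x]
     contains it; both put [x] into a symmetric difference. *)
  have [Cx|nCx] := pselect ((JC (f x)).2 x); last first.
    by exists (f x) => /=; [exact: mem_index_enum|left; split].
  exists (g x) => /=; first exact: mem_index_enum.
  right; split; last by move=> [_].
  rewrite /g; case: pickP => [t /asboolP //|/(_ (f x))].
  by rewrite asboolT.
apply: le_trans (measure_big_setU_le mu _ _ mD) _.
apply: (@le_trans _ _ (\sum_(s : S) (e / #|S|%:R)%:E)%E).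
  by apply: lee_sum => s _; have [_ _] := JCP s.
rewrite sumEFin lee_fin sumr_const -[_ *+ #|_|]mulr_natl mulrCA divff ?mulr1 //.
by rewrite gt_eqF.
Qed.
End ApproxFunction.

(** The first-moment method with several requirements at once: if each is scaled so that failing it
    costs at least 1, an expected total below 1 yields one outcome that meets them all. *)
Lemma exists_small_weight (R : realType) d (T : measurableType d)
    (P : probability T R) (I : finType) (E : I -> set T) (a : I -> R) :
  (forall i, measurable (E i)) -> (forall i, 0 <= a i) ->
  (\sum_i (a i)%:E * P (E i) < 1)%E ->
  exists w, \sum_i a i * (`[< E i w >])%:R < 1.
Proof.
move=> mE a0 lt1; apply: contrapT => no.
have ge1 w : 1 <= \sum_i a i * (`[< E i w >])%:R.
  by rewrite leNgt; apply/negP => h; apply: no; exists w.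
suff : (1 <= \sum_i (a i)%:E * P (E i))%E by rewrite leNgt lt1.
have -> : (\sum_i (a i)%:E * P (E i))%E = (\int[P]_w (\sum_i (a i)%:E * (\1_(E i) w)%:E))%E.
  rewrite ge0_integral_sum //.
  - apply: eq_bigr => i _; rewrite ge0_integralZl //.
    + by rewrite integral_indic // setIT.
    + exact/measurable_EFinP/measurable_indic.
    + by rewrite lee_fin.
  - by move=> i; apply: measurable_funeM; exact/measurable_EFinP/measurable_indic.
  - by move=> i w _; rewrite mule_ge0 ?lee_fin.
apply: (@le_trans _ _ (\int[P]_w (cst 1%E w))%E).
  rewrite integral_cst // mul1e le_eqVlt; apply/orP; left; apply/eqP.
  exact: (esym (@probability_setT _ _ _ P)).
have mF : measurable_fun setT (fun w => (\sum_i (a i)%:E * (\1_(E i) w)%:E)%E).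
  apply: emeasurable_sum => i; apply: measurable_funeM.
  exact/measurable_EFinP/measurable_indic.
apply: ge0_le_integral => // w _ /=.
rewrite (eq_bigr (fun i => (a i * (`[< E i w >])%:R)%:E)) => [|i _].
  by rewrite sumEFin lee_fin.
by rewrite indicE EFinM.
Qed.

(** * Colouring every lift by a rule of finite radius *)

Section LiftColoring.
Variables (R : realType) (d : nat) (dO : measure_display) (Om : measurableType dO).
Variables (P : probability Om R) (X : vertex d -> Om -> R).
Hypothesis d3 : (3 <= d)%N.
Hypothesis iidX : iid_uniform P X.
Variables (S : pfinType) (al : rel S) (q : nat).
Hypothesis q_large : expR (7 * d%:R) < q%:R :> R.
Hypothesis cardS : #|S| = (q ^ 10)%N.
Hypothesis al_deg : forall s, (#|al s| <= q ^ 2)%N.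
Variables (J : seq (vertex d)) (g : config d R -> S).
Hypothesis gJ : forall x y : vertex d -> R, (forall v, v \in J -> x v = y v) -> g x = g y.
Hypothesis mg : forall B : set S, measurable (g @^-1` B).
Hypothesis g_law : forall s,
  (P (relabel X id @^-1` (g @^-1` [set s])) <= (2 / #|S|%:R)%:E)%E.
Hypothesis g_edge : forall i,
  (P [set w | ~~ al (g (relabel X id w)) (g (relabel X (@vrmul d i) w))]
     <= ((160 * d)%N%:R^-1)%:E)%E.

(** One more than the radius of the rule, so that the labels read at a neighbour are still reached
    by words of length at most [r]. *)
Let r : nat := (\max_(v <- J) size (val v)).+1.
Let sizeJ v : v \in J -> (size (val v) < r)%N.
Proof. by move=> vJ; rewrite ltnS (big_rem v vJ) /= leq_maxl. Qed.

Let K := {perm short_word d r}.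
(** The fibre is so large that overlapping pairs add at most 1/20 to the expected weight below. *)
Let m : nat := (4 * (q ^ 8) * #|short_word d r| ^ 2).+1.
Variable tau : {ffun 'I_d * K -> {perm 'I_m}}.
Let V : finType := (K * 'I_m * bool)%type.

Variable iota : (V + vertex d * bool)%type -> vertex d.
Hypothesis iota_inj : injective iota.

(* The rule at [v] reads the labels along the walks from [v].  The labels outside
   the ball of radius [r], which [g] ignores, are private to the side [b]; this
   makes [kap v b] injective, and disjoint balls get independent colours. *)
Let kap (v : V) (b : bool) (u : vertex d) : vertex d :=
  if (size (val u) <= r)%N then iota (inl (walk tau (val u) v)) else iota (inr (u, b)).

Let kap_inj v b : injective (kap v b).
Proof.
move=> u u'; rewrite /kap; case: ifP => hu; case: ifP => hu' /iota_inj [] //.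
move=> h; apply: val_inj; apply: walk_inj h => //; exact: valP.
Qed.

Let kap_disj v v' : ~~ overlap tau v v' -> forall u u', kap v true u <> kap v' false u'.
Proof.
move=> nov u u'; rewrite /kap; case: ifP => hu; case: ifP => hu' /iota_inj [] // h.
move: nov => /existsP; apply.
exists (exist _ (Bseq hu) (valP u)); apply/existsP.
by exists (exist _ (Bseq hu') (valP u')); rewrite /= h.
Qed.

Let col (v : V) (w : Om) : S := g (relabel X (kap v true) w).

Let col_false v w : g (relabel X (kap v false) w) = col v w.
Proof. by apply: gJ => u uJ; rewrite /relabel /kap ltnW // sizeJ. Qed.

(** Seen from [v], the rule at the neighbour reads the labels at right multiples by [i], which stay
    within radius [r]. So the colours across an edge have the joint law of the factor at the root
    and a neighbour. *)
Let col_move i v w : col (move tau i v) w = g (relabel X (kap v true \o @vrmul d i) w).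
Proof.
apply: gJ => u uJ; rewrite /relabel /kap /= (ltnW (sizeJ uJ)).
by rewrite (leq_trans (size_rmul _ _) (sizeJ uJ)) walk_rmul.
Qed.

Let mcol v s : measurable [set w | col v w = s].
Proof. exact: (measurable_relabel_preimage iidX (kap v true) (mg [set s])). Qed.

Let mcol_rel v v' (Q : rel S) : measurable [set w | Q (col v w) (col v' w)].
Proof.
rewrite (_ : [set w | _] = \big[setU/set0]_(p : S * S | Q p.1 p.2)
  ([set w | col v w = p.1] `&` [set w | col v' w = p.2])).
  by apply: bigsetU_measurable => p _; apply: measurableI; exact: mcol.
rewrite -bigcup_seq_cond; apply/seteqP; split => w.
  by move=> /= h; exists (col v w, col v' w) => //=; rewrite mem_index_enum.
by move=> [p /= /andP[_ Qp] [/= e1 e2]]; rewrite /= e1 e2.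
Qed.

Let Pcol v s : (P [set w | col v w = s] <= (2 / #|S|%:R)%:E)%E.
Proof.
apply: le_trans (g_law s); rewrite le_eqVlt; apply/orP; left; apply/eqP.
exact: (relabel_law iidX (@kap_inj v true) (@inj_id _) (mg [set s])).
Qed.

Let Pedge v i : (P [set w | ~~ al (col v w) (col (move tau i v) w)] <= ((160 * d)%N%:R^-1)%:E)%E.
Proof.
apply: le_trans (g_edge i); rewrite le_eqVlt; apply/orP; left; apply/eqP.
pose E : set (config d R) := [set x | ~~ al (g x) (g (fun u => x (vrmul i u)))].
have mE : measurable E.
  have ms : measurable_fun setT (fun x : config d R => (fun u => x (vrmul i u)) : config d R).
    apply: (measurable_to_config (@rat_itv_basis R)) => v0 j.
    by have := @measurable_coordinate R d (vrmul i v0) measurableT _ (measurable_itv `]ratr j.1, ratr j.2[); rewrite setTI.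
  rewrite (_ : E = \big[setU/set0]_(p : S * S | ~~ al p.1 p.2)
    ((g @^-1` [set p.1]) `&` ((fun x : config d R => (fun u => x (vrmul i u)) : config d R) @^-1` (g @^-1` [set p.2])))).
    apply: bigsetU_measurable => p _; apply: measurableI => //.
    by have := ms measurableT _ (mg [set p.2]); rewrite setTI.
  rewrite -bigcup_seq_cond; apply/seteqP; split => x.
    by move=> /= h; exists (g x, g (fun u => x (vrmul i u))) => //=; rewrite mem_index_enum.
  by move=> [p /= /andP[_ Qp] [/= e1 e2]]; rewrite /E /= e1 e2.
have := relabel_law iidX (@kap_inj v true) (@inj_id _) mE.
by congr (P _ = P _); apply/seteqP; split => w; rewrite /E /= -?col_move.
Qed.

(** Disjoint balls give independent colours: at most |S| q^2 allowed pairs, each of probability at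
    most (2/|S|)^2, and |S| = q^10. *)
Let Pallowed v v' : ~~ overlap tau v v' ->
  (P [set w | al (col v w) (col v' w)] <= (4 / (q ^ 8)%N%:R)%:E)%E.
Proof.
move=> nov.
have N0 : 0 < #|S|%:R :> R by rewrite ltr0n; apply/card_gt0P; exists point.
have indep s t : P ([set w | col v w = s] `&` [set w | col v' w = t]) =
    (P [set w | col v w = s] * P [set w | col v' w = t])%E.
  have := relabel_indep iidX (@kap_inj v true) (@kap_inj v' false) (kap_disj nov)
    (mg [set s]) (mg [set t]).
  have -> : relabel X (kap v' false) @^-1` (g @^-1` [set t]) = [set w | col v' w = t].
    by apply/seteqP; split => w /=; rewrite col_false.
  exact.
rewrite (_ : [set w | _] = \big[setU/set0]_(p : S * S | al p.1 p.2)
  ([set w | col v w = p.1] `&` [set w | col v' w = p.2])); last first.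
  rewrite -bigcup_seq_cond; apply/seteqP; split => w.
    by move=> /= h; exists (col v w, col v' w) => //=; rewrite mem_index_enum.
  by move=> [p /= /andP[_ Qp] [/= e1 e2]]; rewrite /= e1 e2.
apply: le_trans (measure_big_setU_le P _ _ _) _ => [p|]; first exact: measurableI.
apply: (@le_trans _ _ (\sum_(p : S * S | al p.1 p.2) ((2 / #|S|%:R) * (2 / #|S|%:R))%:E)%E).
  apply: lee_sum => p _.
  apply: (@le_trans _ _ (P [set w | col v w = p.1] * P [set w | col v' w = p.2])%E).
    by rewrite le_eqVlt; apply/orP; left; apply/eqP; exact: indep.
  by rewrite EFinM; apply: lee_pmul => //; exact: Pcol.
rewrite sumEFin lee_fin sumr_const -[_ *+ #|_|]mulr_natl.
have cal : (#|[pred p : S * S | al p.1 p.2]| <= #|S| * q ^ 2)%N.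
  rewrite (card_dep_pairs predT al) -sum_nat_const.
  by apply: leq_sum => s _; exact: al_deg.
have cR : #|[pred p : S * S | al p.1 p.2]|%:R <= #|S|%:R * (q ^ 2)%N%:R :> R.
  by rewrite -natrM ler_nat.
have SE : #|S|%:R = (q ^ 2)%N%:R * (q ^ 8)%N%:R :> R by rewrite cardS -natrM -expnD.
have q20 : 0 < (q ^ 2)%N%:R :> R by rewrite ltr0n expn_gt0 (q_gt0 q_large).
have q80 : 0 < (q ^ 8)%N%:R :> R by rewrite ltr0n expn_gt0 (q_gt0 q_large).
apply: (@le_trans _ _ (#|S|%:R * (q ^ 2)%N%:R * ((2 / #|S|%:R) * (2 / #|S|%:R)))).
  by apply: ler_wpM2r => //; rewrite !mulr_ge0 ?invr_ge0.
rewrite SE; move: q20 q80; move: ((q ^ 2)%N%:R) ((q ^ 8)%N%:R) => x y x0 y0.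
by rewrite le_eqVlt; apply/orP; left; apply/eqP; field; rewrite !gt_eqF.
Qed.

Local Notation lift_edge := (('I_d * K) * ('I_m * 'I_m))%type.
Let src (x : lift_edge) : V := (x.1.2, x.2.1, true).
Let tgt (x : lift_edge) : V := (shift x.1.1 x.1.2, x.2.2, false).
Let L : nat := (#|K| * m)%N.

Lemma exists_good_lift_coloring :
  exists c : V -> S, good_lift_coloring al (@shift d r) q tau c.
Proof.
have q80 : 0 < (q ^ 8)%N%:R :> R by rewrite ltr0n expn_gt0 (q_gt0 q_large).
have K0 : (0 < #|K|)%N by apply/card_gt0P; exists 1%g.
have L0 : 0 < L%:R :> R by rewrite ltr0n muln_gt0 K0.
have m0 : 0 < m%:R :> R by rewrite ltr0n.
have d0 : 0 < d%:R :> R by rewrite ltr0n; case: (d) d3.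
(* With the weights [a1] and [a2] the two requirements of [good_lift_coloring] are violated only if
   the corresponding sum exceeds 1. Inadmissible pairs outside the lift get weight 0. *)
pose a1 : R := (q ^ 8)%N%:R / (5 * d%:R * L%:R * m%:R).
have a10 : 0 <= a1 by rewrite divr_ge0 // !mulr_ge0.
pose a2 : R := 8 / L%:R.
have a20 : 0 <= a2 by rewrite divr_ge0.
pose E (x : lift_edge + lift_edge) : set Om := match x with
  | inl x => [set w | al (col (src x) w) (col (tgt x) w)]
  | inr x => [set w | ~~ al (col (src x) w) (col (tgt x) w)] end.
pose a (x : lift_edge + lift_edge) : R := match x with
  | inl x => a1 | inr x => if x \in lift_edges tau then a2 else 0 end.
have mE x : measurable (E x).
  by case: x => x; [exact: mcol_rel|exact: (mcol_rel _ _ (fun s t => ~~ al s t))].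
have a0 x : 0 <= a x by case: x => x //=; case: ifP.
pose b (x : lift_edge + lift_edge) : R := match x with
  | inl x => 4 / (q ^ 8)%N%:R + (overlap tau (src x) (tgt x))%:R
  | inr x => if x \in lift_edges tau then (160 * d)%N%:R^-1 else 1 end.
have Pb x : (P (E x) <= (b x)%:E)%E.
  case: x => x /=.
    have [ov|nov] := boolP (overlap tau (src x) (tgt x)).
      apply: le_trans (probability_le1 P (mcol_rel _ _ al)) _.
      by rewrite lee_fin lerDr divr_ge0.
    by rewrite addr0; exact: Pallowed.
  case: ifPn => [xt|_]; last exact: probability_le1 (mcol_rel _ _ (fun s t => ~~ al s t)).
  have -> : tgt x = move tau x.1.1 (src x).
    by move: xt; rewrite inE => /eqP e; rewrite /tgt /src /move e -surjective_pairing.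
  exact: Pedge.
have sumov : (\sum_x overlap tau (src x) (tgt x) <= d * L * #|short_word d r| ^ 2)%N.
  rewrite -(pair_big predT predT (fun e jj => overlap tau (src (e, jj)) (tgt (e, jj)) : nat)) /=.
  apply: (@leq_trans (\sum_(e : 'I_d * K) m * #|short_word d r| ^ 2)%N); last first.
    by rewrite sum_nat_const card_prod card_ord /L !mulnA.
  apply: leq_sum => e _.
  rewrite -(pair_big predT predT (fun j j' => overlap tau (src (e, (j, j'))) (tgt (e, (j, j'))) : nat)) /=.
  apply: (@leq_trans (\sum_(j : 'I_m) #|short_word d r| ^ 2)%N); last first.
    by rewrite sum_nat_const card_ord.
  apply: leq_sum => j _; apply: leq_trans (card_overlap tau (e.2, j, true)).
  pose h (j' : 'I_m) : V := (shift e.1 e.2, j', false).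
  have hi : injective h by move=> j1 j2 [].
  rewrite -big_mkcond sum1_card /= -(card_imset _ hi).
  apply: subset_leq_card; apply/fintype.subsetP => _ /imsetP[j' hj' ->].
  by rewrite inE; move: hj'; rewrite unfold_in.
have sum_ab : \sum_x a x * b x < 1.
  rewrite big_sumType /=.
  have -> : \sum_(x : lift_edge) a1 * (4 / (q ^ 8)%N%:R + (overlap tau (src x) (tgt x))%:R) =
      a1 * (d%:R * L%:R * m%:R * (4 / (q ^ 8)%N%:R) + (\sum_x overlap tau (src x) (tgt x))%N%:R).
    rewrite -mulr_sumr big_split /= natr_sum sumr_const -[_ *+ #|_|]mulr_natl; congr (_ * (_ * _ + _)).
    by rewrite !card_prod !card_ord /L !natrM !mulrA.
  have -> : \sum_(x : lift_edge) (if x \in lift_edges tau then a2 else 0) *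
      (if x \in lift_edges tau then (160 * d)%N%:R^-1 else 1) = d%:R * L%:R * (a2 / (160 * d)%N%:R).
    rewrite (eq_bigr (fun x => if x \in lift_edges tau then a2 / (160 * d)%N%:R else 0)); last first.
      by move=> x _; case: ifP => _; rewrite ?mul0r.
    rewrite -big_mkcond sumr_const -[_ *+ #|_|]mulr_natl card_lift_edges /L.
    by rewrite !natrM !mulrA.
  have ov : (\sum_x overlap tau (src x) (tgt x))%N%:R <= d%:R * L%:R * (#|short_word d r| ^ 2)%N%:R :> R.
    by rewrite -!natrM ler_nat.
  have mB : 4 * (q ^ 8)%N%:R * (#|short_word d r| ^ 2)%N%:R <= m%:R :> R.
    by rewrite -!natrM ler_nat /m.
  move: ov mB; rewrite /a1 /a2 natrM; move: (\sum_x _)%N%:R ((_ ^ 2)%N%:R) => o B ov mB.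
  (* The three terms come from allowed pairs with disjoint balls, from overlapping pairs, and from
     inadmissible edges of the lift: d|K|m edges of weight 8/(|K|m) and probability at most
     1/(160d). *)
  apply: (@le_lt_trans _ _ (4 / 5 + 20^-1 + 20^-1)); last lra.
  apply: lerD; last first.
    rewrite le_eqVlt; apply/orP; left; apply/eqP; field.
    by rewrite !gt_eqF.
  rewrite mulrDr; apply: lerD.
    rewrite le_eqVlt; apply/orP; left; apply/eqP; field.
    have qR : 0 < q%:R :> R by rewrite ltr0n (q_gt0 q_large).
    have KR : 0 < #|K|%:R :> R by rewrite ltr0n.
    by rewrite !gt_eqF ?mulr_gt0.
  rewrite mulrAC ler_pdivrMr ?mulr_gt0 //.
  have := ler_wpM2l (ltW q80) ov; have := ler_wpM2l (mulr_ge0 (ltW d0) (ltW L0)) mB.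
  by lra.
have H : (\sum_x (a x)%:E * P (E x) < 1)%E.
  apply: (@le_lt_trans _ _ (\sum_x (a x * b x)%:E)%E); last by rewrite sumEFin lte_fin.
  by apply: lee_sum => x _; rewrite EFinM; apply: lee_wpmul2l; rewrite ?lee_fin.
have [w] := exists_small_weight mE a0 H; rewrite big_sumType /= => hw.
pose c (v : V) := col v w; exists c; rewrite /good_lift_coloring.
have s1 : \sum_(x : lift_edge) a1 * (`[< al (col (src x) w) (col (tgt x) w) >])%:R =
    a1 * #|allowed_edges al (@shift d r) c|%:R.
  rewrite -mulr_sumr -natr_sum; congr (_ * _%:R).
  rewrite -sum1_card [RHS]big_mkcond /=.
  by apply: eq_bigr => x _; rewrite inE asboolb /c /src /tgt; case: (al _ _).
have s2 : \sum_(x : lift_edge) (if x \in lift_edges tau then a2 else 0) *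
    (`[< ~~ al (col (src x) w) (col (tgt x) w) >])%:R =
    a2 * #|lift_edges tau :\: allowed_edges al (@shift d r) c|%:R.
  rewrite -sum1_card natr_sum mulr_sumr [RHS]big_mkcond /=.
  apply: eq_bigr => x _; rewrite !inE asboolb /c /src /tgt.
  by case: (_ == _); case: (al _ _) => /=; rewrite ?mulr1 ?mulr0 ?mul0r.
have p1 : 0 <= a1 * #|allowed_edges al (@shift d r) c|%:R by rewrite mulr_ge0.
have p2 : 0 <= a2 * #|lift_edges tau :\: allowed_edges al (@shift d r) c|%:R by rewrite mulr_ge0.
move: hw; rewrite s1 s2 => hw.
apply/andP; split.
  have : a1 * #|allowed_edges al (@shift d r) c|%:R < 1 by lra.
  rewrite /a1 mulrAC ltr_pdivrMr ?mulr_gt0 // mul1r -!natrM ltr_nat => /ltnW.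
  by rewrite mulnC /L !mulnA.
have : a2 * #|lift_edges tau :\: allowed_edges al (@shift d r) c|%:R < 1 by lra.
rewrite /a2 mulrAC ltr_pdivrMr // mul1r -natrM ltr_nat => /ltnW.
by rewrite /L.
Qed.

End LiftColoring.

Section NoGoodRule.
Variables (R : realType) (d : nat) (dO : measure_display) (Om : measurableType dO).
Variables (P : probability Om R) (X : vertex d -> Om -> R).
Hypothesis d3 : (3 <= d)%N.
Hypothesis iidX : iid_uniform P X.
Variables (S : pfinType) (al : rel S) (q : nat).
Hypothesis q_large : expR (7 * d%:R) < q%:R :> R.
Hypothesis cardS : #|S| = (q ^ 10)%N.
Hypothesis al_deg : forall s, (#|al s| <= q ^ 2)%N.

Lemma no_good_finite_rule (J : seq (vertex d)) (g : config d R -> S) :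
  (forall x y : vertex d -> R, (forall v, v \in J -> x v = y v) -> g x = g y) ->
  (forall B : set S, measurable (g @^-1` B)) ->
  (forall s, (P (relabel X id @^-1` (g @^-1` [set s])) <= (2 / #|S|%:R)%:E)%E) ->
  ~ (forall i, (P [set w | ~~ al (g (relabel X id w)) (g (relabel X (@vrmul d i) w))]
     <= ((160 * d)%N%:R^-1)%:E)%E).
Proof.
move=> gJ mg glaw gedge.
pose r : nat := (\max_(v <- J) size (val v)).+1.
pose m : nat := (4 * (q ^ 8) * #|short_word d r| ^ 2).+1.
have K0 : (0 < #|{perm short_word d r}|)%N by apply/card_gt0P; exists 1%g.
have [iota iota_inj] := @countable_injection d
  ({perm short_word d r} * 'I_m * bool + vertex d * bool)%type (leq_trans (isT : 1 < 3)%N d3).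
apply: (@not_all_lifts_good S al d m _ (@shift d r) R q d3 q_large cardS (ltn0Sn _) K0) => tau.
exact: (exists_good_lift_coloring d3 iidX q_large cardS al_deg gJ mg glaw gedge tau iota_inj).
Qed.

(** The rule is replaced by one of finite radius. The bounds 3/2 and 1/(320d) leave room for the
    error, so that 2 and 1/(160d) hold after the replacement. *)
Lemma no_good_rule (f : config d R -> S) : factor_rule f ->
  (forall s, (P [set w | f (relabel X id w) = s] <= (3 / 2 / #|S|%:R)%:E)%E) ->
  ~ (forall i, (P [set w | ~~ al (f (relabel X id w)) (f (relabel X (@vrmul d i) w))]
     <= ((320 * d)%N%:R^-1)%:E)%E).
Proof.
move=> [mf _] flaw fedge.
have N0 : 0 < #|S|%:R :> R by rewrite ltr0n; apply/card_gt0P; exists point.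
have N1 : 1 <= #|S|%:R :> R by rewrite ler1n -(ltr_nat R).
have d0 : 0 < d%:R :> R by rewrite ltr0n; case: (d) d3.
have d1 : 1 <= d%:R :> R by rewrite ler1n; case: (d) d3.
have [X01 _ _ _] := iidX.
pose W : set (config d R) := @unit_cube R d.
pose rel_ : {mfun Om >-> config d R} := relabel X id.
pose rel := rel_ P iidX.
pose law := distribution P rel.
have relW k w : W (relabel X k w) by move=> v; exact: X01.
have lawW : law W = 1%E.
  rewrite -(@probability_setT _ _ _ P); transitivity (P (relabel X id @^-1` W)); first by [].
  by congr (P _); apply/seteqP; split => // w _; exact: relW.
(* Small enough for both uses: at most 1/(2|S|) for one colour, and twice it at most 1/(320d) for an
   edge, at whose two ends the rules may differ. *)
pose e : R := (640 * d%:R * #|S|%:R)^-1.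
have e0 : 0 < e by rewrite invr_gt0 (mulr_gt0 (mulr_gt0 (ltr0Sn _ 639) d0) N0).
have e1 : e <= 2^-1 / #|S|%:R.
  rewrite /e invfM; apply: ler_wpM2r; first by rewrite invr_ge0 ltW.
  by rewrite lef_pV2 ?posrE; lra.
have e2 : e <= (640 * d%:R)^-1.
  have c0 : 0 < 640 * d%:R :> R by lra.
  by rewrite /e invfM -[leRHS]mulr1; apply: ler_wpM2l; [rewrite invr_ge0 ltW|rewrite invf_le1].
have [J [g [gJ mg mD hD]]] := finite_range_approx e0 mf lawW.
set D := [set x | _] in mD hD.
have PD k : injective k -> (P (relabel X k @^-1` D) <= e%:E)%E.
  move=> ki; apply: le_trans hD; rewrite le_eqVlt; apply/orP; left; apply/eqP.
  exact: (relabel_law iidX ki (@inj_id _) mD).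
have mpD k : measurable (relabel X k @^-1` D) := measurable_relabel_preimage iidX k mD.
have mf2 k s : measurable [set w | f (relabel X k w) = s].
  rewrite (_ : [set w | _] = relabel X k @^-1` (W `&` f @^-1` [set s])).
    exact: (measurable_relabel_preimage iidX k (mf [set s])).
  by apply/seteqP; split => w; [move=> h; split => //; exact: relW|case].
have mg2 k s : measurable [set w : Om | g (relabel X k w) = s].
  exact: (measurable_relabel_preimage iidX k (mg [set s])).
have fg k w : ~ (relabel X k @^-1` D) w -> f (relabel X k w) = g (relabel X k w).
  by move=> nD; apply: contrapT => h; apply: nD; split => //; exact: relW.
have mpair (h : config d R -> S) (Q : ssrbool.rel S) k1 k2 :
    (forall k s, measurable [set w : Om | h (relabel X k w) = s]) ->
    measurable [set w : Om | Q (h (relabel X k1 w)) (h (relabel X k2 w))].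
  move=> mh; rewrite (_ : [set w | _] = \big[setU/set0]_(p : S * S | Q p.1 p.2)
    ([set w | h (relabel X k1 w) = p.1] `&` [set w | h (relabel X k2 w) = p.2])).
    by apply: bigsetU_measurable => p _; exact: measurableI.
  rewrite -bigcup_seq_cond; apply/seteqP; split => w.
    by move=> /= hQ; exists (h (relabel X k1 w), h (relabel X k2 w)) => //=; rewrite mem_index_enum.
  by move=> [p /= /andP[_ Qp] [/= e3 e4]]; rewrite e3 e4.
apply: (no_good_finite_rule gJ mg) => [s|i].
  apply: (@le_trans _ _ (P ([set w | f (relabel X id w) = s] `|` relabel X id @^-1` D))).
    apply: le_measure; [by apply/mem_set; exact: mg2|by apply/mem_set; exact: measurableU|].
    move=> w /= gs; have [Dw|nD] := pselect ((relabel X id @^-1` D) w); first by right.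
    by left; rewrite /= fg.
  apply: le_trans (measureU2 P (mf2 _ _) (mpD _)) _.
  apply: (@le_trans _ _ ((3 / 2 / #|S|%:R)%:E + e%:E)%E).
    by apply: leeD; [exact: flaw|exact: PD].
  by rewrite -EFinD lee_fin; move: e1; lra.
have inji : injective (@vrmul d i) by exact: inv_inj (@vrmulK d i).
pose nal := fun s t => ~~ al s t.
apply: (@le_trans _ _ (P ([set w | ~~ al (f (relabel X id w)) (f (relabel X (@vrmul d i) w))]
    `|` (relabel X id @^-1` D `|` relabel X (@vrmul d i) @^-1` D)))).
  apply: le_measure.
  - by apply/mem_set; exact: (mpair g nal).
  - by apply/mem_set; apply: measurableU; [exact: (mpair f nal)|exact: measurableU].
  move=> w /= gs; have [Dw|nD] := pselect ((relabel X id @^-1` D) w); first by right; left.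
  have [Dw'|nD'] := pselect ((relabel X (@vrmul d i) @^-1` D) w); first by right; right.
  by left; rewrite /= !fg.
apply: le_trans (measureU2 P (mpair f nal _ _ mf2) (measurableU _ _ (mpD _) (mpD _))) _.
apply: (@le_trans _ _ (((320 * d)%N%:R^-1)%:E + (e%:E + e%:E))%E).
  apply: leeD; first exact: fedge.
  apply: le_trans (measureU2 P (mpD _) (mpD _)) _.
  by apply: leeD; exact: PD.
rewrite -!EFinD lee_fin; move: e2; rewrite !natrM !invfM.
by move: (d%:R^-1 : R) => x; lra.
Qed.

End NoGoodRule.

Section NotWeakLimit.
Variables (R : realType) (d : nat).
Hypothesis d3 : (3 <= d)%N.
Variables (S : pfinType) (al : rel S) (q : nat).
Hypothesis q_large : expR (7 * d%:R) < q%:R :> R.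
Hypothesis cardS : #|S| = (q ^ 10)%N.
Hypothesis al_deg : forall s, (#|al s| <= q ^ 2)%N.
Variable mu : process R d S.
Hypothesis mu_root : forall s, mu [set x | x (tree_root d) = s] = (#|S|%:R^-1)%:E.
Hypothesis mu_star :
  mu [set x | forall j, al (x (tree_root d)) (x (letter j))] = 1%E.

Lemma vrmul_letter (i : 'I_d) : vrmul i (tree_root d) = letter i.
Proof. exact: val_inj. Qed.

Lemma tree_aut_id : tree_aut (@id (vertex d)).
Proof. by split => //; exists id. Qed.

(** The colour of the root and the admissibility of the d edges there are finitely many events of
    finite range, so a single late factor of i.i.d. process nearly has their limiting probabilities.
    Its rule is then excluded by [no_good_rule]. *)
Lemma not_weak_limit : ~ weak_limit_of_fiid mu.
Proof.
move=> [mu_ [fiid cv]].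
have N0 : 0 < #|S|%:R :> R by rewrite ltr0n; apply/card_gt0P; exists point.
have d0 : 0 < d%:R :> R by rewrite ltr0n; case: (d) d3.
pose rt s : set (config d (discrete S)) := [set x | x (tree_root d) = s].
have drt s : depends_on [:: tree_root d] (rt s).
  by move=> x y xy; rewrite /rt /= xy // mem_head.
pose edge j : set (config d (discrete S)) := [set x | al (x (tree_root d)) (x (letter j))].
have dedge j : depends_on [:: tree_root d; letter j] (edge j).
  by move=> x y xy; rewrite /edge /= !xy // !inE eqxx ?orbT.
have med j : measurable (edge j) := measurable_depends_on (dedge j).
have mu_edge j : mu (edge j) = 1%E.
  apply/eqP; rewrite eq_le; apply/andP; split; first exact: probability_le1.
  rewrite -mu_star; apply: le_measure; rewrite ?inE //; last by move=> x h; exact: h.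
  rewrite (_ : [set x | _] = \bigcap_(j in [set: 'I_d]) edge j).
    by apply: fin_bigcap_measurable.
  by apply/seteqP; split => x h; [move=> i _; exact: h|move=> i; exact: (h i)].
have [k1 _ h1] : \forall k \near \oo, forall s, (mu_ k (rt s) < (3 / 2 / #|S|%:R)%:E)%E.
  apply: filter_forall => s.
  have := weak_cvg_depends_on cv (drt s); rewrite mu_root => /fine_cvg/cvgr_lt.
  move=> /(_ (3 / 2 / #|S|%:R)) []; first by rewrite ltr_pMl ?invr_gt0 //; lra.
  move=> k0 _ H; exists k0 => // k /H /=; rewrite -lte_fin fineK // fin_num_measure //.
  exact: measurable_depends_on (drt s).
have [k2 _ h2] : \forall k \near \oo, forall j, ((1 - (320 * d)%N%:R^-1)%:E < mu_ k (edge j))%E.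
  apply: filter_forall => j.
  have := weak_cvg_depends_on cv (dedge j); rewrite mu_edge => /fine_cvg/cvgr_gt.
  move=> /(_ (1 - (320 * d)%N%:R^-1)) [].
    by rewrite ltrBlDr ltrDl invr_gt0 ltr0n muln_gt0 /= (leq_trans _ d3).
  by move=> k0 _ H; exists k0 => // k /H /=; rewrite -lte_fin fineK // fin_num_measure.
pose k := maxn k1 k2.
have {}h1 := h1 k (leq_maxl _ _); have {}h2 := h2 k (leq_maxr _ _).
have [f [rule [dO [Om [P [X [Y [iidX Yf law]]]]]]]] := fiid k.
have Y0 w : Y w (tree_root d) = f (relabel X id w) := Yf w _ tree_aut_id.
(* The letter i is the image of the root under the automorphism [vrmul i], which is used to move the
   root there. *)
have Yi w i : Y w (letter i) = f (relabel X (@vrmul d i) w).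
  by rewrite -vrmul_letter; exact: (Yf w _ (tree_aut_vrmul i)).
apply: (no_good_rule d3 iidX q_large cardS al_deg rule) => [s|i].
  apply: le_trans (ltW (h1 s)); rewrite law; last exact: measurable_depends_on (drt s).
  by rewrite le_eqVlt; apply/orP; left; apply/eqP; congr (P _); apply/seteqP; split => w; rewrite /rt /= Y0.
apply: (@le_trans _ _ (mu_ k (~` edge i))).
  rewrite law; last exact: measurableC.
  rewrite le_eqVlt; apply/orP; left; apply/eqP; congr (P _).
  by apply/seteqP; split => w; rewrite /edge /= Y0 Yi => /negP.
have -> : mu_ k (~` edge i) = (1 - mu_ k (edge i))%E by exact: probability_setC.
have := h2 i; have : mu_ k (edge i) \is a fin_num by exact: fin_num_measure.
case: (mu_ k (edge i)) => // x _; rewrite lte_fin -EFinB lee_fin; lra.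
Qed.

End NotWeakLimit.

(** * The moment kernel *)

(** In polynomial matrices (X - A)F = F(X - B), and the determinant of [F] is a nonzero constant
    polynomial that cancels. *)
Lemma char_poly_conj (K : fieldType) (n : nat) (A B F : 'M[K]_n) :
  F \in unitmx -> A *m F = F *m B -> char_poly A = char_poly B.
Proof.
move=> uF AF; pose FX := map_mx (polyC : K -> {poly K}) F.
have dF : \det FX != 0.
  by rewrite det_map_mx polyC_eq0 -unitfE -unitmxE.
apply: (mulIf dF); rewrite /char_poly -det_mulmx [RHS]mulrC -det_mulmx.
congr (\det _); rewrite /char_poly_mx mulmxBl mulmxBr.
by rewrite scalar_mxC -!map_mxM AF.
Qed.

Section SpectralRadius.
Variables (R : realType) (S : finType) (Q : S -> S -> R).
Local Notation C := R[i].

Lemma spectral_radius_diagonal (lam : 'I_#|S| -> C) (F : 'M[C]_#|S|)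
    (i0 : 'I_#|S|) (e : R) :
  F \in unitmx ->
  (\matrix_(i, j) (Q (enum_val i) (enum_val j))%:C%C) *m F =
    F *m diag_mx (\row_j lam j) ->
  lam i0 = 1 -> 0 < e -> (forall i, i != i0 -> ComplexField.Normc.normc (lam i) < e) ->
  spectral_radius Q < e.
Proof.
move=> uF QF l0 e0 le; rewrite /spectral_radius /eigenvalues.
set cp := char_poly _; case: closed_field_poly_normal => r /= hr.
have cpE : cp = \prod_(z <- [seq lam i | i <- enum 'I_#|S|]) ('X - z%:P).
  rewrite /cp (char_poly_conj uF QF) char_poly_trig ?diag_mx_is_trig //.
  rewrite big_map big_enum /=; apply: eq_bigr => i _.
  by rewrite !mxE eqxx mulr1n.
have pr : perm_eq r [seq lam i | i <- enum 'I_#|S|].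
  apply: prod_XsubC_eq; rewrite -cpE [RHS]hr (monicP _) ?scale1r //.
  by rewrite /cp char_poly_monic.
have pr' : perm_eq (rem 1 r) [seq lam i | i <- rem i0 (enum 'I_#|S|)].
  have i0e : i0 \in enum 'I_#|S| by rewrite mem_enum.
  have r1 : 1 \in r by rewrite (perm_mem pr) -l0 map_f.
  rewrite -(perm_cons 1); apply: (@perm_trans _ r).
    by rewrite perm_sym perm_to_rem.
  apply: (perm_trans pr).
  by rewrite -{1}l0 -map_cons perm_map // perm_to_rem.
rewrite big_seq; apply: bigmax_lt => // z.
rewrite (perm_mem pr') => /mapP[i ii ->]; apply: le.
by move: ii; rewrite mem_rem_uniq ?enum_uniq // !inE => /andP[].
Qed.

End SpectralRadius.

(** * Fourier analysis on the vector space of states *)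

Section Characters.
Variables (R : realType) (p : nat).
Hypothesis p_pr : prime p.
Local Notation C := R[i].
Local Notation F := 'F_p.

(** A root of 1 + X + ... + X^(p-1); it is not 1 because the value at 1 is p. *)
Lemma exists_root_of_unity : exists2 z : C, z ^+ p = 1 & z != 1.
Proof.
pose f : {poly C} := \poly_(i < p) 1.
have sf : size f = p.
  have := @size_poly_eq C p (fun=> 1); apply.
  by rewrite oner_eq0.
have [z] : exists z, root f z by apply/closed_rootP; rewrite sf gtn_eqF ?prime_gt1.
have fz : f.[z] = \sum_(i < p) z ^+ i.
  by rewrite horner_poly; apply: eq_bigr => i _; rewrite mul1r.
rewrite rootE fz => /eqP hz; exists z.
  by apply/eqP; rewrite -subr_eq0 subrX1 hz mulr0.
apply/eqP => z1; move: hz; rewrite z1 (eq_bigr (fun=> 1)) => [|i _]; last by rewrite expr1n.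
rewrite sumr_const card_ord => /eqP; rewrite pnatr_eq0.
by move: (prime_gt0 p_pr); case: (p).
Qed.

Variable z : C.
Hypothesis zp : z ^+ p = 1.
Hypothesis z1 : z != 1.

(** A nontrivial additive character of the prime field. *)
Definition chi (a : F) : C := z ^+ (nat_of_ord a).

Lemma chiD a b : chi (a + b) = chi a * chi b.
Proof.
rewrite /chi -exprD -[in RHS](expr_mod _ zp); congr (_ ^+ _) => /=.
by congr (_ %% _)%N; exact: Fp_cast.
Qed.

Lemma chi0 : chi 0 = 1. Proof. by []. Qed.

Lemma chi1 : chi 1 != 1.
Proof.
have : (1 : F) = 1%N :> nat by rewrite -[1 : F]/(1%:R) val_Fp_nat // modn_small ?prime_gt1.
by rewrite /chi => ->; rewrite expr1.
Qed.

(** Translation by [v] permutes the terms and multiplies the sum by [chi 1], which differs from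
    1. *)
Lemma sum_chi_eq0 (V : finZmodType) (f : V -> F) (v : V) :
  (forall u, f (u + v) = f u + 1) -> \sum_u chi (f u) = 0.
Proof.
move=> fv; set s := \sum_u _.
have : s = s * chi 1.
  rewrite {1}/s (reindex_inj (addIr v)) /= mulr_suml.
  by apply: eq_bigr => u _; rewrite fv chiD.
move=> /eqP; rewrite -subr_eq0 -{1}[s]mulr1 -mulrBr mulf_eq0 => /orP[/eqP //|].
by rewrite subr_eq0 eq_sym (negbTE chi1).
Qed.

Variable m : nat.
Hypothesis m0 : (0 < m)%N.
Hypothesis mp : (m <= p)%N.
Local Notation S := 'rV[F]_m.

Definition moment_step (s : S) (xy : F * F) : S := s + \row_(i < m) (xy.2 * xy.1 ^+ i).

Definition moment_kernel : S -> S -> R := step_kernel R moment_step.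

Definition dual (a s : S) : F := \sum_i a 0 i * s 0 i.

Lemma dualDr a s t : dual a (s + t) = dual a s + dual a t.
Proof. by rewrite -big_split; apply: eq_bigr => i _; rewrite mxE mulrDr. Qed.

Lemma dualDl a b s : dual (a + b) s = dual a s + dual b s.
Proof. by rewrite -big_split; apply: eq_bigr => i _; rewrite mxE mulrDl. Qed.

Lemma dual_delta (c : F) i s : dual (c *: delta_mx 0 i) s = c * s 0 i.
Proof.
rewrite /dual (bigD1 i) //= big1 ?addr0 => [|j ji]; rewrite !mxE eqxx.
  by rewrite eqxx mulr1.
by rewrite (negbTE ji) mulr0 mul0r.
Qed.

Lemma dual0r a : dual a 0 = 0.
Proof. by rewrite /dual big1 // => i _; rewrite mxE mulr0. Qed.

Lemma sum_chi_dual (s : S) :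
  \sum_a chi (dual a s) = if s == 0 then #|S|%:R else 0.
Proof.
case: eqP => [->|/eqP s0].
  by rewrite (eq_bigr (fun=> 1)) => [|a _]; rewrite ?dual0r ?chi0 // sumr_const.
have [i si] : exists i, s 0 i != 0 by apply/rV0Pn.
apply: (@sum_chi_eq0 _ _ ((s 0 i)^-1 *: delta_mx 0 i)) => a.
by rewrite dualDl dual_delta mulVf.
Qed.

Definition num_roots (a : S) : nat := #|[pred x : F | (rVpoly a).[x] == 0]|.

Definition lambda (a : S) : C := (num_roots a)%:R / p%:R.

Lemma dual_moment a (xy : F * F) :
  dual a (\row_(i < m) (xy.2 * xy.1 ^+ i)) = xy.2 * (rVpoly a).[xy.1].
Proof.
rewrite /rVpoly horner_poly mulr_sumr; apply: eq_bigr => i _.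
by rewrite mxE mulrCA valK.
Qed.

Lemma p_neq0 : p%:R != 0 :> C.
Proof. by rewrite pnatr_eq0 -lt0n prime_gt0. Qed.

Lemma sum_chi_mul (b : F) : \sum_(y : F) chi (y * b) = if b == 0 then p%:R else 0.
Proof.
case: eqP => [->|/eqP b0].
  rewrite (eq_bigr (fun=> 1)) => [|y _]; last by rewrite mulr0 chi0.
  by rewrite sumr_const card_Fp.
by apply: (@sum_chi_eq0 _ _ b^-1) => y; rewrite mulrDl mulVf.
Qed.

(** For fixed x the sum over y of a character of y P(x), with P the polynomial of coefficients [a],
    is p if x is a root of P and 0 otherwise. The average over (x, y) is therefore the share of
    roots. *)
Lemma moment_eigen a s :
  \sum_t (moment_kernel s t)%:C%C * chi (dual a t) = chi (dual a s) * lambda a.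
Proof.
have cG : #|{: F * F}| = (p * p)%N by rewrite card_prod card_Fp.
transitivity (\sum_(xy : F * F) chi (dual a (moment_step s xy)) / (p * p)%:R).
  rewrite (partition_big (moment_step s) predT) //=.
  apply: eq_bigr => t _; rewrite (eq_bigr (fun=> chi (dual a t) / (p * p)%:R)); last first.
    by move=> xy /eqP ->.
  rewrite sumr_const /moment_kernel /step_kernel cG rmorphM fmorphV /= !rmorph_nat.
  rewrite -[RHS]mulr_natl [RHS]mulrA [LHS]mulrAC; congr (_%:R * _ / _); exact: eq_card.
rewrite /moment_step -mulr_suml (eq_bigr (fun xy : F * F =>
   chi (dual a s) * chi (xy.2 * (rVpoly a).[xy.1]))); last first.
  by move=> xy _; rewrite dualDr chiD dual_moment.
rewrite -mulr_sumr -mulrA; congr (_ * _).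
rewrite -(pair_big predT predT (fun x y => chi (y * (rVpoly a).[x]))) /=.
rewrite (eq_bigr (fun x => if (rVpoly a).[x] == 0 then p%:R else 0)); last first.
  by move=> x _; exact: sum_chi_mul.
rewrite -big_mkcond sumr_const natrM invfM /lambda -[_ *+ #|_|]mulr_natl.
by rewrite -mulrA [p%:R * _]mulrA divff ?p_neq0 // mul1r.
Qed.

Lemma num_roots0 : num_roots 0 = p.
Proof.
rewrite -[RHS]card_Fp //; apply: eq_card => x; rewrite !inE /rVpoly.
by rewrite (_ : \poly_(_ < _) _ = 0) ?horner0 ?eqxx //; apply/polyP => k; rewrite coef_poly coef0; case: ifP => //; case: insub => // i; rewrite mxE.
Qed.

Lemma num_roots_lt a : a != 0 -> (num_roots a < m)%N.
Proof.
move=> a0; have f0 : rVpoly a != 0.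
  by apply: contraNneq a0 => h; rewrite -[a]rVpolyK h linear0.
rewrite /num_roots cardE; apply: leq_trans (size_poly m (fun k => if insub k is Some i then a 0 i else 0)).
apply: max_poly_roots => //; last exact: enum_uniq.
by apply/allP => x; rewrite mem_enum.
Qed.

Lemma lambda0 : lambda 0 = 1.
Proof. by rewrite /lambda num_roots0 divff ?p_neq0. Qed.

Lemma lambda_neq1 a : a != 0 -> lambda a != 1.
Proof.
move=> /num_roots_lt h; apply/eqP => /(congr1 (fun x => x * p%:R)).
rewrite /lambda divfK ?p_neq0 // mul1r => /eqP; rewrite eqr_nat => /eqP e.
by move: h; rewrite e ltnNge mp.
Qed.

Lemma normc_lambda a : a != 0 ->
  ComplexField.Normc.normc (lambda a) <= m%:R / p%:R.
Proof.
move=> /num_roots_lt/ltnW h.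
have -> : lambda a = ((num_roots a)%:R / p%:R : R)%:C%C.
  by rewrite /lambda rmorphM fmorphV /= !rmorph_nat.
rewrite /= expr0n /= addr0 sqrtr_sqr ger0_norm ?divr_ge0 //.
by rewrite ler_pM2r ?invr_gt0 ?ltr0n ?prime_gt0 // ler_nat.
Qed.

Let Fm : 'M[C]_#|S| := \matrix_(i, j) chi (dual (enum_val j) (enum_val i)).
Let Fi : 'M[C]_#|S| := \matrix_(j, k) chi (dual (enum_val j) (- enum_val k)).

Lemma fourier_inv : Fm *m Fi = #|S|%:R%:M.
Proof.
apply/matrixP => i k; rewrite !mxE.
transitivity (\sum_(a : S) chi (dual a (enum_val i - enum_val k))).
  rewrite [RHS](reindex_onto enum_val enum_rank) /=; last by move=> a _; exact: enum_rankK.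
  apply: eq_big => [j|j _]; first by rewrite enum_valK eqxx.
  by rewrite !mxE dualDr chiD.
rewrite sum_chi_dual subr_eq0 (inj_eq enum_val_inj).
by case: eqP => _; rewrite ?mulr1n ?mulr0n.
Qed.

Lemma cardS_neq0 : #|S|%:R != 0 :> C.
Proof. by rewrite pnatr_eq0 -lt0n; apply/card_gt0P; exists 0. Qed.

Lemma fourier_unit : Fm \in unitmx.
Proof.
have : Fm *m (#|S|%:R^-1 *: Fi) = 1%:M.
  by rewrite -scalemxAr fourier_inv -scalemx1 scalerA mulVf ?scale1r ?cardS_neq0.
by move=> /mulmx1_unit[].
Qed.

(** The characters form an invertible matrix of eigenvectors, so the numbers [lambda a] are all
    eigenvalues with multiplicity; the trivial character supplies the eigenvalue 1 that is
    removed. *)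
Lemma spectral_radius_moment (e : R) : 0 < e -> m%:R / p%:R < e ->
  spectral_radius moment_kernel < e.
Proof.
move=> e0 me.
apply: (@spectral_radius_diagonal _ _ _ (fun j => lambda (enum_val j)) Fm (enum_rank 0)) => //.
- exact: fourier_unit.
- apply/matrixP => i j; rewrite mul_mx_diag !mxE -moment_eigen.
  rewrite [RHS](reindex_onto enum_val enum_rank) /=; last by move=> a _; exact: enum_rankK.
  by apply: eq_big => [k|k _]; rewrite ?enum_valK ?eqxx // !mxE.
- by rewrite enum_rankK lambda0.
move=> i ii0; apply: le_lt_trans (normc_lambda _) me.
by apply: contraNneq ii0 => h; rewrite -h enum_valK.
Qed.

(** A step with (x, y) is undone by the step with (x, -y). *)
Lemma moment_kernel_sym s t : moment_kernel s t = moment_kernel t s.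
Proof.
rewrite /moment_kernel /step_kernel; congr (_%:R / _).
pose h (xy : F * F) := (xy.1, - xy.2).
have hK : involutive h by move=> [x y]; rewrite /h /= opprK.
rewrite -(card_imset _ (inv_inj hK)); apply: eq_card => xy.
rewrite inE; apply/imsetP/eqP => [[xy' + ->]|<-].
  rewrite inE => /eqP <-; rewrite /moment_step /h /= -addrA -[RHS]addr0; congr (_ + _).
  by apply/rowP => i; rewrite !mxE mulNr subrr.
exists (h xy); last by rewrite hK.
rewrite inE /moment_step /h /= -addrA -subr_eq0 addrAC subrr add0r; apply/eqP/rowP => i.
by rewrite !mxE mulNr subrr.
Qed.

Lemma moment_transition : transition_matrix moment_kernel.
Proof.
split => [s t|t]; first by rewrite divr_ge0.
have e : (\sum_s #|[pred xy | moment_step t xy == s]| = #|{: F * F}|)%N.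
  rewrite -[RHS]sum1_card (partition_big (moment_step t) predT) //=.
  by apply: eq_bigr => s _; rewrite -sum1_card; apply: eq_bigl => xy; rewrite inE.
rewrite /moment_kernel /step_kernel -mulr_suml -natr_sum e divff //.
by rewrite card_prod card_Fp // pnatr_eq0 -lt0n muln_gt0 prime_gt0.
Qed.

(** The theorem speaks of every reversible distribution, so uniqueness is required. A stationary
    distribution has Fourier coefficients satisfying h = h * [lambda a], and [lambda a] is not 1 for
    nontrivial [a]; only the constant coefficient survives. *)
Lemma moment_stationary (pi : S -> R) :
  reversible_distribution moment_kernel pi -> forall s, pi s = #|S|%:R^-1.
Proof.
move=> [_ sum1 rev].
have [_ sumQ] := moment_transition.
have stat t : \sum_s pi s * moment_kernel s t = pi t.
  rewrite (eq_bigr (fun s => pi t * moment_kernel t s)) => [|s _]; last exact: rev.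
  by rewrite -mulr_sumr sumQ mulr1.
pose hat (a : S) : C := \sum_s (pi s)%:C%C * chi (dual a s).
have hat0 a : a != 0 -> hat a = 0.
  move=> a0; have : hat a = hat a * lambda a.
    rewrite {1}/hat (eq_bigr (fun t => \sum_s (pi s)%:C%C * ((moment_kernel s t)%:C%C * chi (dual a t)))); last first.
      by move=> t _; rewrite -{1}stat rmorph_sum mulr_suml; apply: eq_bigr => s _; rewrite rmorphM mulrA.
    rewrite exchange_big /= /hat mulr_suml; apply: eq_bigr => s _.
    by rewrite -mulr_sumr moment_eigen mulrA.
  move=> /eqP; rewrite -subr_eq0 -{1}[hat a]mulr1 -mulrBr mulf_eq0 => /orP[/eqP //|].
  by rewrite subr_eq0 eq_sym (negbTE (lambda_neq1 a0)).
have inv s : #|S|%:R * (pi s)%:C%C = hat 0.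
  transitivity (\sum_a hat a * chi (dual a (- s))); last first.
    rewrite (bigD1 0) //= big1 ?addr0 => [|a a0]; last by rewrite hat0 // mul0r.
    by rewrite -[RHS]mulr1 /dual big1 // => i _; rewrite mxE mul0r.
  rewrite (eq_bigr (fun a => \sum_t (pi t)%:C%C * chi (dual a (t - s)))); last first.
    by move=> a _; rewrite mulr_suml; apply: eq_bigr => t _; rewrite dualDr chiD mulrA.
  rewrite exchange_big /= (bigD1 s) //= [X in _ + X]big1 ?addr0.
    by rewrite -mulr_sumr sum_chi_dual subrr eqxx mulrC.
  by move=> t ts; rewrite -mulr_sumr sum_chi_dual subr_eq0 (negbTE ts) mulr0.
have const s : pi s = pi 0.
  have := inv s; rewrite -(inv 0) => /(mulfI cardS_neq0) /complexI; exact.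
move=> s; have SR : #|S|%:R != 0 :> R by rewrite pnatr_eq0 -lt0n; apply/card_gt0P; exists 0.
apply: (mulfI SR); rewrite divff // -[RHS]sum1 (eq_bigr (fun=> pi s)) => [|t _].
  by rewrite sumr_const mulr_natl.
by rewrite const -(const s).
Qed.

Lemma moment_uniform : reversible_distribution moment_kernel (fun=> #|S|%:R^-1).
Proof.
have SR : #|S|%:R != 0 :> R by rewrite pnatr_eq0 -lt0n; apply/card_gt0P; exists 0.
split => [s||s t]; first by rewrite invr_ge0.
  by rewrite sumr_const -[_ *+ #|_|]mulr_natl divff.
by rewrite moment_kernel_sym.
Qed.

End Characters.

(** * The theorem *)

Section BranchingLocal.
Variables (R : realType) (d : nat) (S : pfinType) (G : finType) (nxt : S -> G -> S).
Local Notation Q := (step_kernel R nxt).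
Variables (pi : S -> R) (nu : process R d S).
Hypothesis nuQ : branching_markov Q pi nu.

Definition reachable (s t : S) : bool := [exists z, nxt s z == t].

Lemma card_reachable s : (#|reachable s| <= #|G|)%N.
Proof.
have sub : reachable s \subset [set nxt s z | z : G]%SET.
  apply/fintype.subsetP => t /existsP[z /eqP <-]; exact: imset_f.
exact: leq_trans (subset_leq_card sub) (leq_imset_card _ _).
Qed.

Lemma step_kernel_eq0 s t : ~~ reachable s t -> Q s t = 0.
Proof.
move=> nr; rewrite /step_kernel (_ : #|_| = 0%N) ?mul0r //.
apply: eq_card0 => z; rewrite !inE; apply: contraNF nr => h.
by apply/existsP; exists z.
Qed.

Lemma branching_root s : nu [set x | x (tree_root d) = s] = (pi s)%:E.
Proof.
have := @nuQ [:: tree_root d] isT (mem_head _ _) _ (fun=> s).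
rewrite big_cons big_nil eqxx /= mulr1 => <-.
  congr (nu _); apply/seteqP; split => x /=; first by move=> h v; rewrite inE => /eqP ->.
  by move=> h; apply: h; exact: mem_head.
by move=> v; rewrite inE => /eqP ->; rewrite inE; apply/eqP/val_inj.
Qed.

(** The complement is covered by the finitely many cylinders with some unreachable child, and each
    has a zero transition among its factors. *)
Lemma branching_star :
  nu [set x | forall j, reachable (x (tree_root d)) (x (letter j))] = 1%E.
Proof.
pose A : seq (vertex d) := tree_root d :: [seq letter j | j <- enum 'I_d].
pose x_ (p : S * {ffun 'I_d -> S}) (v : vertex d) : S :=
  if val v is j :: _ then p.2 j else p.1.
pose cyl p : set (config d (discrete S)) := [set y | forall v, v \in A -> y v = x_ p v].
pose star : set (config d (discrete S)) :=
  [set x | forall j, reachable (x (tree_root d)) (x (letter j))].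
have uA : uniq A.
  rewrite /= map_inj_uniq ?enum_uniq ?andbT; last by move=> i j /(congr1 val) [].
  by apply/mapP => -[j _ /(congr1 val)].
have pA v : v \in A -> parent v \in A.
  have pr : parent (tree_root d) = tree_root d by exact: val_inj.
  have pl j : parent (letter j) = tree_root d by exact: val_inj.
  rewrite inE => /orP[/eqP ->|/mapP[j _ ->]]; first by rewrite pr mem_head.
  by rewrite pl mem_head.
have cyl0 (p : S * {ffun 'I_d -> S}) j : ~~ reachable p.1 (p.2 j) -> nu (cyl p) = 0%E.
  move=> nr; have -> := @nuQ A uA (mem_head _ _) pA (x_ p).
  have jA : letter j \in A by rewrite inE map_f ?orbT // mem_enum.
  rewrite (big_rem _ jA) (_ : letter j != tree_root d) //=.
  by rewrite step_kernel_eq0 // mul0r mulr0.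
have dep p : depends_on A (cyl p) by move=> x y xy h v vA; rewrite -xy //; exact: h.
have mcyl p : measurable (cyl p) := measurable_depends_on (dep p).
have dstar : depends_on A star.
  move=> x y xy h j; rewrite -(xy (tree_root d)) ?mem_head // -(xy (letter j)).
    exact: h.
  by rewrite inE map_f ?orbT // mem_enum.
have mstar : measurable star := measurable_depends_on dstar.
have nstar : nu (~` star) = 0%E.
  apply/eqP; rewrite eq_le measure_ge0 andbT.
  apply: (@le_trans _ _ (nu (\big[setU/set0]_(p : S * {ffun 'I_d -> S} | ~~ [forall j, reachable p.1 (p.2 j)]) cyl p))).
    apply: le_measure; [by apply/mem_set; exact: measurableC| |].
      by apply/mem_set; apply: bigsetU_measurable.
    move=> x nx; rewrite -bigcup_seq_cond.
    pose x' : vertex d -> S := x.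
    exists (x' (tree_root d), [ffun j => x' (letter j)]).
      rewrite /= mem_index_enum /=; apply: contra_notN nx => /forallP h j.
      by have := h j; rewrite ffunE.
    move=> v; rewrite inE => /orP[/eqP ->//|/mapP[j _ ->]].
    by rewrite /x_ /= ffunE.
  apply: le_trans (measure_big_setU_le nu _ _ mcyl) _.
  rewrite big1 // => p; rewrite negb_forall => /existsP[j]; exact: cyl0.
have : nu (~` star) = (1 - nu star)%E by exact: probability_setC.
rewrite nstar; have : nu star \is a fin_num by exact: fin_num_measure.
by case: (nu star) => // x _ /eqP; rewrite -EFinB eqe eq_sym subr_eq0 => /eqP <-.
Qed.

End BranchingLocal.

Definition moment_state (p : nat) : Type := 'rV['F_p]_10.
HB.instance Definition _ (p : nat) := Finite.on (moment_state p).
HB.instance Definition _ (p : nat) := isPointed.Build (moment_state p) 0.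

Theorem theorem5 (R : realType) (d : nat) (hd : (3 <= d)%N)
    (eps : R) (heps : 0 < eps) :
  exists (S : pfinType) (Q : S -> S -> R),
  [/\ transition_matrix Q,
      (exists pi : S -> R, reversible_distribution Q pi),
      spectral_radius Q < eps
    & forall pi : S -> R, reversible_distribution Q pi ->
      exists nu : process R d S,
      [/\ branching_markov Q pi nu,
          ~ typical nu
        & ~ weak_limit_of_fiid nu]].
Proof.
have [q0 rare] := good_graphs_rare R hd.
pose b1 := Num.bound (expR (7 * d%:R) : R); pose b2 := Num.bound (10 / eps : R).
(* The prime exceeds four thresholds: [q0] for the count of regular graphs, 10 so that a nonzero
   polynomial of degree at most 9 cannot vanish on the whole field, [b1] for the count of lifts, and
   [b2] for the bound 10/q < eps on the spectral radius. *)
have [q qb q_pr] := prime_above (maxn (maxn q0 10) (maxn b1 b2)).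
move: qb; rewrite !gtn_max => /andP[/andP[qq0 q10] /andP[qb1 qb2]].
have q_large : expR (7 * d%:R) < q%:R :> R.
  apply: lt_le_trans (archi_boundP (expR_ge0 _)) _.
  by rewrite ler_nat ltnW.
have eps_large : 10%:R / q%:R < eps.
  have qR : 0 < q%:R :> R by rewrite ltr0n (leq_trans _ q10).
  rewrite ltr_pdivrMr // mulrC -ltr_pdivrMr //.
  apply: lt_le_trans (archi_boundP _) _; first by rewrite divr_ge0 // ltW.
  by rewrite ler_nat ltnW.
pose S : pfinType := moment_state q.
have [z zq z1] := exists_root_of_unity R q_pr.
have q10' : (10 <= q)%N := ltnW q10.
pose G : finType := ('F_q * 'F_q)%type.
pose nxt : S -> G -> S := @moment_step q 10.
have cardS : #|S| = (q ^ 10)%N.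
  by rewrite [LHS](card_mx 'F_q 1 10) card_Fp // mul1n.
have cardG : #|G| = (q ^ 2)%N by rewrite card_prod card_Fp // mulnn.
have deg s : (#|reachable nxt s| <= q ^ 2)%N by rewrite -cardG; exact: card_reachable.
exists S, (@moment_kernel R q 10 : S -> S -> R); split.
- exact: moment_transition.
- by exists (fun=> #|S|%:R^-1); exact: moment_uniform.
- exact: (spectral_radius_moment q_pr zq z1).
move=> pi /(moment_stationary q_pr zq z1 q10') piE.
have [nu nuQ] := @branching_markov_exists R d S G (0, 0) nxt.
exists nu; have -> : pi = fun=> #|S|%:R^-1 by apply/funext.
have root := branching_root nuQ; have star := branching_star nuQ.
split; first exact: nuQ.
  apply: (@not_typical R d S (reachable nxt) nu) => //.
    exact: leq_trans hd.
  exact: (rare q (ltnW qq0) S (reachable nxt)).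
exact: (not_weak_limit hd q_large cardS deg root star).
Qed.
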